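(* Let $d, j \in \mathbb{N}$, let $q = 1$ or $q = 2$, and let $\alpha \in (-d/q, 0)$. Let $f$ be a probability density function on $\mathbb{R}^d$ and suppose $f$ is bounded. Then, as $n \to \infty$, $$ n^{-1} S_{n,\alpha} \to \omega_d^{-\alpha/d} \left( \frac{\Gamma(j+\alpha/d)}{\Gamma(j)} \right) I_{1-\alpha/d}(f) $$ with convergence in $L^q$.
   Context: $\mathbb{N} = \{1,2,\ldots\}$. For a finite set $\mathcal{X} \subset \mathbb{R}^d$ and $x \in \mathcal{X}$, $D(x,\mathcal{X}) = D_j(x,\mathcal{X})$ denotes the Euclidean distance from $x$ to its $j$th nearest neighbor in $\mathcal{X} \setminus \{x\}$ if $\mathrm{card}(\mathcal{X}) > j$, and $D(x,\mathcal{X}) := 0$ if $\mathrm{card}(\mathcal{X}) \le j$. $(X_i)_{i \in \mathbb{N}}$ is a sequence of independent random vectors in $\mathbb{R}^d$ with common density $f$, $\mathcal{X}_n := \{X_1,\ldots,X_n\}$, and $$S_{n,\alpha} := \sum_{i=1}^n (n^{1/d} D(X_i,\mathcal{X}_n))^{\alpha}$$ (since $\alpha<0$, only $n > j$ is relevant; the statement is asymptotic in $n$). $\omega_d := \pi^{d/2}/\Gamma(1+d/2)$ is the volume of the unit ball in $\mathbb{R}^d$. For $\rho > 0$, $I_\rho(f) := \int_{\mathbb{R}^d} f(y)^\rho\, dy$. *)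

(* Defs.v *)
From HB Require Import structures.
From mathcomp Require Import all_boot all_order all_algebra finmap.
From mathcomp Require Import all_classical all_reals all_analysis.

Set Implicit Arguments.
Unset Strict Implicit.
Unset Printing Implicit Defensive.

Import Order.TTheory GRing.Theory Num.Theory.
Import numFieldNormedType.Exports.

Local Open Scope classical_set_scope.
Local Open Scope ring_scope.

(* R^d is [d.-tuple R], which carries the product of the Borel sigma-algebras
   of the coordinates, i.e. the Borel sigma-algebra of R^d. *)

Section lebesgue_Rd.
Local Open Scope ereal_scope.
Context {R : realType}.

Definition consRd (d : nat) (p : R * d.-tuple R) : d.+1.-tuple R :=
  [tuple of p.1 :: p.2].

(* Iterated product measure, transported along [R * R^d ~ R^(d+1)]; see
   [lebesgue_Rd_box] below for its value on boxes. *)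
Fixpoint lebesgue_Rd (d : nat) : set (d.-tuple R) -> \bar R :=
  match d with
  | 0%N => dirac [tuple]
  | d'.+1 => pushforward (lebesgue_measure \x @lebesgue_Rd d') (@consRd d')
  end.
Arguments lebesgue_Rd : clear implicits.

Lemma measurable_consRd d : measurable_fun [set: R * d.-tuple R] (@consRd d).
Proof. by apply: measurable_cons. Qed.

Lemma measurable_unconsRd d :
  measurable_fun [set: d.+1.-tuple R] (fun x => (thead x, [tuple of behead x])).
Proof.
apply/measurable_fun_pairP; split.
  exact: measurable_tnth.
exact: measurable_behead.
Qed.

Section cons_measure.
Variables (d : nat) (m : {sigma_finite_measure set (d.-tuple R) -> \bar R}).

Let nu : set (d.+1.-tuple R) -> \bar R :=
  pushforward (lebesgue_measure \x m) (@consRd d).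

Let measurable_cons_preimage (A : set (d.+1.-tuple R)) :
  measurable A -> measurable (@consRd d @^-1` A).
Proof.
by move=> mA; rewrite -[X in measurable X]setTI; exact: measurable_consRd.
Qed.

Let nu0 : nu set0 = 0.
Proof. by rewrite /nu /pushforward preimage_set0 measure0. Qed.

Let nu_ge0 A : 0 <= nu A.
Proof. exact: (@measure_ge0 _ _ _ (lebesgue_measure \x m)). Qed.

Let nu_sigma_additive : semi_sigma_additive nu.
Proof.
move=> F mF tF mUF; rewrite /nu /pushforward preimage_bigcup.
apply: (@measure_semi_sigma_additive _ _ _ (lebesgue_measure \x m)).
- by move=> n; exact: measurable_cons_preimage.
- apply/trivIsetP => /= i j _ _ ij; rewrite -preimage_setI.
  by move/trivIsetP : tF => /(_ _ _ _ _ ij) ->//; rewrite preimage_set0.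
- by rewrite -preimage_bigcup; exact: measurable_cons_preimage.
Qed.

HB.instance Definition _ := isMeasure.Build _ _ _ nu nu0 nu_ge0
  nu_sigma_additive.

Let nu_sigma_finite : sigma_finite setT nu.
Proof.
pose mu1 : {sigma_finite_measure set (measurableTypeR R) -> \bar R} :=
  lebesgue_measure.
have /sigma_finiteP[F [TF ndF Foo]] := sigma_finiteT mu1.
have /sigma_finiteP[G [TG ndG Goo]] := sigma_finiteT m.
pose uncons (x : d.+1.-tuple R) := (thead x, [tuple of behead x]).
have consK : uncons \o @consRd d = id.
  apply/funext => -[x t]; rewrite /uncons/=; congr pair.
  exact: val_inj.
exists (fun k => uncons @^-1` (F k `*` G k)).
  rewrite -preimage_bigcup (_ : \bigcup_k _ = setT) ?preimage_setT//.
  rewrite -setXTT TF TG predeqE => -[x y]; split.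
    by move=> [n _ []/= ? ?]; split; exists n.
  move=> [/= [n _ Fnx] [k _ Gky]]; exists (maxn n k) => //; split.
  - by move: x Fnx; exact/subsetPset/ndF/leq_maxl.
  - by move: y Gky; exact/subsetPset/ndG/leq_maxr.
move=> k; have [? ?] := Foo k; have [? ?] := Goo k; split.
  rewrite -[X in measurable X]setTI; apply: measurable_unconsRd => //.
  exact: measurableX.
rewrite /nu /pushforward -comp_preimage consK preimage_id.
by rewrite (product_measure1E mu1)// lte_mul_pinfty// ge0_fin_numE.
Qed.

HB.instance Definition _ := Measure_isSigmaFinite.Build _ _ _ nu
  nu_sigma_finite.

Definition cons_measure : {sigma_finite_measure set _ -> \bar R} := nu.

End cons_measure.

Lemma lebesgue_Rd_sigma_finite_measure d :
  exists m : {sigma_finite_measure set (d.-tuple R) -> \bar R},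
    (m : set _ -> \bar R) = lebesgue_Rd d.
Proof.
elim: d => [|d [m mE]].
  by exists (dirac ([tuple] : 0.-tuple R)).
by exists (cons_measure m); rewrite /= -mE.
Qed.

Section instances.
Variable d : nat.

Let lebesgue_Rd0 : lebesgue_Rd d set0 = 0.
Proof.
by have [m <-] := lebesgue_Rd_sigma_finite_measure d; rewrite measure0.
Qed.

Let lebesgue_Rd_ge0 A : 0 <= lebesgue_Rd d A.
Proof.
by have [m <-] := lebesgue_Rd_sigma_finite_measure d; rewrite measure_ge0.
Qed.

Let lebesgue_Rd_sigma_additive : semi_sigma_additive (lebesgue_Rd d).
Proof.
have [m <-] := lebesgue_Rd_sigma_finite_measure d.
exact: measure_semi_sigma_additive.
Qed.

HB.instance Definition _ := isMeasure.Build _ _ _ (lebesgue_Rd d)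
  lebesgue_Rd0 lebesgue_Rd_ge0 lebesgue_Rd_sigma_additive.

Let lebesgue_Rd_sigma_finite : sigma_finite setT (lebesgue_Rd d).
Proof.
by have [m <-] := lebesgue_Rd_sigma_finite_measure d; exact: sigma_finiteT.
Qed.

HB.instance Definition _ := Measure_isSigmaFinite.Build _ _ _ (lebesgue_Rd d)
  lebesgue_Rd_sigma_finite.

End instances.

Lemma lebesgue_Rd_box d (A : 'I_d -> set R) :
  (forall i, measurable (A i)) ->
  lebesgue_Rd d [set x | forall i, A i (tnth x i)] =
  \prod_(i < d) lebesgue_measure (A i).
Proof.
elim: d A => [|d ih] A mA.
  by rewrite big_ord0 /= diracE mem_set// => -[].
rewrite big_ord_recl -ih//= /pushforward.
have [m <-] := lebesgue_Rd_sigma_finite_measure d.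
set B := (X in _ = _ * m X).
have mB : measurable B.
  rewrite (_ : B =
      \bigcap_(i in [set: 'I_d]) ((@tnth _ R)^~ i @^-1` A (lift ord0 i))).
    apply: fin_bigcap_measurable => // i _.
    by rewrite -[X in measurable X]setTI; exact: measurable_tnth.
  by apply/seteqP; split => [x Ax i _|x Ax i]; exact: Ax.
rewrite -(product_measure1E lebesgue_measure)//; last exact: mA.
congr product_measure1.
apply/seteqP; split => [[x t]/= Axt|[x t]/= [Ax At] i].
  split; first exact: (Axt ord0).
  by move=> i; have := Axt (lift ord0 i); rewrite /consRd/= tnthS.
case: (unliftP ord0 i) => [k ->|->//].
by rewrite /consRd/= tnthS.
Qed.

End lebesgue_Rd.
Arguments lebesgue_Rd {R} d A : simpl never.

Section constants.
Context {R : realType}.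

Definition Gamma_fun (x : R) : R :=
  \int[lebesgue_measure]_(t in `]0, +oo[) (t `^ (x - 1) * expR (- t)).

Definition unit_ball_volume (d : nat) : R :=
  pi `^ (d%:R / 2) / Gamma_fun (1 + d%:R / 2).

Definition I_rho (d : nat) (rho : R) (f : d.-tuple R -> R) : R :=
  \int[lebesgue_Rd d]_y (f y `^ rho).

End constants.

Section nearest_neighbors.
Context {R : realType} {d : nat}.
Implicit Types (x y : d.-tuple R) (A : {fset d.-tuple R}).

Definition euclidean_dist x y : R :=
  Num.sqrt (\sum_(i < d) (tnth x i - tnth y i) ^+ 2).

(* The distances are listed with one occurrence for each point of [A `\ x];
   the j-th nearest neighbor has index [j.-1]. *)
Definition nn_dist (j : nat) x A : R :=
  if (j < #|` A|)%N then
    nth 0 (sort <=%R [seq euclidean_dist x y | y <- (A `\ x)%fset]) j.-1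
  else 0.

End nearest_neighbors.

Section probability_notions.
Local Open Scope ereal_scope.
Context {disp} {Omega : measurableType disp} {R : realType}.
Variable P : probability Omega R.

Definition pdf_Rd (d : nat) (f : d.-tuple R -> R) : Prop :=
  [/\ measurable_fun setT f, (forall y, (0 <= f y)%R) &
      \int[lebesgue_Rd d]_y (f y)%:E = 1].

Definition has_density (d : nat) (X : {RV P >-> d.-tuple R})
    (f : d.-tuple R -> R) : Prop :=
  forall A : set (d.-tuple R), measurable A ->
    distribution P X A = \int[lebesgue_Rd d]_(y in A) (f y)%:E.

Definition mutually_independent d' (T : measurableType d') (I : choiceType)
    (X : I -> {RV P >-> T}) : Prop :=
  forall (J : {fset I}) (A : I -> set T), (forall i, measurable (A i)) ->
    P (\bigcap_(i in [set` J]) (X i @^-1` A i)) =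
    \prod_(i <- J) P (X i @^-1` A i).

(* [Lnorm] is defined for arbitrary functions, so that membership in L^p, and
   measurability in particular, has to be required separately. *)
Definition cvg_in_Lp (p : R) (Y : (Omega -> R)^nat) (Z : Omega -> R) : Prop :=
  [/\ \forall n \near \oo, Y n \in Lfun P p%:E,
      Z \in Lfun P p%:E &
      'N[P]_p%:E [EFin \o (Y n \- Z)%R] @[n --> \oo] --> 0].

End probability_notions.

Section statistic.
Context {disp} {Omega : measurableType disp} {R : realType}.
Context {P : probability Omega R} {d : nat}.
Variables (j : nat) (alpha : R) (X : nat -> {RV P >-> d.-tuple R}).

(* The sequence is indexed from 0. *)
Definition sample (n : nat) (w : Omega) : {fset d.-tuple R} :=
  [fset X i w | i in iota 0 n]%fset.

(* The points are almost surely distinct when they have a density, so that for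
   [j < n] the convention [0 `^ alpha = 0] of [powR] for [alpha < 0] only
   matters on a negligible event; for [n <= j] it makes the sum equal to 0. *)
Definition nn_stat (n : nat) (w : Omega) : R :=
  \sum_(i < n)
    (n%:R `^ (d%:R^-1) * nn_dist j (X i w) (sample n w)) `^ alpha.

End statistic.

(* Main.v *)
Require Import Defs.
From HB Require Import structures.
From mathcomp Require Import all_boot all_order all_algebra finmap.
From mathcomp Require Import all_classical all_reals all_analysis.
From mathcomp Require Import measurable_realfun ring lra.

(* Layer cake: n^-1 S_n is the integral over t > 0 of the fraction Z_n(t) of
   the points with (n^(1/d) D_i)^alpha > t, that is, with at least j other
   points within distance t^(1/alpha) n^(-1/d).  The numbers of points of an
   i.i.d. sample in disjoint sets are negatively associated, so Var Z_n(t)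
   tends to 0, while E Z_n(t) tends to z(t), the mean under f of a Poisson tail
   with parameter omega_d t^(d/alpha) f(X); this uses that the ball averages of
   f converge to f in L^1.  Since f is bounded, E|Z_n(t) - z(t)| is at most
   min(1, C t^(d/alpha)) with d/alpha < -q.  With W the integral of
   |Z_n - z| <= 1 one has W^2 <= 4 int t |Z_n(t) - z(t)| dt, so dominated
   convergence gives the L^q limit int z(t) dt, and Tonelli evaluates it.
   The value omega_d of the volume of the unit ball comes from integrating
   exp(-|x|^2) over R^d by layers. *)

Set Implicit Arguments.
Unset Strict Implicit.
Unset Printing Implicit Defensive.

Import Order.TTheory GRing.Theory Num.Theory.
Import numFieldNormedType.Exports.

Local Open Scope classical_set_scope.
Local Open Scope ring_scope.

(** * Binomial and Poisson tails *)

(** Once two sample points are at least two radii apart, their balls are disjoint and, given both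
    points, the counts of the remaining points in these balls are jointly trinomial; a closer pair
    has probability O(1/n) because [f] is bounded. Bounding the second moment requires only an upper
    bound on pair probabilities, which is why negative association is enough. Laws are always
    reached by integrating out one sample point at a time, and the tails are defined by the matching
    recursions. Ball averages enter in L^1 because the tails are Lipschitz in their parameter and
    integration against the law of a point costs at most the factor [M] over Lebesgue measure. For q
    = 2, expanding the square of an integral over levels would involve two levels at once. Bounding
    the square by a weighted integral keeps one level at a time, so both values of q reduce to the
    mean absolute deviation at level t with weight t^(q-1). This weight times t^(d/alpha) is
    integrable at infinity exactly when alpha > -d/q. *)

Section binomial_tail.
Context {R : realType}.
Implicit Types (p q l : R) (n j k : nat).

(** The probability that a binomial variable with parameters [n] and [p] is less than [j], by
    conditioning on one trial. *)
Fixpoint binom_tail p n j : R :=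
  match j, n with
  | 0%N, _ => 0
  | _.+1, 0%N => 1
  | i.+1, m.+1 => p * binom_tail p m i + (1 - p) * binom_tail p m j
  end.

(** In [n] trials with outcomes of probabilities [p], [q] and [1 - p - q], the probability that the
    first outcome occurs less than [j] times and the second less than [k] times. *)
Fixpoint trinom_tail p q n j k : R :=
  match j, k, n with
  | 0%N, _, _ => 0
  | _, 0%N, _ => 0
  | _, _, 0%N => 1
  | j'.+1, k'.+1, m.+1 => p * trinom_tail p q m j' k
     + q * trinom_tail p q m j k' + (1 - p - q) * trinom_tail p q m j k
  end.

Lemma binom_tail0 p n : binom_tail p n 0 = 0. Proof. by case: n. Qed.

Lemma binom_tailS p n j : binom_tail p n.+1 j.+1 =
  p * binom_tail p n j + (1 - p) * binom_tail p n j.+1.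
Proof. by []. Qed.

Lemma trinom_tail0l p q n k : trinom_tail p q n 0 k = 0.
Proof. by case: n. Qed.

Lemma trinom_tail0r p q n j : trinom_tail p q n j 0 = 0.
Proof. by case: n; case: j. Qed.

Lemma trinom_tailS p q n j k : trinom_tail p q n.+1 j.+1 k.+1 =
  p * trinom_tail p q n j k.+1 + q * trinom_tail p q n j.+1 k
  + (1 - p - q) * trinom_tail p q n j.+1 k.+1.
Proof. by []. Qed.

(** An outcome of probability 0 never occurs, so the threshold 1 on its count is no constraint.
    Statements on one count thus become special cases of statements on two. *)
Lemma trinom_tail_binom p n j : trinom_tail p 0 n j 1 = binom_tail p n j.
Proof.
elim: n j => [|n ih] [|j] //.
by rewrite trinom_tailS binom_tailS !ih; ring.
Qed.

Lemma binom_tail_ge0 p n j : 0 <= p <= 1 -> 0 <= binom_tail p n j.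
Proof.
move=> /andP[p0 p1]; elim: n j => [|n ih] [|j]//.
by rewrite binom_tailS addr_ge0// mulr_ge0// subr_ge0.
Qed.

Lemma binom_tail_le1 p n j : 0 <= p <= 1 -> binom_tail p n j <= 1.
Proof.
move=> /andP[p0 p1]; elim: n j => [|n ih] [|j]//.
rewrite binom_tailS [leRHS](_ : _ = p * 1 + (1 - p) * 1); last by ring.
by rewrite lerD// ler_wpM2l// subr_ge0.
Qed.

Lemma binom_tail_leS p n j : 0 <= p <= 1 ->
  binom_tail p n j <= binom_tail p n j.+1.
Proof.
move=> p01; have /andP[p0 p1] := p01; elim: n j => [|n ih] [|j]//.
  by rewrite binom_tail0 binom_tail_ge0.
by rewrite !binom_tailS lerD// ler_wpM2l// subr_ge0.
Qed.

Lemma trinom_tail_ge0 p q n j k : 0 <= p -> 0 <= q -> p + q <= 1 ->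
  0 <= trinom_tail p q n j k.
Proof.
move=> p0 q0 pq1; elim: n j k => [|n ih] [|j] [|k]//.
by rewrite trinom_tailS !addr_ge0// mulr_ge0//; lra.
Qed.

(* Negative association of the two counts. *)
Lemma trinom_tail_le p q n j k : 0 <= p -> 0 <= q -> p + q <= 1 ->
  trinom_tail p q n j k <= binom_tail p n j * binom_tail q n k.
Proof.
move=> p0 q0 pq1.
have p01 : 0 <= p <= 1 by apply/andP; split=> //; lra.
have q01 : 0 <= q <= 1 by apply/andP; split=> //; lra.
elim: n j k => [|n ih] [|j] [|k]; rewrite ?trinom_tail0l ?trinom_tail0r
  ?binom_tail0 ?mul0r ?mulr0//=; first by rewrite mulr1.
rewrite -/(binom_tail p n j) -/(binom_tail q n k) -/(binom_tail p n j.+1)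
  -/(binom_tail q n k.+1).
have := ih j k.+1; have := ih j.+1 k; have := ih j.+1 k.+1.
have := binom_tail_leS n j p01; have := binom_tail_leS n k q01.
move: (binom_tail p n j) (binom_tail p n j.+1) => a a'.
move: (binom_tail q n k) (binom_tail q n k.+1) => b b'.
move: (trinom_tail p q n j k.+1) (trinom_tail p q n j.+1 k) => x y.
move: (trinom_tail p q n j.+1 k.+1) => z bb aa zab yab xab.
have h1 : p * x <= p * (a * b') by rewrite ler_wpM2l.
have h2 : q * y <= q * (a' * b) by rewrite ler_wpM2l.
have h3 : (1 - p - q) * z <= (1 - p - q) * (a' * b').
  by rewrite ler_wpM2l//; lra.
(* After the induction hypotheses it remains to compare products, and the right side exceeds the
   left by exactly this quantity. *)
have h4 : 0 <= p * q * ((a' - a) * (b' - b)).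
  by rewrite mulr_ge0// ?mulr_ge0// ?subr_ge0.
by nra.
Qed.

(** Changing the success probability of one trial moves the tail by at most [|p - p'|], since the
    two tails that it mixes differ by at most 1. *)
Lemma binom_tail_lip p p' n j : 0 <= p <= 1 -> 0 <= p' <= 1 ->
  `|binom_tail p n j - binom_tail p' n j| <= n%:R * `|p - p'|.
Proof.
move=> p01 p'01; have /andP[p0 p1] := p01.
elim: n j => [|n ih] [|j]; rewrite ?binom_tail0 ?subrr ?normr0 ?mul0r//.
rewrite !binom_tailS.
set a := binom_tail p n j; set a' := binom_tail p n j.+1.
set b := binom_tail p' n j; set b' := binom_tail p' n j.+1.
rewrite (_ : _ - _ = p * (a - b) + (1 - p) * (a' - b') + (p - p') * (b - b'));
  last by ring.
have bb : `|b - b'| <= 1.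
  rewrite distrC ger0_norm ?subr_ge0 ?binom_tail_leS//.
  by rewrite lerBlDr (le_trans (binom_tail_le1 _ _ _))// lerDl binom_tail_ge0.
rewrite (le_trans (ler_normD _ _))//.
rewrite [leRHS](_ : _ = n%:R * `|p - p'| + `|p - p'|); last first.
  by rewrite -natr1; ring.
rewrite lerD//.
  rewrite (le_trans (ler_normD _ _))// !normrM (ger0_norm p0).
  rewrite (ger0_norm (_ : 0 <= 1 - p)) ?subr_ge0//.
  rewrite (_ : n%:R * _ = p * (n%:R * `|p - p'|) + (1 - p) * (n%:R * `|p - p'|));
    last by ring.
  by apply: lerD; rewrite ler_wpM2l ?subr_ge0//; exact: ih.
by rewrite normrM ler_piMr.
Qed.

Lemma binom_tail_p0 n j : binom_tail 0 n j.+1 = 1 :> R.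
Proof. by elim: n => [//|n ih]; rewrite binom_tailS ih; ring. Qed.

(** The union bound for having any success at all, read off from the Lipschitz bound at success
    probability 0. *)
Lemma binom_tail_ge p n j : 0 <= p <= 1 -> 1 - binom_tail p n j.+1 <= n%:R * p.
Proof.
move=> p01; have /andP[p0 p1] := p01.
rewrite -[X in X - _](binom_tail_p0 n j) (le_trans (ler_norm _))//.
rewrite (le_trans (binom_tail_lip _ _ _ p01))//; first by rewrite lexx ler01.
by rewrite sub0r normrN ger0_norm.
Qed.

(** The probability that a Poisson variable with mean [l] is less than [j]. *)
Definition poisson_tail j l : R := \sum_(i < j) expR (- l) * l ^+ i / i`!%:R.

Lemma poisson_tail0 l : poisson_tail 0 l = 0. Proof. exact: big_ord0. Qed.

Lemma poisson_tailS j l :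
  poisson_tail j.+1 l = poisson_tail j l + expR (- l) * l ^+ j / j`!%:R.
Proof. exact: big_ord_recr. Qed.

Lemma poisson_tail_at0 j : poisson_tail j.+1 0 = 1.
Proof.
rewrite /poisson_tail big_ord_recl /= big1 ?addr0.
  by rewrite oppr0 expR0 expr0 fact0 mulr1 divr1.
by move=> i _; rewrite expr0n/= mulr0 mul0r.
Qed.

Lemma poisson_tail_ge0 j l : 0 <= l -> 0 <= poisson_tail j l.
Proof.
move=> l0; apply: sumr_ge0 => i _.
by rewrite divr_ge0// mulr_ge0 ?expR_ge0 ?exprn_ge0.
Qed.

(** The derivatives of consecutive Poisson masses telescope and leave only the last mass. *)
Lemma is_derive_poisson_tail j l :
  is_derive l 1 (poisson_tail j.+1) (- (expR (- l) * l ^+ j / j`!%:R)).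
Proof.
have expRN : is_derive l 1 (fun l : R => expR (- l)) (- expR (- l)).
  by apply: is_derive_eq; rewrite mulrN1.
elim: j => [|j ih].
  rewrite (_ : poisson_tail 1 = fun l => expR (- l)).
    by apply: is_derive_eq; rewrite expr0 fact0 divr1 mulr1.
  apply/funext => x; rewrite poisson_tailS poisson_tail0 add0r.
  by rewrite expr0 fact0 divr1 mulr1.
have dX := is_deriveX j.+1 (is_derive_id l (1 : R)).
have d := is_deriveD ih (is_deriveZ (j.+1)`!%:R^-1 (is_deriveM expRN dX)).
rewrite (_ : poisson_tail j.+2 = poisson_tail j.+1 +
    ((j.+1)`!%:R^-1 \*: ((fun l : R => expR (- l)) * (id ^+ j.+1)))).
  apply: is_derive_eq; rewrite /GRing.scale/= !fctE factS natrM exprS.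
  have fj : j`!%:R != 0 :> R by rewrite pnatr_eq0 -lt0n fact_gt0.
  have j1 : j.+1%:R != 0 :> R by [].
  by move: (j.+1%:R) (j`!%:R) fj j1 => a b b0 a0; field; rewrite a0 b0.
by apply/funext => x; rewrite poisson_tailS !fctE /= [in RHS]/GRing.scale/= mulrC.
Qed.

Lemma poisson_tail_mvt j l l' : l < l' ->
  exists2 x, l < x < l' & poisson_tail j.+1 l' - poisson_tail j.+1 l =
    - (expR (- x) * x ^+ j / j`!%:R) * (l' - l).
Proof.
move=> ll'.
have [x xl xE] := @MVT _ (poisson_tail j.+1) (fun l => - (expR (- l) * l ^+ j / j`!%:R))
  l l' ll' (fun x _ => is_derive_poisson_tail j x)
  (derivable_within_continuous (fun x _ =>
    @ex_derive _ _ _ _ _ _ _ (is_derive_poisson_tail j x))).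
by exists x => //; move: xl; rewrite in_itv.
Qed.

Lemma poisson_tail_le1 j l : 0 <= l -> poisson_tail j l <= 1.
Proof.
move=> l0; elim: j l l0 => [|j ih] l l0; first by rewrite poisson_tail0.
have [->|lneq0] := eqVneq l 0; first by rewrite poisson_tail_at0.
have lgt0 : 0 < l by rewrite lt_neqAle eq_sym lneq0.
have [x /andP[/ltW x0 _]] := poisson_tail_mvt j lgt0.
rewrite poisson_tail_at0 => /eqP; rewrite subr_eq => /eqP ->.
rewrite gerDr mulNr oppr_le0 mulr_ge0// ?subr0// divr_ge0//.
by rewrite mulr_ge0 ?expR_ge0 ?exprn_ge0.
Qed.

(** The derivative is, up to sign, a Poisson mass, hence at most 1 in absolute value. *)
Lemma poisson_tail_lip j l l' : 0 <= l -> 0 <= l' ->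
  `|poisson_tail j l - poisson_tail j l'| <= `|l - l'|.
Proof.
case: j => [|j]; first by rewrite !poisson_tail0 subrr normr0.
wlog ll' : l l' / l < l' => [hwlog l0 l'0|l0 l'0].
  have [ll'|l'l|->] := ltgtP l l'; [exact: hwlog| |by rewrite !subrr].
  by rewrite distrC (distrC l); exact: hwlog.
have [x /andP[/ltW/(le_trans l0) x0 _] xE] := poisson_tail_mvt j ll'.
rewrite distrC xE (distrC l) normrM ler_piMl//.
rewrite normrN ger0_norm; last by rewrite divr_ge0// mulr_ge0 ?expR_ge0 ?exprn_ge0.
rewrite (le_trans _ (poisson_tail_le1 j.+1 x0))// poisson_tailS lerDr.
exact: poisson_tail_ge0.
Qed.

(** Adding one trial of probability [p] to a Poisson variable is compared with raising its mean by
    [p]. By the mean value theorem the difference is [p] times the variation of a derivative over a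
    distance at most [p]; that derivative is a difference of two 1-Lipschitz tails, whence the 2. *)
Lemma poisson_tail_step j l p : 0 <= l -> 0 <= p ->
  `|p * poisson_tail j l + (1 - p) * poisson_tail j.+1 l
    - poisson_tail j.+1 (l + p)| <= 2 * p ^+ 2.
Proof.
move=> l0; rewrite le_eqVlt => /predU1P[<-|p0].
  by rewrite addr0 mul0r add0r subr0 mul1r subrr normr0 expr0n mulr0.
have llp : l < l + p by rewrite ltrDl.
have [x /andP[lx xlp] xE] := poisson_tail_mvt j llp.
have x0 : 0 <= x by rewrite (le_trans l0)// ltW.
move: xE; rewrite (_ : l + p - l = p); last by ring.
have pE y : expR (- y) * y ^+ j / j`!%:R = poisson_tail j.+1 y - poisson_tail j y.
  by rewrite poisson_tailS; ring.
rewrite pE => /eqP; rewrite subr_eq => /eqP ->.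
set a := poisson_tail j l; set a' := poisson_tail j.+1 l.
set b := poisson_tail j x; set b' := poisson_tail j.+1 x.
rewrite (_ : _ - _ = p * ((b' - a') - (b - a))); last by ring.
rewrite normrM gtr0_norm// expr2 mulrCA ler_wpM2l ?(ltW p0)//.
have xlp' : `|x - l| <= p by rewrite gtr0_norm ?subr_gt0// lerBlDl ltW.
rewrite (le_trans (ler_normB _ _))// mulr_natl mulr2n lerD//.
  exact: le_trans (poisson_tail_lip _ _ _) xlp'.
exact: le_trans (poisson_tail_lip _ _ _) xlp'.
Qed.

(** Le Cam's argument: the trials are replaced one after another, each at the cost of
    [poisson_tail_step], and earlier errors are merely averaged. *)
Lemma binom_poisson_tail n j p : 0 <= p <= 1 ->
  `|binom_tail p n j - poisson_tail j (n%:R * p)| <= 2 * n%:R * p ^+ 2.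
Proof.
move=> /andP[p0 p1]; elim: n j => [|n ih] [|j].
- by rewrite poisson_tail0 subrr normr0 mulr0 mul0r.
- by rewrite mul0r poisson_tail_at0 subrr normr0 mulr0 mul0r.
- by rewrite poisson_tail0 subrr normr0 !mulr_ge0 ?sqr_ge0.
rewrite binom_tailS.
have np0 : 0 <= n%:R * p by rewrite mulr_ge0.
have := poisson_tail_step j np0 p0.
rewrite (_ : n%:R * p + p = n.+1%:R * p); last by rewrite -natr1; ring.
have := ih j; have := ih j.+1.
set a := poisson_tail j _; set a' := poisson_tail j.+1 _.
set b := poisson_tail _ _; set c := binom_tail _ _ _; set c' := binom_tail _ _ _.
move=> h1 h2 h3.
rewrite (_ : _ - _ = p * (c' - a) + (1 - p) * (c - a')
  + (p * a + (1 - p) * a' - b)); last by ring.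
rewrite (le_trans (ler_normD _ _))//.
rewrite [leRHS](_ : _ = 2 * n%:R * p ^+ 2 + 2 * p ^+ 2); last first.
  by rewrite -natr1; ring.
rewrite lerD// (le_trans (ler_normD _ _))// !normrM (ger0_norm p0).
rewrite (ger0_norm (_ : 0 <= 1 - p)) ?subr_ge0//.
rewrite [leRHS](_ : _ = p * (2 * n%:R * p ^+ 2) + (1 - p) * (2 * n%:R * p ^+ 2));
  last by ring.
by apply: lerD; rewrite ler_wpM2l ?subr_ge0.
Qed.

End binomial_tail.

(** * Volume of Euclidean balls *)

Section tuple_boxes.
Context {d : measure_display} {T : measurableType d}.
Variables (n : nat) (G : set (set T)) (E : (set T)^nat).
Hypotheses (GE : forall k, G (E k)) (ndE : nondecreasing_seq E)
  (ET : \bigcup_k E k = setT).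

Definition box_of (A : 'I_n -> set T) : set (n.-tuple T) :=
  [set x | forall i, A i (tnth x i)].

Definition boxes : set (set (n.-tuple T)) :=
  [set box_of A | A in [set A | forall i, G (A i)]].

Lemma measurable_box_of (A : 'I_n -> set T) :
  (forall i, measurable (A i)) -> measurable (box_of A).
Proof.
move=> mA; rewrite (_ : box_of A =
    \bigcap_(i in [set: 'I_n]) ((@tnth n T)^~ i @^-1` A i)).
  apply: fin_bigcap_measurable => // i _.
  by rewrite -[X in measurable X]setTI; exact: measurable_tnth.
by apply/seteqP; split => [x Ax i _|x Ax i]; exact: Ax.
Qed.

Lemma setI_closed_boxes : setI_closed G -> setI_closed boxes.
Proof.
move=> GI _ _ [A GA <-] [B GB <-]; exists (fun i => A i `&` B i).
  by move=> i; exact: GI.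
apply/seteqP; split=> [x ABx|x [Ax Bx] i//].
by split=> i; case: (ABx i).
Qed.

Lemma bigcup_boxes : \bigcup_k box_of (fun=> E k) = setT.
Proof.
apply/seteqP; split=> // x _.
have /choice[N EN] : forall i, exists k, E k (tnth x i).
  by move=> i; have : setT (tnth x i) by []; rewrite -ET => -[k _ ?]; exists k.
exists (\max_i N i) => //= i.
by have /subsetPset := ndE (leq_bigmax (F := N) i); apply; exact: EN.
Qed.

(** A constraint on one coordinate by a member of [G] is a countable union of boxes whose other
    sides are [E k]; this puts the cylinders in the sigma-algebra generated by boxes. *)
Lemma measurable_boxes : measurable = <<s G >> ->
  @measurable _ (n.-tuple T) = <<s boxes >>.
Proof.
move=> mG; apply/seteqP; split.
  apply: smallest_sub; first exact: smallest_sigma_algebra.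
  elim/big_ind : _ => [//|X Y hX hY|i _ _ [A mA <-]]; first by rewrite subUset.
  rewrite setTI; move: (A) mA; rewrite mG.
  set f := (fun y : n.-tuple T => tnth y i).
  suff: <<s G >> `<=` image_set_system setT f <<s boxes >>.
    by move=> + B GB => /(_ _ GB); rewrite /image_set_system/= setTI.
  apply: smallest_sub.
    by apply: sigma_algebra_image; exact: smallest_sigma_algebra.
  move=> B GB; rewrite /image_set_system/= setTI.
  rewrite (_ : f @^-1` B =
    \bigcup_k box_of (fun l => if l == i then B else E k)).
    apply: sigma_algebra_bigcup => k; apply: sub_sigma_algebra.
    by eexists; last reflexivity; move=> l /=; case: ifPn.
  apply/seteqP; split=> x /=; last first.
    by move=> [k _ /(_ i)]; rewrite eqxx.
  move=> Bx; have : setT x by []; rewrite -bigcup_boxes => -[k _ Ex].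
  by exists k => // l; case: eqP => [->//|_]; exact: Ex.
apply: smallest_sub; first exact: sigma_algebra_measurable.
move=> _ [A GA <-]; apply: measurable_box_of => i.
by rewrite mG; apply: sub_sigma_algebra; exact: GA.
Qed.

End tuple_boxes.

(* The instance is named explicitly, since [pushforward] is also the head of the
   measure instance behind [cons_measure]. *)
Definition image_measure d1 d2 (T1 : measurableType d1) (T2 : measurableType d2)
    (R : realType) (m : {measure set T1 -> \bar R}) (f : T1 -> T2)
    (mf : measurable_fun setT f) : {measure set T2 -> \bar R} :=
  measure_function_pushforward__canonical__measure_function_Measure m mf.

Section lebesgue_Rd_theory.
Context {R : realType}.

Definition ocitv_nat (k : nat) : set R := `]- k%:R, k%:R]%classic.

Lemma ocitv_ocitv_nat k : ocitv (ocitv_nat k). Proof. exact: is_ocitv. Qed.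

Lemma nd_ocitv_nat : nondecreasing_seq ocitv_nat.
Proof.
move=> m n mn; apply/subsetPset => x; rewrite /ocitv_nat/= !in_itv/=.
move=> /andP[mx xm]; have mn' : m%:R <= n%:R :> R by rewrite ler_nat.
by apply/andP; split; lra.
Qed.

Lemma bigcup_ocitv_nat : \bigcup_k ocitv_nat k = setT.
Proof.
apply/seteqP; split => // x _; have [n xn] := ltr_add_invr (ltr_pwDr ltr01 (normr_ge0 x)).
exists (Num.truncn `|x|).+1 => //; rewrite /ocitv_nat/= in_itv/=.
have := truncnS_gt `|x|; move: (_.+1) => m xm.
by move: xm; rewrite ltr_norml => /andP[-> /ltW].
Qed.

Lemma measurable_ocitv : @measurable _ (measurableTypeR R) = <<s @ocitv R >>.
Proof. by []. Qed.

Context {d : nat}.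

Lemma lebesgue_Rd_unique (m1 m2 : {measure set (d.-tuple R) -> \bar R}) :
  (forall a b : 'I_d -> R,
    m1 (box_of (fun i => `]a i, b i]%classic)) =
    m2 (box_of (fun i => `]a i, b i]%classic))) ->
  (forall k, (m1 (box_of (fun=> ocitv_nat k)) < +oo)%E) ->
  forall A, measurable A -> m1 A = m2 A.
Proof.
move=> m12 m1oo.
apply: (measure_unique (boxes (@ocitv R)) (fun k => box_of (fun=> ocitv_nat k))).
- exact: (measurable_boxes d ocitv_ocitv_nat nd_ocitv_nat bigcup_ocitv_nat measurable_ocitv).
- exact/setI_closed_boxes/ocitvI.
- by move=> k; exists (fun=> ocitv_nat k) => // i; exact: ocitv_ocitv_nat.
- exact: bigcup_boxes nd_ocitv_nat bigcup_ocitv_nat.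
- move=> _ [A /= oA <-].
  have /choice[ab abA] : forall i, exists ab : R * R, `]ab.1, ab.2]%classic = A i.
    by move=> i; have [x _ <-] := oA i; exists x.
  rewrite (_ : A = fun i => `](ab i).1, (ab i).2]%classic) ?m12//.
  by apply/funext => i; rewrite abA.
- exact: m1oo.
Qed.

Lemma lebesgue_Rd_itv (a b : 'I_d -> R) :
  lebesgue_Rd d (box_of (fun i => `]a i, b i]%classic)) =
  (\prod_(i < d) (Num.max 0 (b i - a i)))%:E.
Proof.
rewrite lebesgue_Rd_box//; elim/big_ind2: _ => //.
  by move=> x1 x2 y1 y2 -> ->; rewrite EFinM.
move=> i _; rewrite lebesgue_measure_itv/= lte_fin -subr_gt0 -EFinB.
by case: ltP.
Qed.

(** Oriented so that the ball of center [c] and radius [a] is a preimage of the unit ball around the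
    origin. *)
Definition affineRd (c : d.-tuple R) (a : R) (x : d.-tuple R) : d.-tuple R :=
  [tuple (tnth x i - tnth c i) / a | i < d].

Lemma measurable_affineRd c a : measurable_fun setT (affineRd c a).
Proof.
apply/measurable_fun_tnthP => i.
rewrite (_ : _ \o _ = fun x => (tnth x i - tnth c i) / a); last first.
  by apply/funext => x /=; rewrite tnth_mktuple.
apply: measurable_funM => //; apply: measurable_funB => //.
exact: measurable_tnth.
Qed.

Lemma lebesgue_Rd_affine c (a : R) A : 0 < a -> measurable A ->
  lebesgue_Rd d (affineRd c a @^-1` A) = ((a ^+ d)%:E * lebesgue_Rd d A)%E.
Proof.
move=> a0 mA.
have ad0 : 0 <= a ^+ d by rewrite exprn_ge0// ltW.
pose m1 := image_measure (lebesgue_Rd d) (measurable_affineRd c a).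
pose m2 : {measure set _ -> \bar R} := mscale (NngNum ad0) (lebesgue_Rd d).
have preE (l r : 'I_d -> R) :
  affineRd c a @^-1` box_of (fun i => `]l i, r i]%classic) =
  box_of (fun i => `]tnth c i + a * l i, tnth c i + a * r i]%classic).
  by apply/seteqP; split=> x + i => /(_ i) /=; rewrite tnth_mktuple !in_itv/=
    ltr_pdivlMr// ler_pdivrMr// ltrBrDl lerBlDl (mulrC a) (mulrC a).
rewrite -[LHS]/(m1 A) -[RHS]/(m2 A).
have m12 (l r : 'I_d -> R) : m1 (box_of (fun i => `]l i, r i]%classic)) =
    m2 (box_of (fun i => `]l i, r i]%classic)).
  rewrite /m1 /m2 /image_measure/= /pushforward /mscale/= preE !lebesgue_Rd_itv -EFinM.
  congr EFin; have -> : a ^+ d = \prod_(i < d) a by rewrite prodr_const card_ord.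
  rewrite -big_split/=.
  apply: eq_bigr => i _; rewrite opprD addrACA subrr add0r -mulrBr.
  by rewrite -{1}(mulr0 a) maxr_pMr// ltW.
apply: lebesgue_Rd_unique => // k.
by rewrite m12 /m2/= /mscale/= (lebesgue_Rd_itv (fun=> _) (fun=> _)) -EFinM ltry.
Qed.

End lebesgue_Rd_theory.

Section euclidean_ball.
Context {R : realType} {d : nat}.
Implicit Types x y c : d.-tuple R.

Definition eball x (r : R) : set (d.-tuple R) := [set y | euclidean_dist x y < r].

Lemma euclidean_distC x y : euclidean_dist x y = euclidean_dist y x.
Proof.
by congr Num.sqrt; apply: eq_bigr => i _; rewrite -opprB sqrrN.
Qed.

Lemma euclidean_dist_ge0 x y : 0 <= euclidean_dist x y.
Proof. exact: sqrtr_ge0. Qed.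

Lemma euclidean_dist_eq0 x y : (euclidean_dist x y == 0) = (x == y).
Proof.
rewrite sqrtr_eq0; apply/idP/eqP => [|->]; last first.
  by rewrite big1// => i _; rewrite subrr expr0n.
move=> le0; apply: eq_from_tnth => i; apply/eqP.
have : \sum_(i < d) (tnth x i - tnth y i) ^+ 2 == 0.
  by rewrite eq_le le0 sumr_ge0// => k _; exact: sqr_ge0.
rewrite psumr_eq0; last by move=> k _; exact: sqr_ge0.
by move=> /allP /(_ i (mem_index_enum i)); rewrite sqrf_eq0 subr_eq0.
Qed.

Lemma ler_coord_dist x y i : `|tnth x i - tnth y i| <= euclidean_dist x y.
Proof.
rewrite -sqrtr_sqr ler_sqrt; last by apply: sumr_ge0 => k _; exact: sqr_ge0.
by rewrite (bigD1 i)//= lerDl sumr_ge0// => k _; exact: sqr_ge0.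
Qed.

Lemma eball_disjoint x y (r : R) : 2 * r <= euclidean_dist x y ->
  eball x r `&` eball y r = set0.
Proof.
move=> rxy; rewrite -subset0 => z [/= xz yz].
have r0 : 0 < r by rewrite (le_lt_trans _ xz)// euclidean_dist_ge0.
have : euclidean_dist x y < 2 * r.
  rewrite -(gtr0_norm (_ : 0 < 2 * r)); last by rewrite mulr_gt0.
  rewrite -sqrtr_sqr ltr_sqrt ?exprn_gt0 ?mulr_gt0//.
  have sq u v : euclidean_dist u v < r ->
      \sum_(i < d) (tnth u i - tnth v i) ^+ 2 < r ^+ 2.
    rewrite /euclidean_dist -{1}(gtr0_norm r0) -sqrtr_sqr ltr_sqrt//.
    by rewrite exprn_gt0.
  have := sq _ _ xz; have := sq _ _ yz => h1 h2.
  (* Coordinatewise (u - v)^2 <= 2 u^2 + 2 v^2, so the squared distance stays below 4 r^2. *)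
  apply: (@le_lt_trans _ _ (2 * (\sum_(i < d) (tnth x i - tnth z i) ^+ 2) +
    2 * \sum_(i < d) (tnth y i - tnth z i) ^+ 2)); last by nra.
  rewrite !mulr_sumr -big_split/= ler_sum// => i _.
  have : 0 <= ((tnth x i - tnth z i) + (tnth y i - tnth z i)) ^+ 2 by exact: sqr_ge0.
  by nra.
by rewrite ltNge rxy.
Qed.

Lemma measurable_euclidean_dist dd (U : measurableType dd) (f g : U -> d.-tuple R) :
  measurable_fun setT f -> measurable_fun setT g ->
  measurable_fun setT (fun u => euclidean_dist (f u) (g u)).
Proof.
move=> mf mg; apply: (measurableT_comp (f := @Num.sqrt R)).
  apply: continuous_measurable_fun; exact: sqrt_continuous.
apply: measurable_sum => i; apply: measurable_funX.
by apply: measurable_funB; apply: (measurableT_comp (measurable_tnth i)).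
Qed.

Lemma measurable_eball x (r : R) : measurable (eball x r).
Proof.
have := @measurable_fun_ltr _ _ _ setT (euclidean_dist x) (cst r).
move=> /(_ _ _ measurableT [set true])/=; rewrite setTI; apply => //.
exact: measurable_euclidean_dist.
Qed.

Definition origin : d.-tuple R := [tuple 0 | i < d].

Lemma eball_affine c (r : R) : 0 < r ->
  eball c r = affineRd c r @^-1` eball origin 1.
Proof.
move=> r0; apply/seteqP; split=> x; rewrite /eball/= /euclidean_dist;
  rewrite (_ : \sum_(i < d) (tnth origin i - _) ^+ 2 =
    r ^- 2 * \sum_(i < d) (tnth c i - tnth x i) ^+ 2).
- by rewrite sqrtrM ?invr_ge0 ?sqr_ge0// sqrtrV ?sqr_ge0// sqrtr_sqr gtr0_norm//
    mulrC ltr_pdivrMr// mul1r.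
- rewrite mulr_sumr; apply: eq_bigr => i _.
  by rewrite !tnth_mktuple sub0r sqrrN -opprB mulNr sqrrN exprMn exprVn mulrC.
- by rewrite sqrtrM ?invr_ge0 ?sqr_ge0// sqrtrV ?sqr_ge0// sqrtr_sqr gtr0_norm//
    mulrC ltr_pdivrMr// mul1r.
- rewrite mulr_sumr; apply: eq_bigr => i _.
  by rewrite !tnth_mktuple sub0r sqrrN -opprB mulNr sqrrN exprMn exprVn mulrC.
Qed.

(** The product form is integrated by Tonelli and the radial form [gaussRdE] by layers; comparing
    the two results gives the volume of the unit ball. *)
Definition gaussRd x : R := \prod_(i < d) gauss_fun (tnth x i).

Lemma gaussRdE x : gaussRd x = expR (- euclidean_dist origin x ^+ 2).
Proof.
rewrite /euclidean_dist sqr_sqrtr; last by apply: sumr_ge0 => i _; exact: sqr_ge0.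
rewrite -sumrN expR_sum; apply: eq_bigr => i _.
by rewrite /gauss_fun tnth_mktuple sub0r sqrrN.
Qed.

Lemma measurable_gaussRd : measurable_fun setT gaussRd.
Proof.
apply: measurable_prod => i _; apply: (measurableT_comp measurable_gauss_fun).
exact: measurable_tnth.
Qed.

Lemma gaussRd_ge0 x : 0 <= gaussRd x.
Proof. by apply: prodr_ge0 => i _; exact: gauss_fun_ge0. Qed.

End euclidean_ball.

Lemma integral_lebesgue_RdS (R : realType) (d : nat)
    (f : d.+1.-tuple R -> \bar R) :
  measurable_fun setT f -> (forall x, 0 <= f x)%E ->
  (\int[lebesgue_Rd d.+1]_x f x =
   \int[lebesgue_measure]_x \int[lebesgue_Rd d]_t f (consRd (x, t)))%E.
Proof.
move=> mf f0.
have mc : measurable_fun setT (fun x : R * d.-tuple R => f (consRd x)).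
  by apply: (measurableT_comp mf); exact: measurable_consRd.
transitivity (\int[lebesgue_measure \x lebesgue_Rd d]_x f (consRd x))%E;
  last exact: fubini_tonelli1.
pose lam : {sigma_finite_measure set (measurableTypeR R) -> \bar R} :=
  lebesgue_measure.
pose mu : {measure set (measurableTypeR R * d.-tuple R)%type -> \bar R} :=
  (lam \x lebesgue_Rd d)%E.
have mcons : measurable_fun [set: measurableTypeR R * d.-tuple R] (@consRd R d).
  exact: measurable_consRd.
have := ge0_integral_pushforward mcons mu measurableT mf.
by rewrite preimage_setT => <-.
Qed.

Lemma gaussRd_cons (R : realType) (d : nat) (x : R) (t : d.-tuple R) :
  gaussRd (consRd (x, t)) = gauss_fun x * gaussRd t.
Proof.
rewrite /gaussRd big_ord_recl/= /consRd tnth0; congr (_ * _).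
by apply: eq_bigr => i _; rewrite tnthS.
Qed.

Lemma integral_gaussRd (R : realType) (d : nat) :
  (\int[lebesgue_Rd d]_x (gaussRd x)%:E = (Num.sqrt pi ^+ d)%:E :> \bar R)%E.
Proof.
elim: d => [|d ih].
  rewrite /lebesgue_Rd integral_dirac//.
    by rewrite /gaussRd big_ord0 diracT mul1e.
  by apply/measurable_EFinP; exact: measurable_gaussRd.
rewrite integral_lebesgue_RdS; first last.
- by move=> x; rewrite lee_fin gaussRd_ge0.
- by apply/measurable_EFinP; exact: measurable_gaussRd.
under eq_integral => x _.
  under eq_integral do rewrite gaussRd_cons EFinM.
  rewrite ge0_integralZl_EFin ?gauss_fun_ge0//; first last.
  - by apply/measurable_EFinP; exact: measurable_gaussRd.
  - by move=> t _; rewrite lee_fin gaussRd_ge0.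
  rewrite ih; over.
rewrite ge0_integralZr//; first last.
- by move=> x _; rewrite lee_fin gauss_fun_ge0.
- by apply/measurable_EFinP; exact: measurable_gauss_fun.
by rewrite integralT_gauss -EFinM exprS.
Qed.

Lemma lebesgue_eball (R : realType) (d : nat) (c : d.-tuple R) (r : R) : 0 < r ->
  lebesgue_Rd d (eball c r) = ((r ^+ d)%:E * lebesgue_Rd d (eball origin 1))%E.
Proof.
move=> r0; rewrite (eball_affine _ r0) lebesgue_Rd_affine//.
exact: measurable_eball.
Qed.

Lemma integral_expRN_itvoy (R : realType) (a : R) :
  (\int[lebesgue_measure]_(t in `]a, +oo[) (expR (- t))%:E = (expR (- a))%:E)%E.
Proof.
have cexp : continuous (fun t : R => expR (- t)).
  by move=> x; apply: continuous_comp; [exact: opp_continuous|exact: continuous_expR].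
rewrite integral_itv_obnd_cbnd; last first.
  apply/measurable_EFinP/measurable_funTS; exact: continuous_measurable_fun.
have dF (x : R) : is_derive x 1 (fun t => - expR (- t)) (expR (- x)).
  by apply: is_derive_eq; rewrite mulrN1 opprK.
rewrite (@ge0_continuous_FTC2y _ (fun t => expR (- t)) (fun t => - expR (- t)) a 0).
- by rewrite sub0e -EFinN opprK.
- by move=> x _; exact: expR_ge0.
- exact: continuous_subspaceT.
- rewrite -oppr0; apply: cvgN.
  exact: (cvg_comp _ _ _ (@cvgr_expR R)).
- by move=> x _; exact: ex_derive.
- apply: cvg_at_right_filter; apply: cvgN; exact: cexp.
- by move=> x _; rewrite derive1E derive_val.
Qed.

(** Writing exp(-|x|^2) as the integral of exp(-t) over t > |x|^2 and exchanging the integrals turns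
    the Gaussian integral into the volume times the integral that defines Gamma(1 + d/2). *)
Lemma lebesgue_ball_volume (R : realType) (d : nat) :
  lebesgue_Rd d (eball (@origin R d) 1) = (unit_ball_volume d)%:E /\
  0 < unit_ball_volume d :> R.
Proof.
set v := lebesgue_Rd d (eball (@origin R d) 1).
have v0 : (0 <= v)%E by exact: measure_ge0.
pose n2 (x : d.-tuple R) := euclidean_dist origin x ^+ 2.
have mn2 : measurable_fun setT n2.
  by apply: measurable_funX; exact: measurable_euclidean_dist.
pose A : set (d.-tuple R * measurableTypeR R) := [set p | n2 p.1 < p.2].
have mA : measurable A.
  have := @measurable_fun_ltr _ (d.-tuple R * measurableTypeR R)%type R setT
    (n2 \o fst) snd.
  move=> /(_ _ _ measurableT [set true])/=; rewrite setTI; apply => //.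
  exact: measurableT_comp.
pose lam : {sigma_finite_measure set (measurableTypeR R) -> \bar R} :=
  lebesgue_measure.
pose h (p : d.-tuple R * measurableTypeR R) : \bar R :=
  ((expR (- p.2))%:E * (\1_A p)%:E)%E.
have mexp : measurable_fun setT (fun t : measurableTypeR R => expR (- t)).
  by apply: (measurableT_comp (@measurable_expR R)); exact: measurable_funN.
have mh : measurable_fun setT h.
  apply: emeasurable_funM; apply/measurable_EFinP.
    exact: (measurableT_comp mexp measurable_snd).
  exact: measurable_indic.
have h0 p : (0 <= h p)%E by rewrite mule_ge0// lee_fin ?expR_ge0.
have := @fubini_tonelli _ _ _ _ _ (lebesgue_Rd d) lam h mh h0.
have -> : (\int[lebesgue_Rd d]_x \int[lam]_y h (x, y) = (Num.sqrt pi ^+ d)%:E)%E.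
  rewrite -integral_gaussRd; apply: eq_integral => x _.
  rewrite gaussRdE -integral_expRN_itvoy [in RHS]integral_mkcond.
  apply: eq_integral => t _; rewrite epatch_indic/= /h/=; congr (_ * (_)%:E)%E.
  by rewrite !indicE; congr (_%:R); congr nat_of_bool; apply/idP/idP;
    rewrite !inE /A/= in_itv/= andbT.
have -> : (\int[lam]_y \int[lebesgue_Rd d]_x h (x, y) =
    v * \int[lebesgue_measure]_(t in `]0%R, +oo[)
    (t `^ (1 + d%:R / 2 - 1) * expR (- t))%:E)%E.
  have mg : measurable_fun (`]0%R, +oo[%classic : set (measurableTypeR R))
      (fun t : measurableTypeR R => (t `^ (1 + d%:R / 2 - 1) * expR (- t))%:E).
    apply/measurable_EFinP/measurable_funTS/measurable_funM; last exact: mexp.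
    exact: measurable_powR.
  rewrite -ge0_integralZl//; last first.
    by move=> t _; rewrite lee_fin mulr_ge0 ?powR_ge0 ?expR_ge0.
  rewrite [in RHS]integral_mkcond; apply: eq_integral => t _.
  (* The section at level [t] is the ball of radius [Num.sqrt t]; for [t <= 0] the square root is 0
     and the ball is empty. *)
  have indE x : \1_A (x, t) = \1_(eball origin (Num.sqrt t)) x :> R.
    rewrite !indicE; congr (_%:R); congr nat_of_bool.
    apply/idP/idP; rewrite !inE /A/= /eball/= /n2.
      move=> xt; rewrite -(ger0_norm (euclidean_dist_ge0 origin x)) -sqrtr_sqr.
      by rewrite ltr_sqrt// (le_lt_trans _ xt)// sqr_ge0.
    move=> xt; have t0 : 0 < t.
      by rewrite -sqrtr_gt0 (le_lt_trans _ xt)// euclidean_dist_ge0.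
    by rewrite -(sqr_sqrtr (ltW t0)) ltr_sqr ?nnegrE ?sqrtr_ge0.
  under eq_integral do rewrite /h/= indE.
  rewrite ge0_integralZl_EFin ?expR_ge0//; last first.
    by apply/measurable_EFinP; apply: measurable_indic; exact: measurable_eball.
  rewrite integral_indic//; last exact: measurable_eball.
  rewrite setIT patchE; case: ifPn => [|/negP]; rewrite inE/= in_itv/= andbT.
    move=> t0; rewrite lebesgue_eball ?sqrtr_gt0// muleA -EFinM muleC.
    congr (_ * (_)%:E)%E; rewrite mulrC; congr (_ * _).
    rewrite addrC addKr (_ : _ / 2 = 2^-1 * d%:R); last by rewrite mulrC.
    by rewrite powRrM powR12_sqrt ?ltW// powR_mulrn// sqrtr_ge0.
  move=> /negP; rewrite -leNgt => t0.
  rewrite (_ : eball _ _ = set0) ?measure0 ?mule0//.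
  rewrite -subset0 => x; rewrite /eball/= ler0_sqrtr//.
  by rewrite ltNge euclidean_dist_ge0.
pose G : \bar R := (\int[lebesgue_measure]_(t in `]0%R, +oo[)
    (t `^ (1 + d%:R / 2 - 1) * expR (- t))%:E)%E.
rewrite -/G => vG.
have G0 : (0 <= G)%E.
  by apply: integral_ge0 => t _; rewrite lee_fin mulr_ge0 ?powR_ge0 ?expR_ge0.
have pid : 0 < (Num.sqrt pi : R) ^+ d by rewrite exprn_gt0// sqrtr_gt0 pi_gt0.
have GE : Gamma_fun (1 + d%:R / 2) = fine G by [].
(* The volume and the Gamma integral are nonnegative with a positive finite product, so neither is 0
   or infinite. This matters because [Gamma_fun] sees only the finite part of its integral. *)
have G_gt0 : (0 < G)%E.
  rewrite lt_neqAle G0 andbT; apply/eqP => G00.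
  by move: vG; rewrite -G00 mule0 => -[] /eqP; rewrite gt_eqF.
have v_gt0 : (0 < v)%E.
  rewrite lt_neqAle v0 andbT; apply/eqP => v00.
  by move: vG; rewrite -v00 mul0e => -[] /eqP; rewrite gt_eqF.
have Gfin : G \is a fin_num.
  rewrite ge0_fin_numE// ltey; apply/eqP => Goo.
  by move: vG; rewrite Goo gt0_muley.
have vfin : v \is a fin_num.
  rewrite ge0_fin_numE// ltey; apply/eqP => voo.
  by move: vG; rewrite voo gt0_mulye.
have fG : 0 < fine G by rewrite fine_gt0// G_gt0 -ge0_fin_numE.
have vE : unit_ball_volume d = fine v.
  rewrite /unit_ball_volume GE (_ : d%:R / 2 = 2^-1 * d%:R); last by rewrite mulrC.
  rewrite powRrM powR12_sqrt ?pi_ge0// powR_mulrn ?sqrtr_ge0//.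
  move: vG; rewrite -(fineK Gfin) -(fineK vfin) -EFinM => -[->].
  by rewrite mulfK// gt_eqF.
by rewrite vE fineK//; split=> //; rewrite fine_gt0// v_gt0 -ge0_fin_numE.
Qed.

(** * Ball averages of integrable functions *)

Section ball_integral.
Context {R : realType} {d : nat}.
Local Notation Rd := (d.-tuple R).
Local Notation lam := (@lebesgue_Rd R d).
Local Notation v := (@unit_ball_volume R d).
Implicit Types (e : R) (f g : Rd -> R).

Lemma eball_volume (x : Rd) e : 0 < e -> lam (eball x e) = (v * e ^+ d)%:E.
Proof.
move=> e0; rewrite lebesgue_eball//.
by have [-> _] := @lebesgue_ball_volume R d; rewrite -EFinM mulrC.
Qed.

Lemma unit_ball_volume_gt0 : 0 < v.
Proof. by have [_ ->] := @lebesgue_ball_volume R d. Qed.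

Lemma measurable_ball_kernel e :
  measurable [set p : Rd * Rd | euclidean_dist p.1 p.2 < e].
Proof.
have := @measurable_fun_ltr _ (Rd * Rd)%type R setT
  (fun p => euclidean_dist p.1 p.2) (cst e).
move=> /(_ _ _ measurableT [set true])/=; rewrite setTI; apply => //.
exact: measurable_euclidean_dist.
Qed.

Lemma indic_eball e (x y : Rd) :
  \1_(eball x e) y = \1_[set p : Rd * Rd | euclidean_dist p.1 p.2 < e] (x, y) :> R.
Proof. by rewrite !indicE; congr ((_ : bool)%:R); apply/idP/idP; rewrite !inE. Qed.

Lemma measurable_ball_kernelM e (h : Rd -> \bar R) : measurable_fun setT h ->
  measurable_fun setT (fun p : Rd * Rd =>
    (h p.2 * (\1_[set p : Rd * Rd | euclidean_dist p.1 p.2 < e] p)%:E)%E).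
Proof.
move=> mh; apply: emeasurable_funM; first exact: (measurableT_comp mh).
by apply/measurable_EFinP; apply: measurable_indic; exact: measurable_ball_kernel.
Qed.

Lemma ge0_ball_integralE e (h : Rd -> \bar R) x :
  (\int[lam]_(y in eball x e) h y = \int[lam]_y
    (h y * (\1_[set p : Rd * Rd | (euclidean_dist p.1 p.2 < e)%R] (x, y))%:E))%E.
Proof.
rewrite integral_mkcond; apply: eq_integral => y _.
by rewrite epatch_indic/= indic_eball.
Qed.

Lemma measurable_ge0_ball_integral e (h : Rd -> \bar R) :
  measurable_fun setT h -> (forall y, 0 <= h y)%E ->
  measurable_fun setT (fun x => \int[lam]_(y in eball x e) h y)%E.
Proof.
move=> mh h0; under eq_fun do rewrite ge0_ball_integralE.
apply: (measurable_fun_fubini_tonelli_F (m2 := lam) _ (measurable_ball_kernelM e mh)).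
by move=> p; rewrite mule_ge0// lee_fin.
Qed.

(** After exchanging the integrals, symmetry of the distance shows that each [y] is counted with the
    volume of the ball around it. *)
Lemma ge0_integral_ball_integral e (h : Rd -> \bar R) : 0 < e ->
  measurable_fun setT h -> (forall y, 0 <= h y)%E ->
  (\int[lam]_x \int[lam]_(y in eball x e) h y =
   (v * e ^+ d)%:E * \int[lam]_y h y)%E.
Proof.
move=> e0 mh h0; under eq_integral do rewrite ge0_ball_integralE.
rewrite (fubini_tonelli _ (measurable_ball_kernelM e mh)); last first.
  by move=> p; rewrite mule_ge0// lee_fin.
rewrite -ge0_integralZl//; last first.
  by rewrite lee_fin mulr_ge0 ?exprn_ge0 ?(ltW e0)// ltW// unit_ball_volume_gt0.
apply: eq_integral => y _; rewrite /=.
rewrite (eq_integral (fun x => (h y * (\1_(eball y e) x)%:E)%E)); last first.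
  move=> x _; rewrite -indic_eball !indicE; congr (_ * ((_ : bool)%:R)%:E)%E.
  by apply/idP/idP; rewrite !inE /eball/= euclidean_distC.
rewrite ge0_integralZl//; last first.
  by apply/measurable_EFinP; apply: measurable_indic; exact: measurable_eball.
rewrite integral_indic//; last exact: measurable_eball.
by rewrite setIT/= eball_volume// muleC.
Qed.

Definition ball_int e f x := \int[lam]_(y in eball x e) f y.

Lemma measurable_ball_int e f : measurable_fun setT f ->
  measurable_fun setT (ball_int e f).
Proof.
move=> mf; rewrite /ball_int /Rintegral; apply: (measurableT_comp (@fine_measurable _ setT measurableT)).
under eq_fun do rewrite integralE.
have mEf : measurable_fun setT (EFin \o f) by exact/measurable_EFinP.
apply: emeasurable_funB; apply: measurable_ge0_ball_integral => //.
  exact: measurable_funepos.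
exact: measurable_funeneg.
Qed.

(** The integrals are not divided by the volume of the ball, so convergence of averages takes the
    form of a bound of order o(e^d). *)
Definition ball_err e f : \bar R :=
  (\int[lam]_x `|ball_int e f x - v * e ^+ d * f x|%:E)%E.

Lemma measurable_ball_err e f : measurable_fun setT f ->
  measurable_fun setT (fun x => `|ball_int e f x - v * e ^+ d * f x|%:E).
Proof.
move=> mf; apply/measurable_EFinP; apply: measurableT_comp => //.
apply: measurable_funB; first exact: measurable_ball_int.
exact: measurable_funM.
Qed.

Let integrable_meas f : lam.-integrable setT (EFin \o f) -> measurable_fun setT f.
Proof. by move=> /integrableP[/measurable_EFinP]. Qed.

Let integrable_eball f x e : lam.-integrable setT (EFin \o f) ->
  lam.-integrable (eball x e) (EFin \o f).
Proof.
by move=> fi; apply: (integrableS measurableT) fi => //; exact: measurable_eball.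
Qed.

Lemma ball_errD e f g : lam.-integrable setT (EFin \o f) ->
  lam.-integrable setT (EFin \o g) ->
  (ball_err e (f \+ g)%R <= ball_err e f + ball_err e g)%E.
Proof.
move=> fi gi; have mf := integrable_meas fi; have mg := integrable_meas gi.
rewrite /ball_err -ge0_integralD//; first last.
- exact: measurable_ball_err.
- exact: measurable_ball_err.
apply: ge0_le_integral => //.
- by apply: measurable_ball_err; exact: measurable_funD.
- by apply: emeasurable_funD; exact: measurable_ball_err.
move=> x _; rewrite -EFinD lee_fin /ball_int RintegralD//; first last.
- exact: integrable_eball.
- exact: integrable_eball.
- exact: measurable_eball.
by rewrite (le_trans _ (ler_normD _ _))// mulrDr opprD addrACA.
Qed.

Lemma ball_errZ e c f : lam.-integrable setT (EFin \o f) ->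
  (ball_err e (fun x => c * f x)%R = `|c|%:E * ball_err e f)%E.
Proof.
move=> fi; have mf := integrable_meas fi.
rewrite /ball_err -ge0_integralZl//; last exact: measurable_ball_err.
apply: eq_integral => x _; rewrite -EFinM -normrM; congr (`| _ |%:E).
rewrite /ball_int RintegralZl//; first by rewrite mulrBr (mulrCA c).
  exact: measurable_eball.
exact: integrable_eball.
Qed.

(** Continuity in L^1, uniform in the radius after division by [e ^+ d]; this is what lets
    regularity pass to L^1 limits. *)
Lemma ball_err_le e f : 0 < e -> lam.-integrable setT (EFin \o f) ->
  (ball_err e f <= (2 * v * e ^+ d)%:E * \int[lam]_x `|f x|%:E)%E.
Proof.
move=> e0 fi; have mf := integrable_meas fi.
have v0 := ltW unit_ball_volume_gt0.
have ve0 : 0 <= v * e ^+ d by rewrite mulr_ge0// exprn_ge0// ltW.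
have mnf : measurable_fun setT (fun x => `|f x|%:E).
  by apply/measurable_EFinP; exact: measurableT_comp.
have -> : (2 * v * e ^+ d)%:E = ((v * e ^+ d)%:E + (v * e ^+ d)%:E)%E.
  by rewrite -EFinD; congr EFin; ring.
rewrite ge0_muleDl// -{1}ge0_integral_ball_integral// -ge0_integralZl//.
rewrite -ge0_integralD//; first last.
- by apply: emeasurable_funM.
- by move=> x _; rewrite mule_ge0.
- exact: measurable_ge0_ball_integral.
- by move=> x _; exact: integral_ge0.
apply: ge0_le_integral => //.
- exact: measurable_ball_err.
- apply: emeasurable_funD; first exact: measurable_ge0_ball_integral.
  exact: emeasurable_funM.
move=> x _; rewrite (@le_trans _ _ (`|ball_int e f x|%:E + (v * e ^+ d)%:E * `|f x|%:E)%E)//.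
  by rewrite -EFinM -EFinD lee_fin (le_trans (ler_normB _ _))// normrM (ger0_norm ve0).
rewrite leeD2r// /ball_int.
have mB := measurable_eball x e.
have fB := integrable_eball x e fi.
have := le_abse_integral lam mB (measurable_int _ fB).
rewrite /Rintegral; have := integrable_fin_num mB fB.
by move: (integral _ _ _) => I /fineK {1}<-.
Qed.

End ball_integral.

Section ball_average_cvg.
Context {R : realType} {d : nat}.
Local Notation Rd := (d.-tuple R).
Local Notation lam := (@lebesgue_Rd R d).
Local Notation v := (@unit_ball_volume R d).
Implicit Types (e : R) (f g : Rd -> R) (a b : 'I_d -> R).

Definition rect a b : set Rd := box_of (fun i => `]a i, b i]%classic).

Lemma measurable_rect a b : measurable (rect a b).
Proof. exact: measurable_box_of. Qed.

Lemma rectP a b x : rect a b x <-> forall i, a i < tnth x i <= b i.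
Proof. by split=> h i; have := h i; rewrite /= in_itv. Qed.

Lemma integrable_indic (A : set Rd) : measurable A -> (lam A < +oo)%E ->
  lam.-integrable setT (EFin \o \1_A).
Proof.
move=> mA Aoo; apply/integrableP; split.
  by apply/measurable_EFinP; exact: measurable_indic.
under eq_integral do rewrite /= ger0_norm//.
by rewrite integral_indic// setIT.
Qed.

Lemma ball_int_indic e (A : set Rd) x : measurable A ->
  ball_int e \1_A x = fine (lam (A `&` eball x e)).
Proof.
by move=> mA; rewrite /ball_int /Rintegral integral_indic//; exact: measurable_eball.
Qed.

(** Only points near the boundary contribute. Well inside, the whole ball lies in the rectangle; far
    outside, both terms vanish; elsewhere the error is at most the volume of the ball. The
    difference of products is the volume of the shell between [Bm] and [Bp]. *)
Lemma ball_err_rect e a b : 0 < e ->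
  (ball_err e \1_(rect a b) <= (v * e ^+ d *
    (\prod_(i < d) Num.max 0 (b i - a i + 2 * e)
     - \prod_(i < d) Num.max 0 (b i - a i - 2 * e)))%:E)%E.
Proof.
move=> e0.
have ve0 : 0 <= v * e ^+ d by rewrite mulr_ge0 ?exprn_ge0 ?ltW ?unit_ball_volume_gt0.
pose Bp := rect (fun i => a i - e) (fun i => b i + e).
pose Bm := rect (fun i => a i + e) (fun i => b i - e).
have BpE : lam Bp = (\prod_(i < d) Num.max 0 (b i - a i + 2 * e))%:E.
  rewrite /Bp /rect lebesgue_Rd_itv; congr EFin; apply: eq_bigr => i _.
  by congr Num.max; ring.
have BmE : lam Bm = (\prod_(i < d) Num.max 0 (b i - a i - 2 * e))%:E.
  rewrite /Bm /rect lebesgue_Rd_itv; congr EFin; apply: eq_bigr => i _.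
  by congr Num.max; ring.
have Bmp x : Bm x -> Bp x.
  by move=> /rectP h; apply/rectP => i; have /andP[] := h i; lra.
have mBp : measurable Bp by exact: measurable_rect.
have mBm : measurable Bm by exact: measurable_rect.
have BmBp : Bp `&` Bm = Bm by apply: setIidr.
rewrite EFinM EFinB -BpE -BmE -[X in (_ - X)%E](congr1 lam BmBp).
rewrite -measureD//=; last by rewrite BpE ltry.
rewrite -(setIT (Bp `\` Bm)) -integral_indic//; last exact: measurableD.
rewrite -ge0_integralZl//; last first.
  by apply/measurable_EFinP/measurable_indic; exact: measurableD.
apply: ge0_le_integral => //.
- by apply: measurable_ball_err; apply: measurable_indic; exact: measurable_rect.
- apply: emeasurable_funM => //; apply/measurable_EFinP/measurable_indic.
  exact: measurableD.
move=> x _; rewrite -EFinM lee_fin ball_int_indic; last exact: measurable_rect.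
have [xm|xm] := pselect (Bm x).
  rewrite [X in lam X](_ : _ = eball x e); last first.
    apply/seteqP; split=> [y []//|y xy]; split=> //.
    move/rectP in xm; apply/rectP => i; have := le_lt_trans (ler_coord_dist x y i) xy.
    by rewrite ltr_norml; have /andP[] := xm i; lra.
  rewrite /= eball_volume//= [\1_(rect a b) x]indicE mem_set.
    by rewrite mulr1 subrr normr0 mulr_ge0.
  by move/rectP in xm; apply/rectP => i; have /andP[] := xm i; lra.
have [xp|xp] := pselect (Bp x).
  rewrite [\1_(Bp `\` Bm) x]indicE mem_set// mulr1.
  have : fine (lam (rect a b `&` eball x e)) <= v * e ^+ d.
    have le1 : (lam (rect a b `&` eball x e) <= (v * e ^+ d)%:E)%E.
      rewrite -(eball_volume x e0); apply: le_measure; rewrite ?inE.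
      - by apply: measurableI; [exact: measurable_rect|exact: measurable_eball].
      - exact: measurable_eball.
      - by move=> y [].
    rewrite -lee_fin fineK// ge0_fin_numE//.
    by rewrite (le_lt_trans le1)// ltry.
  have : 0 <= fine (lam (rect a b `&` eball x e)) by exact: fine_ge0.
  rewrite indicE; case: (_ \in _) => p0 pv; rewrite ?mulr1 ?mulr0 ler_norml;
    by apply/andP; split; lra.
rewrite [X in lam X](_ : _ = set0); last first.
  rewrite -subset0 => y [/rectP aby xy]; apply: xp; apply/rectP => i.
  have := le_lt_trans (ler_coord_dist x y i) xy.
  by rewrite ltr_norml; have /andP[] := aby i; lra.
rewrite measure0 [\1_(rect a b) x]indicE memNset.
  by rewrite mulr0 subrr normr0 mulr_ge0.
by move=> /rectP abx; apply: xp; apply/rectP => i; have /andP[] := abx i; lra.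
Qed.

(** The averages of [f] over balls of radius [e] converge to [f] in L^1 as [e] tends to 0. *)
Definition ball_regular f := forall eta : R, 0 < eta ->
  \forall e \near 0^'+, (ball_err e f <= (eta * e ^+ d)%:E)%E.

Lemma cvg_prod_max (c : 'I_d -> R) (k : R) :
  \prod_(i < d) Num.max 0 (c i + k * e) @[e --> 0^'+] -->
  \prod_(i < d) Num.max 0 (c i).
Proof.
apply: (@cvg_at_right_filter R R (fun e => \prod_(i < d) Num.max 0 (c i + k * e)) 0).
have -> : \prod_(i < d) Num.max 0 (c i) = \prod_(i < d) Num.max 0 (c i + k * 0).
  by under [in RHS]eq_bigr do rewrite mulr0 addr0.
apply: (@continuous_big R _ _ _ _ _ R) => [|i _].
  exact: mul_continuous.
move=> x; apply: (@continuous_max R R (cst 0) (fun e => c i + k * e)).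
  exact: cst_continuous.
apply: cvgD; first exact: cvg_cst.
by apply: cvgM; [exact: cvg_cst|exact: cvg_id].
Qed.

Lemma ball_regular_rect a b : ball_regular \1_(rect a b).
Proof.
move=> eta eta0.
have v0 := @unit_ball_volume_gt0 R d.
have cB : (\prod_(i < d) Num.max 0 (b i - a i + 2 * e)
    - \prod_(i < d) Num.max 0 (b i - a i - 2 * e)) @[e --> 0^'+] --> (0 : R).
  rewrite -[X in _ --> X](subrr (\prod_(i < d) Num.max 0 (b i - a i))).
  apply: cvgB; first exact: cvg_prod_max.
  under eq_cvg do under eq_bigr do rewrite -mulNr.
  exact: cvg_prod_max.
have etav : 0 < eta / v by rewrite divr_gt0.
move/cvgrPdist_le : cB => /(_ _ etav) cB.
near=> e.
have e0 : 0 < e by near: e; exact: nbhs_right_gt.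
apply: le_trans (ball_err_rect _ _ e0) _.
rewrite lee_fin mulrAC ler_pM2r ?exprn_gt0//.
rewrite mulrC -ler_pdivlMr//; apply: le_trans (ler_norm _) _.
rewrite -normrN -[X in `|X|]add0r.
by near: e.
Unshelve. all: by end_near. Qed.

End ball_average_cvg.

Import HBSimple.
Section ball_regular_integrable.
Context {R : realType} {d : nat}.
Local Notation Rd := (d.-tuple R).
Local Notation lam := (@lebesgue_Rd R d).
Local Notation v := (@unit_ball_volume R d).
Implicit Types (e : R) (f g : Rd -> R).

Lemma ball_regularD f g : lam.-integrable setT (EFin \o f) ->
  lam.-integrable setT (EFin \o g) ->
  ball_regular f -> ball_regular g -> ball_regular (f \+ g)%R.
Proof.
move=> fi gi rf rg eta eta0; have eta2 : 0 < eta / 2 by rewrite divr_gt0.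
have := rf _ eta2; have := rg _ eta2; apply: filterS2 => e ge fe.
apply: le_trans (ball_errD _ fi gi) _.
apply: le_trans (leeD fe ge) _.
by rewrite -EFinD lee_fin -mulrDl -splitr.
Qed.

Lemma ball_regularZ c f : lam.-integrable setT (EFin \o f) ->
  ball_regular f -> ball_regular (fun x => c * f x).
Proof.
move=> fi rf eta eta0.
have c1 : 0 < `|c| + 1 by rewrite ltr_wpDl.
have /rf : 0 < eta / (`|c| + 1) by rewrite divr_gt0.
move=> H; near=> e; have e0 : 0 < e by near: e; exact: nbhs_right_gt.
rewrite ball_errZ//; apply: (@le_trans _ _ (`|c|%:E * (eta / (`|c| + 1) * e ^+ d)%:E)%E).
  by apply: lee_wpmul2l => //; near: e.
rewrite -EFinM lee_fin mulrA ler_pM2r ?exprn_gt0// mulrA ler_pdivrMr//.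
by rewrite mulrC ler_pM2l// lerDl.
Unshelve. all: by end_near. Qed.

Lemma integrableDR f g : lam.-integrable setT (EFin \o f) ->
  lam.-integrable setT (EFin \o g) -> lam.-integrable setT (EFin \o (f \+ g)%R).
Proof. by move=> fi gi; exact: (integrableD measurableT fi gi). Qed.

Lemma integrableZR c f : lam.-integrable setT (EFin \o f) ->
  lam.-integrable setT (EFin \o (fun x => c * f x)).
Proof. by move=> fi; exact: (integrableZl measurableT c fi). Qed.

Lemma ball_regular_approx f : lam.-integrable setT (EFin \o f) ->
  (forall eta : R, 0 < eta -> exists g, [/\ lam.-integrable setT (EFin \o g),
    ball_regular g & (\int[lam]_x `|f x - g x|%:E <= eta%:E)%E]) ->
  ball_regular f.
Proof.
move=> fi H eta eta0.
have v0 := @unit_ball_volume_gt0 R d.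
(* By [ball_err_le] the remainder contributes at most [2 * v * e ^+ d] times this number, which is
   half of [eta * e ^+ d]. *)
have v4 : 0 < eta / (4 * v) by rewrite divr_gt0// mulr_gt0.
have [g [gi rg fg]] := H _ v4.
have eta2 : 0 < eta / 2 by rewrite divr_gt0.
have ngi : lam.-integrable setT (EFin \o (fun x => (-1) * g x)) by exact: integrableZR.
near=> e; have e0 : 0 < e by near: e; exact: nbhs_right_gt.
have fE : f = (g \+ (f \+ (fun x => (-1) * g x)))%R by apply/funext => x /=; ring.
rewrite fE; apply: (le_trans (ball_errD _ gi _)); first exact: integrableDR.
apply: (@le_trans _ _ ((eta / 2 * e ^+ d)%:E + (eta / 2 * e ^+ d)%:E)%E); last first.
  by rewrite -EFinD -mulrDl -splitr.
apply: leeD; first by near: e; exact: rg.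
apply: (le_trans (ball_err_le e0 _)); first exact: integrableDR.
under eq_integral do rewrite /= mulN1r.
apply: (@le_trans _ _ ((2 * v * e ^+ d)%:E * (eta / (4 * v))%:E)%E).
  apply: lee_wpmul2l; last exact: fg.
  by rewrite lee_fin mulr_ge0 ?exprn_ge0 ?(ltW e0)// mulr_ge0// ltW.
rewrite -EFinM lee_fin le_eqVlt; apply/orP; left; apply/eqP; field.
by rewrite gt_eqF.
Unshelve. all: by end_near. Qed.

(** By continuity of the measure from below, the indicators converge in L^1 to that of the union,
    whose measure is finite. *)
Lemma ball_regular_indic_bigcup (F : (set Rd)^nat) :
  (forall n, measurable (F n)) -> nondecreasing_seq F ->
  (lam (\bigcup_n F n) < +oo)%E ->
  (forall n, ball_regular \1_(F n)) -> ball_regular \1_(\bigcup_n F n).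
Proof.
move=> mF ndF UFoo rF; set U := \bigcup_n F n.
have mU : measurable U by exact: bigcup_measurable.
have FU n : F n `<=` U by exact: bigcup_sup.
have FUle n : (lam (F n) <= lam U)%E by apply: le_measure; rewrite ?inE.
apply: ball_regular_approx; first exact: integrable_indic.
move=> eta eta0.
have Ufin : lam U \is a fin_num by rewrite ge0_fin_numE.
have : lam (F n) @[n --> \oo] --> (fine (lam U))%:E.
  by rewrite fineK//; exact: (@nondecreasing_cvg_mu _ _ _ lam).
move=> /fine_cvgP[_ /cvgrPdist_le /(_ _ eta0)] [N _ HN].
exists \1_(F N); split=> //; first by apply: integrable_indic => //; exact: le_lt_trans UFoo.
rewrite (eq_integral (EFin \o \1_(U `\` F N))); last first.
  move=> x _ /=; congr EFin; rewrite !indicE.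
  have [xF|xF] := pselect (F N x).
    rewrite (mem_set xF) (mem_set (FU _ _ xF)) memNset ?subrr ?normr0//.
    by case.
  rewrite (memNset xF) subr0 ger0_norm//; congr ((_ : bool)%:R).
  by apply/idP/idP; rewrite !inE // => -[].
rewrite integral_indic//; last exact: measurableD.
rewrite setIT measureD// setIidr//.
have FNfin : lam (F N) \is a fin_num.
  by rewrite ge0_fin_numE// (le_lt_trans (FUle N)).
have /= := HN N (leqnn N); rewrite -(fineK Ufin) -(fineK FNfin) -EFinB lee_fin.
by apply: le_trans; exact: ler_norm.
Qed.

Let cube (k : nat) : set Rd := rect (fun=> - k%:R) (fun=> k%:R).

Let cube_fin k : (lam (cube k) < +oo)%E.
Proof. by rewrite /cube /rect lebesgue_Rd_itv ltry. Qed.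

Let mcube k : measurable (cube k). Proof. exact: measurable_rect. Qed.

Let cap_fin A k : measurable A -> (lam (A `&` cube k) < +oo)%E.
Proof.
move=> mA; apply: le_lt_trans (cube_fin k); apply: le_measure; rewrite ?inE//.
exact: measurableI.
Qed.

(** Dynkin induction from the boxes. Intersecting with a cube keeps all indicators integrable, so a
    complement becomes a difference of two regular functions. *)
Lemma ball_regular_indic_cube k A : measurable A -> ball_regular \1_(A `&` cube k).
Proof.
have mE := measurable_boxes d (@ocitv_ocitv_nat R) nd_ocitv_nat bigcup_ocitv_nat
  (@measurable_ocitv R).
rewrite mE; move: A.
apply: (dynkin_induction mE).
- exact/setI_closed_boxes/ocitvI.
- by rewrite setTI; exact: ball_regular_rect.
- move=> _ [A /= oA <-].
  have /choice[ab abA] : forall i, exists ab : R * R, `]ab.1, ab.2]%classic = A i.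
    by move=> i; have [x _ <-] := oA i; exists x.
  rewrite (_ : _ `&` _ =
    rect (fun i => Num.max (ab i).1 (- k%:R)) (fun i => Num.min (ab i).2 k%:R)).
    exact: ball_regular_rect.
  apply/seteqP; split=> [x [Ax /rectP kx]|x /rectP h].
    apply/rectP => i; have := Ax i; rewrite /= -abA/= in_itv/= => /andP[h1 h2].
    have /andP[h3 h4] := kx i.
    by rewrite gt_max h1 h3 le_min h2 h4.
  split; [move=> i; rewrite -abA /= in_itv/= | apply/rectP => i].
    by have := h i; rewrite gt_max le_min => /andP[/andP[-> _] /andP[-> _]].
  by have := h i; rewrite gt_max le_min => /andP[/andP[_ ->] /andP[_ ->]].
- move=> A mA' rA.
  rewrite (_ : \1_(~` A `&` cube k) =
      (\1_(cube k) \+ (fun x => (-1) * \1_(A `&` cube k) x))%R); last first.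
    apply/funext => x /=; rewrite !indicE.
    have [xc|xc] := pselect (cube k x); last first.
      by rewrite !memNset ?mulr0 ?addr0//; case.
    rewrite (mem_set xc); have [xA|xA] := pselect (A x).
      by rewrite memNset ?mem_set ?mulr1 ?subrr//; case.
    by rewrite mem_set ?memNset ?mulr0 ?addr0//; case.
  apply: ball_regularD.
  - exact: integrable_indic.
  - apply: integrableZR; apply: integrable_indic; first exact: measurableI.
    exact: cap_fin.
  - exact: ball_regular_rect.
  - apply: ball_regularZ => //; apply: integrable_indic; first exact: measurableI.
    exact: cap_fin.
- move=> F mF tF rF.
  (* The partial unions increase, so the monotone case applies; disjointness makes the indicators
     add up. *)
  pose U n := \big[setU/set0]_(i < n) (F i `&` cube k).
  have mU n : measurable (U n).
    by apply: bigsetU_measurable => i _; exact: measurableI.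
  have UE : \bigcup_n F n `&` cube k = \bigcup_n U n.
    apply/seteqP; split=> [x [[i _ Fx] cx]|x [n _]].
      by exists i.+1 => //; rewrite /U big_ord_recr/=; right.
    by rewrite /U -(bigcup_mkord _ (fun i => F i `&` cube k)) => -[i _ [Fx cx]]; split=> //; exists i.
  have Uc n : U n `<=` cube k.
    by rewrite /U -(bigcup_mkord _ (fun i => F i `&` cube k)) => x [i _ []].
  rewrite UE; apply: ball_regular_indic_bigcup => //.
  + by move=> m n mn; apply/subsetPset => x; rewrite /U -!(bigcup_mkord _ (fun i => F i `&` cube k));
      move=> -[i /= im Fx]; exists i => //=; exact: leq_trans im mn.
  + by rewrite -UE; apply: cap_fin; exact: bigcup_measurable.
  elim=> [|n ih].
    rewrite /U big_ord0 (_ : \1_set0 = (fun x => 0 * \1_(cube k) x)); last first.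
      by apply/funext => x; rewrite mul0r indic0.
    by apply: ball_regularZ; [exact: integrable_indic|exact: ball_regular_rect].
  rewrite (_ : \1_(U n.+1) = (\1_(U n) \+ \1_(F n `&` cube k))%R).
    apply: ball_regularD => //; apply: integrable_indic => //.
    + apply: le_lt_trans (cube_fin k); apply: le_measure; rewrite ?inE//.
    + exact: measurableI.
    + exact: cap_fin.
  rewrite /U big_ord_recr/= -/(U n); apply/funext => x /=; rewrite !indicE.
  have [xU|xU] := pselect (U n x).
    rewrite (mem_set xU) mem_set; last by left.
    rewrite memNset ?addr0// => -[xF _].
    move: xU; rewrite /U -(bigcup_mkord _ (fun i => F i `&` cube k)) => -[i /= ni [xFi _]].
    move/trivIsetP : tF => /(_ i n I I); rewrite ltn_eqF// => /(_ isT).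
    by rewrite -subset0 => /(_ x (conj xFi xF)).
  rewrite (memNset xU) add0r; congr ((_ : bool)%:R).
  by apply/idP/idP; rewrite !inE; [case|right].
Qed.

Lemma bigcup_cube : \bigcup_k cube k = setT.
Proof. exact: (bigcup_boxes d (@nd_ocitv_nat R) bigcup_ocitv_nat). Qed.

Lemma ball_regular_indic A : measurable A -> (lam A < +oo)%E -> ball_regular \1_A.
Proof.
move=> mA Aoo.
have AE : A = \bigcup_k (A `&` cube k).
  by rewrite -setI_bigcupr bigcup_cube setIT.
rewrite AE; apply: ball_regular_indic_bigcup.
- by move=> n; exact: measurableI.
- move=> m n mn; apply/subsetPset; apply: setIS => x /= h i.
  by have /subsetPset := @nd_ocitv_nat R _ _ mn; apply; exact: h.
- by rewrite -AE.
- by move=> n; exact: ball_regular_indic_cube.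
Qed.

Theorem ball_regular_integrable f : lam.-integrable setT (EFin \o f) ->
  ball_regular f.
Proof.
move=> fi; apply: (ball_regular_approx fi) => eta eta0.
have [g [gi _ /fine_cvgP[gfin /cvgrPdist_le /(_ _ eta0) gf]]] :=
  approximation_sfun_integrable measurableT fi.
have [N _ /(_ N (leqnn N)) /= [Nfin Nle]] := filterI gfin gf.
exists (fun x => g N x); split; first exact: gi; last first.
  rewrite -[leLHS](fineK Nfin) lee_fin; move: Nle; rewrite sub0r normrN.
  by apply: le_trans; exact: ler_norm.
have gNE x : g N x = \sum_(y <- fset_set (range (g N))) y * \1_(g N @^-1` [set y]) x.
  by rewrite fimfunE fsbig_finite.
rewrite (_ : (fun x => g N x) = (fun x => \sum_(y <- fset_set (range (g N)))
    y * \1_(g N @^-1` [set y]) x)); last exact/funext.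
have mg y : measurable (g N @^-1` [set y]) by exact: measurable_sfunP.
(* On this level set [|y|] is the value of [|g N|], so integrability bounds its measure. The level 0
   may have infinite measure, but its term in the sum vanishes. *)
have gy (y : R) : y != 0 -> (lam (g N @^-1` [set y]) < +oo)%E.
  move=> y0; have yN : 0 < `|y| by rewrite normr_gt0.
  rewrite -(@lte_pmul2l _ `|y|%:E)// mulry gtr0_sg// mul1e.
  have /integrableP[_] := gi N; apply: le_lt_trans.
  rewrite -(setIT (g N @^-1` [set y])) -integral_indic// -ge0_integralZl//; last first.
    by apply/measurable_EFinP; exact: measurable_indic.
  apply: ge0_le_integral => //.
  - by apply/measurable_EFinP/measurable_funM => //; exact: measurable_indic.
  - by apply/measurable_EFinP; apply: measurableT_comp.
  - move=> x _ /=; rewrite -EFinM lee_fin indicE.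
    have [xy|xy] := pselect (g N x = y).
      by rewrite mem_set// mulr1 xy.
    by rewrite memNset ?mulr0.
pose h s x := \sum_(y <- s) y * \1_(g N @^-1` [set y]) x.
suff H s : lam.-integrable setT (EFin \o h s) /\ ball_regular (h s).
  by have [] := H (fset_set (range (g N))).
elim: s => [|y s [si sr]].
  have m0 : measurable (set0 : set Rd) by [].
  have l0 : (lam set0 < +oo)%E by rewrite measure0.
  rewrite (_ : h [::] = \1_set0); last by apply/funext => x; rewrite /h big_nil indic0.
  split; first exact: integrable_indic.
  exact: ball_regular_indic.
have [->|y0] := eqVneq y 0.
  rewrite (_ : h (0 :: s) = h s); first by split.
  by apply/funext => x; rewrite /h big_cons mul0r add0r.
rewrite (_ : h (y :: s) = ((fun x => y * \1_(g N @^-1` [set y]) x) \+ h s)%R); last first.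
  by apply/funext => x; rewrite /h big_cons.
have iy := integrable_indic (mg y) (gy y y0).
split; first by apply: integrableDR => //; exact: integrableZR.
apply: ball_regularD => //; first exact: integrableZR.
apply: ball_regularZ; [exact: iy|exact: (ball_regular_indic (mg y) (gy y y0))].
Qed.

End ball_regular_integrable.

(** * Independent samples *)

Section independence.
Local Open Scope ereal_scope.
Context {disp} {Omega : measurableType disp} {R : realType}.
Variable P : probability Omega R.
Context {d' : measure_display} {T : measurableType d'}.
Variable X : nat -> {RV P >-> T}.

Definition first_rvs m (w : Omega) : m.-tuple T := [tuple X i w | i < m].

Lemma tnth_first_rvs m w i : tnth (first_rvs m w) i = X i w.
Proof. exact: tnth_mktuple. Qed.

Lemma measurable_first_rvs m : measurable_fun setT (first_rvs m).
Proof.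
apply/measurable_fun_tnthP => i.
rewrite (_ : _ \o _ = X i)//.
by apply/funext => w /=; rewrite tnth_mktuple.
Qed.

(** Measurability with respect to the first [m] variables, expressed by a factorization because
    composition and pairing then preserve it directly. *)
Definition past m {d1} {T1 : measurableType d1} (U : Omega -> T1) :=
  exists2 phi : m.-tuple T -> T1, measurable_fun setT phi & U = phi \o first_rvs m.

Lemma past_measurable m d1 (T1 : measurableType d1) (U : Omega -> T1) :
  past m U -> measurable_fun setT U.
Proof.
by move=> [phi mphi ->]; apply: measurableT_comp => //; exact: measurable_first_rvs.
Qed.

Lemma past_comp m d1 d2 (T1 : measurableType d1) (T2 : measurableType d2)
    (f : T1 -> T2) (U : Omega -> T1) :
  measurable_fun setT f -> past m U -> past m (f \o U).
Proof.
by move=> mf [phi mphi ->]; exists (f \o phi) => //; exact: measurableT_comp.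
Qed.

Lemma past_pair m d1 d2 (T1 : measurableType d1) (T2 : measurableType d2)
    (U1 : Omega -> T1) (U2 : Omega -> T2) :
  past m U1 -> past m U2 -> past m (fun w => (U1 w, U2 w)).
Proof.
move=> [phi mphi ->] [psi mpsi ->]; exists (fun v => (phi v, psi v)) => //.
exact: measurable_fun_pair.
Qed.

Lemma past_first_rvs m m' : (m <= m')%N -> past m' (first_rvs m).
Proof.
move=> mm'; exists (fun v => [tuple tnth v (widen_ord mm' i) | i < m]).
  apply/measurable_fun_tnthP => i.
  rewrite (_ : _ \o _ = (fun v => tnth v (widen_ord mm' i))).
    exact: measurable_tnth.
  by apply/funext => w /=; rewrite tnth_mktuple.
by apply/funext => w; apply: eq_from_tnth => i /=; rewrite !tnth_mktuple.
Qed.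

Lemma past_le m m' d1 (T1 : measurableType d1) (U : Omega -> T1) : (m <= m')%N ->
  past m U -> past m' U.
Proof. by move=> mm' [phi mphi ->]; apply: past_comp => //; exact: past_first_rvs. Qed.

Lemma past_rv m i : (i < m)%N -> past m (X i).
Proof.
move=> im; exists (fun v => tnth v (Ordinal im)); first exact: measurable_tnth.
by apply/funext => w /=; rewrite tnth_mktuple.
Qed.

Hypothesis X_indep : mutually_independent X.

Lemma mutually_independent_iota n (A : nat -> set T) :
  (forall i, measurable (A i)) ->
  P [set w | forall i, (i < n)%N -> A i (X i w)] =
  \prod_(i < n) P (X i @^-1` A i).
Proof.
move=> mA; pose J := [fset i | i in iota 0 n]%fset.
have JE i : (i \in J) = (i < n)%N.
  apply/imfsetP/idP => [[k /=]|ni]; first by rewrite mem_iota => /andP[_ kn] ->.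
  by exists i => //=; rewrite mem_iota.
rewrite (_ : [set w | _] = \bigcap_(i in [set` J]) (X i @^-1` A i)).
  rewrite X_indep// (perm_big (iota 0 n)) /=.
    by rewrite -[in LHS](subn0 n) big_mkord.
  apply: uniq_perm; [exact: fset_uniq|exact: iota_uniq|].
  by move=> i; rewrite JE mem_iota.
apply/seteqP; split=> [w h i /=|w h i ni]; first by rewrite JE => /h.
by apply: h => /=; rewrite JE.
Qed.

(** For fixed [B] both sides are finite measures in [A], and on boxes the identity is the
    independence of [m + 1] variables. *)
Lemma first_rvs_indep m A B : measurable A -> measurable B ->
  P (first_rvs m @^-1` A `&` X m @^-1` B) = P (first_rvs m @^-1` A) * P (X m @^-1` B).
Proof.
move=> mA mB.
have mXB : measurable (X m @^-1` B).
  by rewrite -[X in measurable X]setTI; exact: measurable_funP.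
have Bfin : P (X m @^-1` B) \is a fin_num by exact: fin_num_measure.
have B0 : (0 <= fine (P (X m @^-1` B)))%R by exact: fine_ge0.
pose m1 := image_measure (mrestr P mXB) (@measurable_first_rvs m).
pose m2 : {measure set _ -> \bar R} :=
  mscale (NngNum B0) (image_measure P (@measurable_first_rvs m)).
suff : m1 A = m2 A.
  by rewrite /m1 /image_measure/= /pushforward /mrestr /m2/= /mscale/= fineK// muleC.
apply: (measure_unique (boxes measurable) (fun=> box_of (fun=> setT))) => //.
- apply: (@measurable_boxes _ _ m measurable (fun=> setT)) => //.
  + exact: bigcup_const.
  + by rewrite sigma_algebra_id//; exact: sigma_algebra_measurable.
- by apply: setI_closed_boxes; exact: measurableI.
- by move=> _; exists (fun=> setT).
- by rewrite bigcup_const//; apply/seteqP; split.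
- move=> _ [C mC <-]; rewrite /m1 /image_measure/= /pushforward /mrestr /m2/= /mscale/= fineK//.
  (* The sides of the box for indices below [m], then [B] from index [m] on. *)
  pose A' i := if insub i is Some k then C k else B.
  have A'i (i : 'I_m) : A' i = C i by rewrite /A' valK.
  have A'm : A' m = B by rewrite /A' insubF// ltnn.
  have mA' i : measurable (A' i) by rewrite /A'; case: insub.
  rewrite (_ : _ `&` _ = [set w | forall i, (i < m.+1)%N -> A' i (X i w)]).
    rewrite mutually_independent_iota// big_ord_recr/= A'm muleC; congr (_ * _).
    rewrite -mutually_independent_iota//; congr (P _).
    apply/seteqP; split=> w h i; first by rewrite tnth_first_rvs -A'i; exact: h.
    by move=> im; have := h (Ordinal im); rewrite tnth_first_rvs/= -A'i.
  apply/seteqP; split=> [w [h hm] i|w h].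
    rewrite ltnS leq_eqVlt => /predU1P[->|im]; first by rewrite A'm.
    by have := h (Ordinal im); rewrite tnth_first_rvs/= -A'i.
  split; last by rewrite /= -A'm; exact: h.
  by move=> i; rewrite tnth_first_rvs -A'i; apply: h; rewrite ltnS ltnW.
- move=> _; rewrite /m1 /image_measure/= /pushforward /mrestr/=.
  by rewrite (le_lt_trans (probability_le1 _ _)) ?ltry//; apply: measurableI => //;
    rewrite -[X in measurable X]setTI; apply: measurable_first_rvs => //;
    exact: measurable_box_of.
Qed.

Lemma past_indep m d1 (T1 : measurableType d1) (U : Omega -> T1) A B :
  past m U -> measurable A -> measurable B ->
  P (U @^-1` A `&` X m @^-1` B) = P (U @^-1` A) * P (X m @^-1` B).
Proof.
move=> [phi mphi ->] mA mB; rewrite comp_preimage; apply: first_rvs_indep => //.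
by rewrite -[X in measurable X]setTI; exact: mphi.
Qed.

(** By independence the pair has the product law, and Tonelli integrates the new variable with [U]
    frozen. *)
Lemma past_fubini m d1 (T1 : measurableType d1) (U : Omega -> T1)
    (h : T1 * T -> \bar R) :
  past m U -> measurable_fun setT h -> (forall p, 0 <= h p) ->
  \int[P]_w h (U w, X m w) = \int[P]_w \int[distribution P (X m)]_z h (U w, z).
Proof.
move=> pU mh h0; have mU := past_measurable pU.
pose V w := (U w, X m w).
have mV : measurable_fun setT V.
  exact: measurable_fun_pair.
pose U' : {mfun Omega >-> T1} :=
  HB.pack_for {mfun Omega >-> T1} U (isMeasurableFun.Build _ _ _ _ U mU).
pose UX : {mfun Omega >-> (T1 * T)%type} :=
  HB.pack_for {mfun Omega >-> (T1 * T)%type} V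
    (isMeasurableFun.Build _ _ _ _ V mV).
transitivity (\int[distribution P UX]_p h p).
  by rewrite ge0_integral_distribution.
transitivity (\int[distribution P U' \x distribution P (X m)]_p h p).
  apply: eq_measure_integral => A mA _; apply/esym.
  apply: product_measure_unique => // B C mB mC.
  rewrite /distribution/= /pushforward/= -past_indep//.
rewrite fubini_tonelli1//.
apply: (etrans (ge0_integral_distribution U' _ _)) => //.
  exact: measurable_fun_fubini_tonelli_F.
by move=> u; apply: integral_ge0 => z _.
Qed.

End independence.

Lemma measurable_natr_bool (R : realType) d (S : measurableType d) (b : S -> bool) :
  measurable_fun setT b -> measurable_fun setT (fun x => (b x)%:R : R).
Proof.
move=> mb; rewrite (_ : (fun x => _) = \1_(b @^-1` [set true])).
  apply: measurable_indic; rewrite -[X in measurable X]setTI.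
  exact: mb.
by apply/funext => x; rewrite indicE; congr ((_ : bool)%:R);
  apply/idP/idP; rewrite inE.
Qed.

Lemma measurable_in_set d (S : measurableType d) (A : set S) :
  measurable A -> measurable_fun setT (fun x => x \in A).
Proof.
move=> mA; apply: (measurable_fun_bool true) => //.
rewrite setTI (_ : _ @^-1` _ = A)//.
by apply/seteqP; split=> x /=; [move/set_mem|move/mem_set].
Qed.

Lemma measurable_trinom_tail (R : realType) d (S : measurableType d) (p q : S -> R) n j k :
  measurable_fun setT p -> measurable_fun setT q ->
  measurable_fun setT (fun y => trinom_tail (p y) (q y) n j k).
Proof.
move=> mp mq; elim: n j k => [|n ih] [|j] [|k]; rewrite /=;
  try exact: measurable_cst.
by apply: measurable_funD; [apply: measurable_funD|]; apply: measurable_funM => //;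
  apply: measurable_funB => //; apply: measurable_funB.
Qed.

(** * Joint counts of later points in two disjoint regions *)

Section counting.
Local Open Scope ereal_scope.
Context {disp} {Omega : measurableType disp} {R : realType}.
Variable P : probability Omega R.
Context {d' : measure_display} {T : measurableType d'}.
Variables (X : nat -> {RV P >-> T}) (Q : probability T R).
Hypothesis X_indep : mutually_independent X.
Hypothesis X_law : forall i A, measurable A -> distribution P (X i) A = Q A.
Context {d1 : measure_display} {S : measurableType d1}.
Variables (m0 : nat) (Y : Omega -> S).
Hypothesis pY : past X m0 Y.
Implicit Types (A B : set (S * T)).

(** The sets live in [S * T] so that the region in which later points are counted may depend on
    [Y]. *)
Definition hits A n w : nat := (\sum_(l < n) ((Y w, X (m0 + l) w) \in A))%N.

(** The conditional probability, given that [Y] equals [y], that a later point is a hit. *)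
Definition section_prob A y : R := fine (Q (xsection A y)).

Lemma past_hits A n : measurable A -> past X (m0 + n) (hits A n).
Proof.
move=> mA; elim: n => [|n ih].
  exists (cst 0%N); first exact: measurable_cst.
  by apply/funext => w; rewrite /hits big_ord0.
have p1 : past X (m0 + n.+1) (fun w => (hits A n w, (Y w, X (m0 + n) w))).
  apply: past_pair; first by apply: past_le ih; rewrite leq_add2l.
  apply: past_pair; first by apply: past_le pY; exact: leq_addr.
  by apply: past_rv; rewrite addnS.
rewrite (_ : hits A n.+1 =
    (fun u : nat * (S * T) => (u.1 + (u.2 \in A))%N) \o
    (fun w => (hits A n w, (Y w, X (m0 + n) w)))).
  apply: past_comp => //; apply: measurable_fun_addn => //.
  apply: (measurableT_comp (f := nat_of_bool)) => //.
  exact: (measurableT_comp (measurable_in_set mA) measurable_snd).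
by apply/funext => w; rewrite /hits big_ord_recr.
Qed.

Lemma measurable_section_prob A : measurable A -> measurable_fun setT (section_prob A).
Proof.
move=> mA; apply: (measurableT_comp (@fine_measurable _ setT measurableT)).
exact: measurable_fun_xsection.
Qed.

Lemma section_prob_ge0 A y : (0 <= section_prob A y)%R.
Proof. exact: fine_ge0. Qed.

Lemma section_probE A y : measurable A -> Q (xsection A y) = (section_prob A y)%:E.
Proof. by move=> mA; rewrite fineK// fin_num_measure//; exact: measurable_xsection. Qed.

Lemma section_probD A B y : measurable A -> measurable B -> A `&` B = set0 ->
  Q (~` (xsection A y `|` xsection B y)) = (1 - section_prob A y - section_prob B y)%:E.
Proof.
move=> mA mB AB; have mAy := measurable_xsection y mA; have mBy := measurable_xsection y mB.
rewrite probability_setC; last exact: measurableU.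
rewrite measureU//; last first.
  rewrite -subset0 => z []; rewrite /xsection/= !inE => Az Bz.
  by have : (A `&` B) (y, z) by []; rewrite AB.
transitivity (1 - (section_prob A y + section_prob B y)%:E); last first.
  by rewrite -EFinB; congr EFin; ring.
by rewrite EFinD -!section_probE.
Qed.

Lemma section_prob_sum_le1 A B y : measurable A -> measurable B -> A `&` B = set0 ->
  (section_prob A y + section_prob B y <= 1)%R.
Proof.
move=> mA mB AB.
have : 0 <= Q (~` (xsection A y `|` xsection B y)) by exact: measure_ge0.
by rewrite section_probD// lee_fin; lra.
Qed.

(** Given [Y], the two counts are trinomial because the regions are disjoint. The weight [g] is
    arbitrary so that the induction closes: integrating out one point multiplies the weight by one
    of three conditional probabilities. *)
Lemma integral_hits A B (g : S -> R) n j k :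
  measurable A -> measurable B -> A `&` B = set0 ->
  measurable_fun setT g -> (forall y, 0 <= g y)%R ->
  \int[P]_w (g (Y w) * ((hits A n w < j)%N && (hits B n w < k)%N)%:R)%:E =
  \int[P]_w (g (Y w) * trinom_tail (section_prob A (Y w)) (section_prob B (Y w)) n j k)%:E.
Proof.
move=> mA mB AB; elim: n j k g => [|n ih] j k g mg g0.
  apply: eq_integral => w _; rewrite /hits !big_ord0.
  by case: j k => [|j] [|k].
case: j => [|j].
  by apply: eq_integral => w _; rewrite ltn0 trinom_tail0l.
case: k => [|k].
  by apply: eq_integral => w _; rewrite ltn0 andbF trinom_tail0r.
pose pA := section_prob A; pose pB := section_prob B.
pose i (a b a' b' : nat) : R := ((a < a')%N && (b < b')%N)%:R.
(* The last point falls in [A], in [B] or in neither; a hit lowers by one the threshold left for the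
   first [n] points. *)
pose h (p : (S * (nat * nat)) * T) : \bar R :=
  (g p.1.1 * (\1_A (p.1.1, p.2) * i p.1.2.1 p.1.2.2 j k.+1
   + \1_B (p.1.1, p.2) * i p.1.2.1 p.1.2.2 j.+1 k
   + \1_(~` (A `|` B)) (p.1.1, p.2) * i p.1.2.1 p.1.2.2 j.+1 k.+1))%:E.
pose U w := (Y w, (hits A n w, hits B n w)).
have pU : past X (m0 + n) U.
  apply: past_pair; first by apply: past_le pY; exact: leq_addr.
  by apply: past_pair; exact: past_hits.
have mi j1 k1 : measurable_fun setT (fun p : (S * (nat * nat)) * T =>
    i p.1.2.1 p.1.2.2 j1 k1).
  apply: measurable_natr_bool; apply: measurable_and.
    apply: measurable_fun_ltn => //.
    exact: (measurableT_comp measurable_fst (measurableT_comp measurable_snd measurable_fst)).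
  apply: measurable_fun_ltn => //.
  exact: (measurableT_comp measurable_snd (measurableT_comp measurable_snd measurable_fst)).
have mY : measurable_fun setT (fun p : (S * (nat * nat)) * T => p.1.1).
  exact: (measurableT_comp measurable_fst measurable_fst).
have mYz : measurable_fun setT (fun p : (S * (nat * nat)) * T => (p.1.1, p.2)).
  exact: measurable_fun_pair.
have mind C : measurable C -> measurable_fun setT
    (fun p : (S * (nat * nat)) * T => \1_C (p.1.1, p.2) : R).
  by move=> mC; exact: (measurableT_comp (measurable_indic mC) mYz).
have mh : measurable_fun setT h.
  apply/measurable_EFinP/measurable_funM; first exact: measurableT_comp mg mY.
  apply: measurable_funD; first apply: measurable_funD;
    apply: measurable_funM (mi _ _); apply: mind => //.
  by apply: measurableC; exact: measurableU.
have h0 p : 0 <= h p.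
  by rewrite lee_fin mulr_ge0// !addr_ge0// mulr_ge0.
transitivity (\int[P]_w h (U w, X (m0 + n) w)).
  apply: eq_integral => w _; rewrite /h /U/=; congr (_ * _)%:E.
  rewrite /hits !big_ord_recr/= /i -/(hits A n w) -/(hits B n w).
  have [xA|xA] := pselect (A (Y w, X (m0 + n) w)).
    have xB : ~ B (Y w, X (m0 + n) w).
      by move=> xB; have : (A `&` B) (Y w, X (m0 + n) w) by []; rewrite AB.
    rewrite !indicE (mem_set xA) (memNset xB) memNset ?mul1r ?mul0r ?addr0/=.
      by rewrite addn1 addn0 ltnS.
    by apply; left.
  have [xB|xB] := pselect (B (Y w, X (m0 + n) w)).
    rewrite !indicE (mem_set xB) (memNset xA) memNset ?mul1r ?mul0r ?addr0 ?add0r/=.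
      by rewrite addn1 addn0 ltnS.
    by apply; right.
  rewrite !indicE (memNset xB) (memNset xA) mem_set ?mul1r ?mul0r ?addr0 ?add0r/=.
    by rewrite !addn0.
  by case.
rewrite (past_fubini X_indep pU mh h0).
transitivity (\int[P]_w ((g (Y w) * pA (Y w) * i (hits A n w) (hits B n w) j k.+1)%:E +
   (g (Y w) * pB (Y w) * i (hits A n w) (hits B n w) j.+1 k)%:E +
   (g (Y w) * (1 - pA (Y w) - pB (Y w)) * i (hits A n w) (hits B n w) j.+1 k.+1)%:E)).
  apply: eq_integral => w _.
  have mAy := measurable_xsection (Y w) mA; have mBy := measurable_xsection (Y w) mB.
  pose i1 := i (hits A n w) (hits B n w) j k.+1.
  pose i2 := i (hits A n w) (hits B n w) j.+1 k.
  pose i3 := i (hits A n w) (hits B n w) j.+1 k.+1.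
  rewrite (eq_measure_integral Q) => [|C mC _]; last exact: X_law.
  pose F (C : set T) (r : R) (z : T) := ((g (Y w) * r)%:E * (\1_C z)%:E) : \bar R.
  have mF C r : measurable C -> measurable_fun setT (F C r).
    by move=> mC; apply: emeasurable_funM => //; apply/measurable_EFinP/measurable_indic.
  have F0 C r z : (0 <= r)%R -> 0 <= F C r z.
    by move=> r0; rewrite mule_ge0// lee_fin ?mulr_ge0.
  have iF C r : measurable C -> (0 <= r)%R ->
      \int[Q]_z F C r z = (g (Y w) * r)%:E * Q C.
    move=> mC r0; rewrite ge0_integralZl_EFin ?mulr_ge0//; last first.
      by apply/measurable_EFinP/measurable_indic.
    by rewrite integral_indic// setIT.
  have mN : measurable (~` (xsection A (Y w) `|` xsection B (Y w))).
    by apply: measurableC; exact: measurableU.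
  rewrite (eq_integral (fun z => F (xsection A (Y w)) i1 z + F (xsection B (Y w)) i2 z +
      F (~` (xsection A (Y w) `|` xsection B (Y w))) i3 z)).
    rewrite ge0_integralD//; first last.
    - exact: mF.
    - by move=> z _; exact: F0.
    - by apply: emeasurable_funD; exact: mF.
    - by move=> z _; rewrite adde_ge0// F0.
    rewrite ge0_integralD//; first last.
    - exact: mF.
    - by move=> z _; exact: F0.
    - exact: mF.
    - by move=> z _; exact: F0.
    rewrite !iF// section_probD// !section_probE//.
    by rewrite -!EFinM; congr (_%:E + _%:E + _%:E); rewrite mulrAC.
  move=> z _; rewrite /h /U/= /F -!EFinM -!EFinD; congr EFin.
  have inx (C : set (S * T)) y : \1_(xsection C y) z = \1_C (y, z) :> R.
    by rewrite !indicE mem_xsection.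
  have -> : ~` (xsection A (Y w) `|` xsection B (Y w)) = xsection (~` (A `|` B)) (Y w).
    by apply/seteqP; split=> x; rewrite /xsection /= !inE.
  by rewrite !inx -/i1 -/i2 -/i3; ring.
have pAB y : (0 <= 1 - pA y - pB y)%R.
  by have := section_prob_sum_le1 y mA mB AB; rewrite /pA /pB; lra.
have mY' := past_measurable pY.
have mi' j1 k1 : measurable_fun setT (fun w => i (hits A n w) (hits B n w) j1 k1).
  apply: measurable_natr_bool; apply: measurable_and; apply: measurable_fun_ltn => //.
    exact: past_measurable (past_hits n mA).
  exact: past_measurable (past_hits n mB).
have mpA := measurable_section_prob mA; have mpB := measurable_section_prob mB.
have pA0 := section_prob_ge0 A; have pB0 := section_prob_ge0 B.
have mgA : measurable_fun setT (fun y => g y * pA y)%R by exact: measurable_funM.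
have mgB : measurable_fun setT (fun y => g y * pB y)%R by exact: measurable_funM.
have mgC : measurable_fun setT (fun y => g y * (1 - pA y - pB y))%R.
  by apply: measurable_funM => //; apply: measurable_funB => //; exact: measurable_funB.
have mS (g1 : S -> R) j1 k1 : measurable_fun setT g1 ->
    measurable_fun setT (fun w => (g1 (Y w) * i (hits A n w) (hits B n w) j1 k1)%:E).
  move=> mg1; apply/measurable_EFinP/measurable_funM => //.
  exact: (measurableT_comp mg1 mY').
have mTr (g1 : S -> R) j1 k1 : measurable_fun setT g1 ->
    measurable_fun setT (fun w => (g1 (Y w) * trinom_tail (pA (Y w)) (pB (Y w)) n j1 k1)%:E).
  move=> mg1; apply/measurable_EFinP.
  apply: (measurableT_comp (f := fun y => g1 y * trinom_tail (pA y) (pB y) n j1 k1)%R) => //.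
  by apply: measurable_funM => //; exact: measurable_trinom_tail.
have tr0 y j1 k1 : (0 <= trinom_tail (pA y) (pB y) n j1 k1)%R.
  by apply: trinom_tail_ge0 => //; have := pAB y; lra.
rewrite ge0_integralD//; first last.
- exact: mS mgC.
- by move=> w _; rewrite lee_fin !mulr_ge0.
- by apply: emeasurable_funD; [exact: mS mgA|exact: mS mgB].
- by move=> w _; rewrite adde_ge0// lee_fin !mulr_ge0.
rewrite ge0_integralD//; first last.
- exact: mS mgB.
- by move=> w _; rewrite lee_fin !mulr_ge0.
- exact: mS mgA.
- by move=> w _; rewrite lee_fin !mulr_ge0.
rewrite (ih j k.+1 _ mgA) => [|y]; last by rewrite mulr_ge0.
rewrite (ih j.+1 k _ mgB) => [|y]; last by rewrite mulr_ge0.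
rewrite (ih j.+1 k.+1 _ mgC) => [|y]; last by rewrite mulr_ge0.
rewrite -ge0_integralD//; first last.
- exact: mTr mgB.
- by move=> w _; rewrite lee_fin !mulr_ge0.
- exact: mTr mgA.
- by move=> w _; rewrite lee_fin !mulr_ge0.
rewrite -ge0_integralD//; first last.
- exact: mTr mgC.
- by move=> w _; rewrite lee_fin !mulr_ge0.
- by apply: emeasurable_funD; [exact: mTr mgA|exact: mTr mgB].
- by move=> w _; rewrite adde_ge0// lee_fin !mulr_ge0.
apply: eq_integral => w _; rewrite trinom_tailS -!EFinD -/pA -/pB; congr EFin; ring.
Qed.

End counting.

(** * Layer cake formula and densities *)

Section layer_cake.
Context {R : realType}.
Local Notation leb := (@lebesgue_measure R).

(** The condition [0 < t] is part of the indicator so that layers can be integrated over the whole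
    line. *)
Definition below (t a : R) : R := ((0 < t) && (t < a))%:R.

Lemma below_ge0 t a : 0 <= below t a. Proof. exact: ler0n. Qed.

Lemma below_le1 t a : below t a <= 1.
Proof. by rewrite /below; case: (_ && _). Qed.

Lemma integral_below (a : R) : 0 <= a -> (\int[leb]_t (below t a)%:E = a%:E)%E.
Proof.
move=> a0; rewrite (eq_integral (fun t : measurableTypeR R => (\1_(`]0%R, a[%classic) t)%:E)).
  rewrite integral_indic// setIT/= lebesgue_measure_itv/= lte_fin.
  by case: ltP => [_|a0']; rewrite ?sube0//; congr EFin; apply/eqP; rewrite eq_le a0 a0'.
move=> t _; rewrite indicE /below; congr (((_ : bool)%:R)%:E).
by apply/idP/idP; rewrite ?inE/= in_itv.
Qed.

Lemma measurable_below dd (U : measurableType dd) (s xi : U -> R) :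
  measurable_fun setT s -> measurable_fun setT xi ->
  measurable_fun setT (fun u => below (s u) (xi u)).
Proof.
move=> ms mxi; apply: measurable_natr_bool; apply: measurable_and.
  exact: measurable_fun_ltr.
exact: measurable_fun_ltr.
Qed.

Lemma layer_cake dd (U : measurableType dd)
    (m : {sigma_finite_measure set U -> \bar R}) (k xi : U -> R) :
  measurable_fun setT k -> measurable_fun setT xi ->
  (forall u, 0 <= k u) -> (forall u, 0 <= xi u) ->
  (\int[m]_u (k u * xi u)%:E = \int[leb]_t \int[m]_u (k u * below t (xi u))%:E)%E.
Proof.
move=> mk mxi k0 xi0.
pose lam : {sigma_finite_measure set (measurableTypeR R) -> \bar R} := leb.
pose h (p : U * measurableTypeR R) := (k p.1 * below p.2 (xi p.1))%:E.
have mh : measurable_fun setT h.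
  apply/measurable_EFinP/measurable_funM; first exact: (measurableT_comp mk measurable_fst).
  apply: measurable_below; first exact: measurable_snd.
  exact: (measurableT_comp mxi measurable_fst).
have h0 p : (0 <= h p)%E by rewrite lee_fin mulr_ge0// below_ge0.
rewrite -(fubini_tonelli (m1 := m) (m2 := lam) h mh h0).
apply: eq_integral => u _; rewrite /h/=.
under eq_integral do rewrite EFinM.
rewrite ge0_integralZl_EFin//; last first.
- by apply/measurable_EFinP; exact: measurable_below.
- by move=> t _; rewrite lee_fin below_ge0.
by rewrite integral_below// EFinM.
Qed.

End layer_cake.

Section density.
Context {R : realType} {d : nat}.
Local Notation Rd := (d.-tuple R).
Local Notation lam := (@lebesgue_Rd R d).
Variables (Q : probability Rd R) (f : Rd -> R).
Hypotheses (mf : measurable_fun setT f) (f0 : forall y, 0 <= f y).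
Hypothesis Qf : forall A, measurable A -> Q A = (\int[lam]_(y in A) (f y)%:E)%E.

(** The density formula is known for sets; the layer cake formula on both sides reduces functions to
    the superlevel sets of [psi]. *)
Lemma integral_density (psi : Rd -> R) : measurable_fun setT psi ->
  (forall y, 0 <= psi y) ->
  (\int[Q]_y (psi y)%:E = \int[lam]_y (f y * psi y)%:E)%E.
Proof.
move=> mpsi psi0; rewrite layer_cake//.
under eq_integral do rewrite -(mul1r (psi _)).
rewrite layer_cake//; apply: eq_integral => t _.
pose A := [set y | 0 < t /\ t < psi y].
have bE y : below t (psi y) = \1_A y.
  rewrite indicE /below; congr ((_ : bool)%:R).
  by apply/idP/idP; rewrite inE => /andP.
have mA : measurable A.
  rewrite -[X in measurable X]setTI.
  have := @measurable_below R _ Rd (cst t) psi (measurable_cst _) mpsi.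
  under eq_fun do rewrite bE.
  by move/measurable_indicP; rewrite setTI.
under eq_integral do rewrite mul1r bE.
under [RHS]eq_integral do rewrite bE.
rewrite integral_indic// setIT/= Qf// [in LHS]integral_mkcond.
by apply: eq_integral => y _; rewrite epatch_indic/= -EFinM.
Qed.

Lemma integral_density_le (M : R) (psi : Rd -> R) : measurable_fun setT psi ->
  (forall y, 0 <= psi y) -> (forall y, f y <= M) ->
  (\int[Q]_y (psi y)%:E <= M%:E * \int[lam]_y (psi y)%:E)%E.
Proof.
move=> mpsi psi0 fM; rewrite integral_density//.
have M0 : 0 <= M by exact: le_trans (f0 (@origin R d)) (fM _).
rewrite -ge0_integralZl//; [|exact/measurable_EFinP|by move=> y _; rewrite lee_fin].
apply: ge0_le_integral => //.
- by move=> y _; rewrite lee_fin mulr_ge0.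
- by apply/measurable_EFinP; exact: measurable_funM.
- by apply: emeasurable_funM => //; apply/measurable_EFinP.
- by move=> y _; rewrite -EFinM lee_fin ler_wpM2r.
Qed.

End density.

(** * Neighbor counts *)

Section neighbor_counts.
Local Open Scope ereal_scope.
Context {disp} {Omega : measurableType disp} {R : realType}.
Variable P : probability Omega R.
Context {d : nat}.
Local Notation Rd := (d.-tuple R).
Variables (Q : probability Rd R).
Implicit Types (X : nat -> {RV P >-> Rd}) (rho : R).

(** Counting indices gives a sum of indicators that behaves well under permutations of the sample.
    For distinct sample points it agrees with the count in the finite set, by
    [count_sample_neighbors]. *)
Definition neighbors X rho n i w : nat :=
  (\sum_(k <- iota 0 n | k != i) (euclidean_dist (X i w) (X k w) < rho)%R)%N.

Definition ball_prob rho x : R := fine (Q (eball x rho)).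

Definition iid X := mutually_independent X /\
  forall i A, measurable A -> distribution P (X i) A = Q A.

Let near_pairs rho : set (Rd * Rd) := [set p | euclidean_dist p.1 p.2 < rho]%R.

Lemma section_prob_ball rho x : section_prob Q (near_pairs rho) x = ball_prob rho x.
Proof.
rewrite /section_prob /ball_prob; congr (fine (Q _)).
by apply/seteqP; split=> y; rewrite /xsection/= inE.
Qed.

Lemma measurable_ball_prob rho : measurable_fun setT (ball_prob rho).
Proof.
rewrite (_ : ball_prob rho = section_prob Q (near_pairs rho)).
  by apply: measurable_section_prob; exact: measurable_ball_kernel.
by apply/funext => x; rewrite section_prob_ball.
Qed.

Lemma ball_prob01 rho x : (0 <= ball_prob rho x <= 1)%R.
Proof.
rewrite fine_ge0//= -lee_fin fineK ?probability_le1//; first exact: measurable_eball.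
by rewrite fin_num_measure//; exact: measurable_eball.
Qed.

Lemma measurable_binom_ball_prob rho n j :
  measurable_fun setT (fun x => binom_tail (ball_prob rho x) n j).
Proof.
under eq_fun do rewrite -trinom_tail_binom.
by apply: measurable_trinom_tail => //; exact: measurable_ball_prob.
Qed.

Lemma integral_iid X i (psi : Rd -> R) : iid X -> measurable_fun setT psi ->
  (forall x, 0 <= psi x)%R ->
  \int[P]_w (psi (X i w))%:E = \int[Q]_x (psi x)%:E.
Proof.
move=> [_ Xlaw] mpsi psi0.
have mE : measurable_fun setT (fun x => (psi x)%:E) by exact/measurable_EFinP.
have := ge0_integral_distribution (X i) mE.
rewrite /comp => <-; last by move=> x; rewrite lee_fin.
by apply: eq_measure_integral => A mA _; exact: Xlaw.
Qed.

Lemma measurable_neighbors X rho n i : measurable_fun setT (neighbors X rho n i).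
Proof.
rewrite /neighbors; elim: (iota 0 n) => [|k s ih].
  by under eq_fun do rewrite big_nil; exact: measurable_cst.
pose b w := (k != i) && (euclidean_dist (X i w) (X k w) < rho)%R.
pose N w := (\sum_(k <- s | k != i) (euclidean_dist (X i w) (X k w) < rho)%R)%N.
have mb : measurable_fun setT b.
  apply: measurable_and; first exact: measurable_cst.
  by apply: measurable_fun_ltr => //; apply: measurable_euclidean_dist; exact: measurable_funP.
have -> : (fun w => (\sum_(l <- k :: s | l != i)
    (euclidean_dist (X i w) (X l w) < rho)%R)%N) = (fun w => nat_of_bool (b w) + N w)%N.
  by apply/funext => w; rewrite big_cons /b /N; case: (k != i).
apply: measurable_fun_addn; last exact: ih.
by apply: (measurableT_comp (f := nat_of_bool)).
Qed.

(** Given the first point, each of the [n] others falls in its ball independently. This is the joint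
    count with an empty second region and threshold 1. *)
Lemma neighbors0_prob X rho n j : iid X ->
  \int[P]_w ((neighbors X rho n.+1 0 w < j)%N%:R)%:E =
  \int[Q]_x (binom_tail (ball_prob rho x) n j)%:E.
Proof.
move=> iidX; have [Xind Xlaw] := iidX.
rewrite -(integral_iid 0 iidX); first last.
- by move=> x; apply: binom_tail_ge0; exact: ball_prob01.
- exact: measurable_binom_ball_prob.
have p0 : past X 1 (X 0%N) by exact: past_rv.
have mg : measurable_fun setT (fun _ : Rd => 1%R : R) by exact: measurable_cst.
have := integral_hits Xind Xlaw p0 n j 1 (measurable_ball_kernel rho)
  measurable0 (setI0 _) mg (fun=> ler01).
have s0 x : section_prob Q (set0 : set (Rd * Rd)) x = 0%R.
  by rewrite /section_prob xsection0 measure0.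
under [X in _ = X -> _]eq_integral do
  rewrite s0 trinom_tail_binom section_prob_ball mul1r.
move=> <-; apply: eq_integral => w _; rewrite mul1r.
have -> : hits X 1 (X 0%N) set0 n w = 0%N.
  by rewrite /hits big1// => l _; rewrite memNset.
rewrite andbT; congr (((_ < _)%N)%:R%:E).
rewrite /neighbors /hits /= big_cons/= big_seq_cond.
rewrite (eq_bigl (fun i => i \in iota 1 n)); last first.
  by move=> i; case: i => [|i]; rewrite ?andbT// andbF mem_iota.
rewrite -big_seq (iotaDl 1 0) big_map -(subn0 n) big_mkord subn0.
by apply: eq_bigr => l _; congr nat_of_bool; apply/idP/idP; rewrite inE.
Qed.

Lemma close_pair_prob X rho (C : R) : iid X ->
  (forall x, Q (eball x rho) <= C%:E) ->
  \int[P]_w ((euclidean_dist (X 0%N w) (X 1%N w) < rho)%R%:R)%:E <= C%:E.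
Proof.
move=> iidX QC; have [Xind Xlaw] := iidX.
have p0 : past X 1 (X 0%N) by exact: past_rv.
have m1 : measurable_fun setT (fun p : Rd * Rd => (\1_(near_pairs rho) p : R)%:E).
  by apply/measurable_EFinP; apply: measurable_indic; exact: measurable_ball_kernel.
rewrite (eq_integral (fun w => (\1_(near_pairs rho) (X 0%N w, X 1%N w) : R)%:E)); last first.
  by move=> w _; rewrite indicE; congr (((_ : bool)%:R)%:E); apply/idP/idP; rewrite inE.
rewrite (past_fubini Xind p0 m1)//.
apply: (@le_trans _ _ (\int[P]_w (cst C%:E w))); last first.
  by rewrite integral_cst//= probability_setT mule1.
apply: ge0_le_integral => //.
- by move=> w _; apply: integral_ge0.
- have mF : measurable_fun setT (fubini_F (distribution P (X 1%N))
      (fun p => (\1_(near_pairs rho) p : R)%:E)).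
    exact: measurable_fun_fubini_tonelli_F.
  by apply: (measurableT_comp mF); exact: measurable_funP.
move=> w _; rewrite (eq_measure_integral Q) => [|B mB _]; last exact: Xlaw.
under eq_integral do rewrite -indic_eball.
rewrite integral_indic//; last exact: measurable_eball.
by rewrite setIT; exact: QC.
Qed.

(** Condition on the first two points. A pair closer than [2 * rho] is charged to [C]; otherwise the
    balls are disjoint, negative association gives a product, and independence of the two points
    turns its integral into a square. *)
Lemma neighbors01_prob X rho (C : R) n j : (0 < rho)%R -> iid X ->
  (forall x, Q (eball x (2 * rho)) <= C%:E) ->
  \int[P]_w (((neighbors X rho n.+2 0 w < j) && (neighbors X rho n.+2 1 w < j))%N%:R)%:E
  <= C%:E + (\int[Q]_x (binom_tail (ball_prob rho x) n j)%:E) *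
    (\int[Q]_x (binom_tail (ball_prob rho x) n j)%:E).
Proof.
move=> rho0 iidX QC; have [Xind Xlaw] := iidX.
pose far (y : Rd * Rd) := (2 * rho <= euclidean_dist y.1 y.2)%R.
pose Y w := (X 0%N w, X 1%N w).
have pY : past X 2 Y by apply: past_pair; exact: past_rv.
have mfar : measurable_fun setT far.
  by apply: measurable_fun_ler => //; exact: measurable_euclidean_dist.
(* Both regions are empty for a close pair, which makes them disjoint for every value of [Y]. *)
pose A := [set p : (Rd * Rd) * Rd | (euclidean_dist p.1.1 p.2 < rho)%R && far p.1].
pose B := [set p : (Rd * Rd) * Rd | (euclidean_dist p.1.2 p.2 < rho)%R && far p.1].
have mAB (b : (Rd * Rd) -> Rd) : measurable_fun setT b ->
    measurable [set p : (Rd * Rd) * Rd | (euclidean_dist (b p.1) p.2 < rho)%R && far p.1].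
  move=> mb; rewrite -[X in measurable X]setTI.
  suff /(_ measurableT [set true]) : measurable_fun setT
      (fun p : (Rd * Rd) * Rd => (euclidean_dist (b p.1) p.2 < rho)%R && far p.1).
    by apply.
  apply: measurable_and; last exact: (measurableT_comp mfar measurable_fst).
  apply: measurable_fun_ltr => //; apply: measurable_euclidean_dist => //.
  exact: (measurableT_comp mb measurable_fst).
have mA : measurable A by exact: (mAB fst).
have mB : measurable B by exact: (mAB snd).
have AB0 : A `&` B = set0.
  rewrite -subset0 => -[[y1 y2] z] [/andP[/= h1 h] /andP[/= h2 _]].
  by have : (eball y1 rho `&` eball y2 rho) z by []; rewrite (eball_disjoint h).
pose g y : R := (far y)%:R.
have mg : measurable_fun setT g by exact: measurable_natr_bool.
have g0 y : (0 <= g y)%R by exact: ler0n.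
have mX i : measurable_fun setT (X i : Omega -> Rd) by exact: measurable_funP.
have mhit C1 k : measurable C1 -> measurable_fun setT (fun w => (hits X 2 Y C1 n w < k)%N).
  by move=> mC; apply: measurable_fun_ltn => //; exact: past_measurable (past_hits pY n mC).
have mclose : measurable_fun setT (fun w => (euclidean_dist (X 0%N w) (X 1%N w) < 2 * rho)%R).
  by apply: measurable_fun_ltr => //; exact: measurable_euclidean_dist.
have mgY : measurable_fun setT (fun w => g (Y w)).
  by apply: (measurableT_comp mg); exact: past_measurable pY.
apply: (@le_trans _ _ (\int[P]_w
    (((euclidean_dist (X 0%N w) (X 1%N w) < 2 * rho)%R%:R)%:E +
     (g (Y w) * ((hits X 2 Y A n w < j)%N && (hits X 2 Y B n w < j)%N)%:R)%:E))).
  apply: ge0_le_integral => //.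
  - apply/measurable_EFinP/measurable_natr_bool/measurable_and;
      by apply: measurable_fun_ltn => //; exact: measurable_neighbors.
  - apply: emeasurable_funD; apply/measurable_EFinP.
      exact: measurable_natr_bool.
    apply: measurable_funM => //; apply: measurable_natr_bool.
    by apply: measurable_and; exact: mhit.
  move=> w _; rewrite -EFinD lee_fin.
  (* The regional counts leave out the first two points, so they are at most the neighbor counts,
     and passing to them can only enlarge the event. *)
  have hle (C1 : set ((Rd * Rd) * Rd)) (i : nat) : (i < 2)%N ->
      (forall k, (2 <= k)%N -> (Y w, X k w) \in C1 ->
        (euclidean_dist (X i w) (X k w) < rho)%R) ->
      (hits X 2 Y C1 n w <= neighbors X rho n.+2 i w)%N.
    move=> i2 hC; pose F k : nat := (euclidean_dist (X i w) (X k w) < rho)%R.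
    apply: (@leq_trans (\sum_(k <- iota 2 n | k != i) F k)); last first.
      by rewrite /neighbors/= !big_cons; do 2 case: ifP => _ //;
        rewrite ?addnA leq_addl.
    rewrite big_seq_cond (eq_bigl (fun k => k \in iota 2 n)); last first.
      move=> k; rewrite mem_iota; case: (leqP 2 k) => //= k2.
      by rewrite (gtn_eqF (leq_trans i2 k2)) andbT.
    rewrite -big_seq (iotaDl 2 0) big_map -(subn0 n) big_mkord subn0 /hits.
    apply: leq_sum => l _; rewrite /F; case: (boolP (_ \in _)) => // h.
    by rewrite (hC (2 + l)%N).
  have [wfar|wfar] := boolP (far (Y w)); last first.
    by rewrite /g (negbTE wfar) mul0r addr0 ltNge; move: wfar; rewrite /far => ->;
      case: (_ && _).
  rewrite /g wfar mul1r ltNge [X in ~~ X]wfar/= add0r ler_nat.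
  case: (boolP (_ && _)) => // /andP[h0 h1].
  rewrite (leq_ltn_trans _ h0) ?(leq_ltn_trans _ h1)//.
    by apply: hle => // k _; rewrite inE => /andP[].
  by apply: hle => // k _; rewrite inE => /andP[].
rewrite ge0_integralD//; first last.
- apply/measurable_EFinP/measurable_funM => //; apply: measurable_natr_bool.
  by apply: measurable_and; exact: mhit.
- by move=> w _; rewrite lee_fin mulr_ge0.
- by apply/measurable_EFinP; exact: measurable_natr_bool.
apply: leeD; first exact: close_pair_prob.
rewrite (integral_hits Xind Xlaw pY n j j mA mB AB0 mg g0).
pose G x := binom_tail (ball_prob rho x) n j.
have G0 x : (0 <= G x)%R by apply: binom_tail_ge0; exact: ball_prob01.
have mG : measurable_fun setT G by exact: measurable_binom_ball_prob.
have mGG : measurable_fun setT (fun p : Rd * Rd => (G p.1 * G p.2)%:E).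
  apply/measurable_EFinP/measurable_funM.
    exact: (measurableT_comp mG measurable_fst).
  exact: (measurableT_comp mG measurable_snd).
apply: (@le_trans _ _ (\int[P]_w (G (X 0%N w) * G (X 1%N w))%:E)).
  apply: ge0_le_integral => //.
  - move=> w _; rewrite lee_fin mulr_ge0// trinom_tail_ge0 ?section_prob_ge0//.
    exact: section_prob_sum_le1.
  - apply/measurable_EFinP/measurable_funM => //.
    apply: (measurableT_comp (f := fun y =>
      trinom_tail (section_prob Q A y) (section_prob Q B y) n j j)).
      by apply: measurable_trinom_tail; exact: measurable_section_prob.
    exact: past_measurable pY.
  - exact: (measurableT_comp mGG (past_measurable pY)).
  - move=> w _; rewrite lee_fin.
    have [wfar|wfar] := boolP (far (Y w)); last first.
      by rewrite /g (negbTE wfar) mul0r mulr_ge0.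
    rewrite /g wfar mul1r.
    apply: le_trans (trinom_tail_le _ _ _ _ _ _) _.
    + exact: section_prob_ge0.
    + exact: section_prob_ge0.
    + exact: section_prob_sum_le1.
    rewrite (_ : section_prob Q A (Y w) = ball_prob rho (X 0%N w)).
      rewrite (_ : section_prob Q B (Y w) = ball_prob rho (X 1%N w))//.
      congr (fine (Q _)); apply/seteqP; split=> z; rewrite /xsection/= inE.
        by move=> /andP[].
      by move=> h; apply/andP; split.
    congr (fine (Q _)); apply/seteqP; split=> z; rewrite /xsection/= inE.
      by move=> /andP[].
    by move=> h; apply/andP; split.
have p0 : past X 1 (X 0%N) by exact: past_rv.
rewrite (past_fubini Xind p0 mGG); last by move=> p; rewrite lee_fin mulr_ge0.
pose I := \int[Q]_x (G x)%:E.
have mEG : measurable_fun setT (fun x => (G x)%:E) by exact/measurable_EFinP.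
rewrite (eq_integral (fun w => (G (X 0%N w))%:E * I)); last first.
  move=> w _; rewrite (eq_measure_integral Q) => [|C1 mC _]; last exact: Xlaw.
  rewrite (eq_integral (fun x => (G (X 0%N w))%:E * (G x)%:E)) => [|x _]; last first.
    by rewrite -EFinM.
  by rewrite ge0_integralZl_EFin// => x _; rewrite lee_fin.
rewrite ge0_integralZr//; last 3 first.
- by apply: (measurableT_comp mEG).
- by move=> w _; rewrite lee_fin.
- by apply: integral_ge0 => x _; rewrite lee_fin.
by rewrite (integral_iid 0 iidX).
Qed.

End neighbor_counts.

(** * Exchangeability: reduction to the first one or two indices *)

Definition swapn (a b k : nat) : nat := if k == a then b else if k == b then a else k.

Lemma swapnK a b : involutive (swapn a b).
Proof.
move=> k; rewrite /swapn; have [->|ka] := eqVneq k a.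
  by have [//|_] := eqVneq b a; rewrite eqxx.
have [->|kb] := eqVneq k b; first by rewrite eqxx.
by rewrite (negbTE ka) (negbTE kb).
Qed.

Lemma swapn_ltn a b k n : (a < n)%N -> (b < n)%N -> (k < n)%N -> (swapn a b k < n)%N.
Proof. by rewrite /swapn; case: ifP => // _; case: ifP. Qed.

Lemma swap_pair i k : i != k -> exists s t : nat -> nat,
  [/\ cancel s t, cancel t s, s 0%N = i, s 1%N = k &
    forall n x, (i < n.+2)%N -> (k < n.+2)%N -> (x < n.+2)%N -> (s x < n.+2)%N].
Proof.
(* Swapping 1 with this index first ensures that 1 is sent to [k] after 0 and [i] are exchanged. *)
move=> ik; pose k' := swapn 0 i k.
exists (swapn 0 i \o swapn 1 k'), (swapn 1 k' \o swapn 0 i); split.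
- by move=> x /=; rewrite !swapnK.
- by move=> x /=; rewrite !swapnK.
- rewrite /=; have -> : swapn 1 k' 0 = 0%N.
    rewrite /swapn/=; case: eqP => // k0.
    have : swapn 0 i k = swapn 0 i i by rewrite -/k' -k0 /swapn eqxx; case: eqP.
    by move=> /(can_inj (@swapnK 0 i)) ki; rewrite ki eqxx in ik.
  by rewrite /swapn eqxx.
- by rewrite /= [swapn 1 k' 1]/swapn eqxx /k' swapnK.
- by move=> n x ni nk xn; rewrite /= swapn_ltn// swapn_ltn// swapn_ltn.
Qed.

Section exchangeability.
Local Open Scope ereal_scope.
Context {disp} {Omega : measurableType disp} {R : realType}.
Variable P : probability Omega R.
Context {d : nat}.
Local Notation Rd := (d.-tuple R).
Variables (Q : probability Rd R).
Implicit Types (X : nat -> {RV P >-> Rd}) (rho : R) (s t : nat -> nat).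

Lemma iid_reindex X s t : cancel s t -> cancel t s -> iid Q X -> iid Q (X \o s).
Proof.
move=> stK tsK [Xind Xlaw]; split; last by move=> i; exact: Xlaw.
move=> J A mA; have := Xind (s @` J)%fset (A \o t) (fun i => mA _).
rewrite big_imfset/=; last by move=> x y _ _; exact: can_inj stK _ _.
under [in X in _ = X -> _]eq_bigr do rewrite stK.
move=> <-; congr (P _); apply/seteqP; split=> w h i /=.
  by move=> /imfsetP[k /= kJ ->]; rewrite stK; exact: h.
by move=> iJ; have := h (s i); rewrite /= stK; apply; exact: in_imfset.
Qed.

Lemma neighbors_reindex X s t rho n i w : cancel s t -> cancel t s ->
  (forall k, (k < n)%N -> (s k < n)%N) ->
  neighbors (X \o s) rho n i w = neighbors X rho n (s i) w.
Proof.
move=> stK tsK sn; rewrite /neighbors.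
have sp : perm_eq (map s (iota 0 n)) (iota 0 n).
  have us : uniq (map s (iota 0 n)) by rewrite (map_inj_uniq (can_inj stK)) iota_uniq.
  apply: uniq_perm => //; first exact: iota_uniq.
  have sub : {subset map s (iota 0 n) <= iota 0 n}.
    by move=> k /mapP[l + ->]; rewrite !mem_iota/= !add0n; exact: sn.
  by have [|_ e k] := uniq_min_size us sub; [rewrite size_map|rewrite e].
rewrite -[RHS](perm_big _ sp)/= big_map; apply: eq_bigl => k.
by rewrite (inj_eq (can_inj stK)).
Qed.

Lemma neighbors_prob X rho n i j : iid Q X -> (i < n.+1)%N ->
  \int[P]_w ((neighbors X rho n.+1 i w < j)%N%:R)%:E =
  \int[Q]_x (binom_tail (ball_prob Q rho x) n j)%:E.
Proof.
move=> iidX ni; pose s := swapn 0 i.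
have iidS : iid Q (X \o s) by apply: iid_reindex iidX; exact: swapnK.
rewrite -(neighbors0_prob rho n j iidS); apply: eq_integral => w _.
by rewrite (@neighbors_reindex X s s) ?/s //; [exact: swapnK|exact: swapnK|
  move=> k; exact: swapn_ltn].
Qed.

Lemma neighbors_pair_prob X rho (C : R) n i k j : (0 < rho)%R -> iid Q X ->
  (forall x, Q (eball x (2 * rho)) <= C%:E) -> (i < n.+2)%N -> (k < n.+2)%N -> i != k ->
  \int[P]_w (((neighbors X rho n.+2 i w < j) && (neighbors X rho n.+2 k w < j))%N%:R)%:E
  <= C%:E + (\int[Q]_x (binom_tail (ball_prob Q rho x) n j)%:E) *
    (\int[Q]_x (binom_tail (ball_prob Q rho x) n j)%:E).
Proof.
move=> rho0 iidX QC ni nk ik; have [s [t [stK tsK s0 s1 sn]]] := swap_pair ik.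
have iidS : iid Q (X \o s) by exact: iid_reindex iidX.
apply: le_trans (neighbors01_prob n j rho0 iidS QC).
rewrite le_eqVlt; apply/orP; left; apply/eqP; apply: eq_integral => w _.
by rewrite !(@neighbors_reindex X s t) ?s0 ?s1// => x; exact: sn.
Qed.

End exchangeability.

(** * Second moment of the fraction of points with few neighbors *)

Section sparse_fraction.
Local Open Scope ereal_scope.
Context {disp} {Omega : measurableType disp} {R : realType}.
Variable P : probability Omega R.
Context {d : nat}.
Local Notation Rd := (d.-tuple R).
Variables (Q : probability Rd R) (X : nat -> {RV P >-> Rd}).
Hypothesis iidX : iid Q X.

(** The complement of an exceedance: for distinct points, a term of the statistic is above a level
    exactly when its point is not sparse at the corresponding radius. *)
Definition sparse rho n j i w : R := ((neighbors X rho n i w < j)%N%:R)%R.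

Definition sparse_frac rho n j w : R := (n%:R^-1 * \sum_(i < n) sparse rho n j i w)%R.

Definition mean_tail rho n j : R := fine (\int[Q]_x (binom_tail (ball_prob Q rho x) n j)%:E).

Lemma sparse_ge0 rho n j i w : (0 <= sparse rho n j i w)%R. Proof. exact: ler0n. Qed.

Lemma measurable_sparse rho n j i : measurable_fun setT (sparse rho n j i).
Proof.
apply: measurable_natr_bool; apply: measurable_fun_ltn => //.
exact: measurable_neighbors.
Qed.

Lemma measurable_sparse_frac rho n j : measurable_fun setT (sparse_frac rho n j).
Proof. by apply: measurable_funM => //; apply: measurable_sum => i; exact: measurable_sparse. Qed.

Lemma sparse_frac_ge0 rho n j w : (0 <= sparse_frac rho n j w)%R.
Proof. by rewrite mulr_ge0 ?invr_ge0// sumr_ge0// => i _; exact: sparse_ge0. Qed.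

Lemma mean_tailE rho n j :
  \int[Q]_x (binom_tail (ball_prob Q rho x) n j)%:E = (mean_tail rho n j)%:E.
Proof.
have G0 x : (0 <= binom_tail (ball_prob Q rho x) n j)%R.
  by apply: binom_tail_ge0; exact: ball_prob01.
rewrite fineK// ge0_fin_numE; last by apply: integral_ge0 => x _; rewrite lee_fin.
apply: (@le_lt_trans _ _ (\int[Q]_x (cst 1%:E x))); last first.
  by rewrite integral_cst//= probability_setT mule1 ltry.
apply: ge0_le_integral => //.
- by move=> x _; rewrite lee_fin.
- by apply/measurable_EFinP; exact: measurable_binom_ball_prob.
- by move=> x _; rewrite lee_fin; apply: binom_tail_le1; exact: ball_prob01.
Qed.

Lemma mean_tail_ge0 rho n j : (0 <= mean_tail rho n j)%R.
Proof.
apply: fine_ge0; apply: integral_ge0 => x _; rewrite lee_fin.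
by apply: binom_tail_ge0; exact: ball_prob01.
Qed.

Lemma integral_sparse_frac rho n j :
  \int[P]_w (sparse_frac rho n.+1 j w)%:E = (mean_tail rho n j)%:E.
Proof.
under eq_integral do rewrite /sparse_frac EFinM -sumEFin.
rewrite ge0_integralZl_EFin//; last 2 first.
- by move=> w _; rewrite sume_ge0// => i _; rewrite lee_fin sparse_ge0.
- by apply: emeasurable_sum => i; apply/measurable_EFinP; exact: measurable_sparse.
rewrite ge0_integral_sum//; last 2 first.
- by move=> i; apply/measurable_EFinP; exact: measurable_sparse.
- by move=> i w _; rewrite lee_fin sparse_ge0.
under eq_bigr => i _ do rewrite (neighbors_prob rho j iidX (ltn_ord i)) mean_tailE.
rewrite sumEFin -EFinM; congr EFin.
by rewrite sumr_const card_ord -(mulr_natl (mean_tail _ _ _)) mulrA mulVf ?mul1r.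
Qed.

(** The diagonal terms account for the reciprocal of the sample size; each pair of distinct indices
    contributes at most [C] plus the square of the mean tail. *)
Lemma integral_sparse_frac_sqr rho (C : R) n j : (0 < rho)%R -> (0 <= C)%R ->
  (forall x, Q (eball x (2 * rho)) <= C%:E) ->
  \int[P]_w (sparse_frac rho n.+2 j w ^+ 2)%:E <=
  (n.+2%:R^-1 + C + mean_tail rho n j ^+ 2)%:E.
Proof.
move=> rho0 C0 QC; set N := n.+2; set b := mean_tail rho n j.
pose s i w := sparse rho N j i w.
have sqE w : (sparse_frac rho N j w ^+ 2 =
    N%:R ^- 2 * \sum_(i < N) \sum_(k < N) s i w * s k w)%R.
  rewrite /sparse_frac exprMn exprVn; congr (_ * _)%R.
  by rewrite expr2 mulr_suml; apply: eq_bigr => i _; rewrite mulr_sumr.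
have msR (i k : 'I_N) : measurable_fun setT (fun w => s i w * s k w)%R.
  by apply: measurable_funM; exact: measurable_sparse.
have ms (i k : 'I_N) : measurable_fun setT (fun w => (s i w * s k w)%:E).
  exact/measurable_EFinP.
have s0 (i k : 'I_N) w : 0 <= (s i w * s k w)%:E.
  by rewrite lee_fin mulr_ge0// sparse_ge0.
have sik (i k : 'I_N) : \int[P]_w (s i w * s k w)%:E <= ((i == k)%:R + (C + b ^+ 2))%:E.
  have [->|ik] := eqVneq i k.
    apply: (@le_trans _ _ (\int[P]_w (cst 1%:E w))); last first.
      by rewrite integral_cst//= probability_setT mule1 lee_fin lerDl addr_ge0// sqr_ge0.
    apply: ge0_le_integral => // w _; rewrite lee_fin /s /sparse.
    by case: (_ < _)%N; rewrite ?mulr1 ?mulr0.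
  rewrite add0r expr2 EFinD EFinM -!mean_tailE.
  apply: le_trans (neighbors_pair_prob j rho0 iidX QC (ltn_ord i) (ltn_ord k) _) => //.
  rewrite le_eqVlt; apply/orP; left; apply/eqP; apply: eq_integral => w _.
  by rewrite /s /sparse -natrM mulnb.
under eq_integral do rewrite sqE EFinM.
rewrite ge0_integralZl_EFin//; last 2 first.
- by move=> w _; rewrite lee_fin sumr_ge0// => i _; rewrite sumr_ge0// => k _; rewrite -lee_fin.
- apply/measurable_EFinP; apply: measurable_sum => i; apply: measurable_sum => k.
  exact: msR.
under eq_integral do rewrite -sumEFin; rewrite ge0_integral_sum//; last 2 first.
- move=> i; apply/measurable_EFinP; apply: measurable_sum => k; exact: msR.
- by move=> i w _; rewrite lee_fin sumr_ge0// => k _; rewrite -lee_fin.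
have sumle : \sum_(i < N) \int[P]_w (\sum_(k < N) s i w * s k w)%:E <=
    (N%:R + N%:R ^+ 2 * (C + b ^+ 2))%:E.
  apply: (@le_trans _ _ (\sum_(i < N) (1 + N%:R * (C + b ^+ 2))%:E)); last first.
    rewrite sumEFin lee_fin sumr_const card_ord -(mulr_natl (1 + _)%R).
    by rewrite mulrDr mulr1 mulrA expr2.
  apply: lee_sum => i _; under eq_integral do rewrite -sumEFin.
  rewrite ge0_integral_sum//.
  apply: (@le_trans _ _ (\sum_(k < N) ((i == k)%:R + (C + b ^+ 2))%:E)).
    by apply: lee_sum => k _; exact: sik.
  rewrite sumEFin lee_fin big_split/= sumr_const card_ord -(mulr_natl (C + _)%R) lerD2r.
  rewrite (bigD1 i)//= eqxx big1 ?addr0// => k.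
  by rewrite eq_sym => /negbTE ->.
apply: (@le_trans _ _ ((N%:R ^- 2)%:E * (N%:R + N%:R ^+ 2 * (C + b ^+ 2))%:E)).
  by apply: lee_wpmul2l; [rewrite lee_fin invr_ge0 exprn_ge0|exact: sumle].
rewrite -EFinM lee_fin le_eqVlt; apply/orP; left; apply/eqP.
have N0 : (N%:R != 0 :> R)%R by rewrite pnatr_eq0.
by field.
Qed.

(** A Chebyshev bound around the level [u], from |x| <= e + x^2 / e. Among [n + 2] points, a single
    point has [n + 1] others and a pair has [n] others, whence the two different means. *)
Lemma sparse_frac_deviation rho (C u e : R) n j : (0 < rho)%R -> (0 <= C)%R ->
  (forall x, Q (eball x (2 * rho)) <= C%:E) -> (0 <= u)%R -> (0 < e)%R ->
  \int[P]_w (`|sparse_frac rho n.+2 j w - u|)%:E <=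
  (e + (n.+2%:R^-1 + C + mean_tail rho n j ^+ 2 + u ^+ 2
    - 2 * u * mean_tail rho n.+1 j) / e)%:E.
Proof.
move=> rho0 C0 QC u0 e0; pose U w := sparse_frac rho n.+2 j w.
have mU : measurable_fun setT U by exact: measurable_sparse_frac.
have U0 w : (0 <= U w)%R by exact: sparse_frac_ge0.
have mU2 : measurable_fun setT (fun w => (U w - u) ^+ 2)%R.
  by apply: measurable_funX; apply: measurable_funB.
set V := (n.+2%:R^-1 + C + mean_tail rho n j ^+ 2 + u ^+ 2
    - 2 * u * mean_tail rho n.+1 j)%R.
have VE : \int[P]_w ((U w - u) ^+ 2)%:E <= V%:E.
  have uu : 0 <= (2 * u)%R%:E by rewrite lee_fin mulr_ge0.
  (* The cross term is moved to the left so that only nonnegative functions are integrated. *)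
  rewrite -(@leeD2rE _ (2 * u * mean_tail rho n.+1 j)%:E)// EFinM -integral_sparse_frac.
  rewrite -ge0_integralZl//; last 2 first.
  - by apply/measurable_EFinP.
  - by move=> w _; rewrite lee_fin.
  rewrite -ge0_integralD//; last 4 first.
  - by move=> w _; rewrite lee_fin sqr_ge0.
  - by apply/measurable_EFinP.
  - by move=> w _; apply: mule_ge0 => //; rewrite lee_fin; exact: U0.
  - by apply: emeasurable_funM => //; apply/measurable_EFinP; exact: mU.
  rewrite (eq_integral (fun w => (U w ^+ 2)%:E + cst (u ^+ 2)%:E w)); last first.
    by move=> w _; rewrite -EFinM -!EFinD; congr EFin; rewrite /U; ring.
  rewrite ge0_integralD//; last 3 first.
  - by move=> w _; rewrite lee_fin sqr_ge0.
  - by apply/measurable_EFinP; exact: measurable_funX.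
  - by move=> w _; rewrite lee_fin sqr_ge0.
  rewrite integral_cst//= probability_setT mule1.
  rewrite ge0_integralZl//; last 2 first.
  - by apply/measurable_EFinP.
  - by move=> w _; rewrite lee_fin.
  rewrite integral_sparse_frac -EFinM -EFinD /V subrK EFinD.
  by apply: leeD => //; exact: integral_sparse_frac_sqr.
apply: (@le_trans _ _ (\int[P]_w (cst e%:E w + e^-1%:E * ((U w - u) ^+ 2)%:E))).
  apply: ge0_le_integral => //.
  - apply/measurable_EFinP; apply: measurableT_comp => //.
    exact: measurable_funB.
  - apply: emeasurable_funD => //; apply: emeasurable_funM => //.
    exact/measurable_EFinP.
  move=> w _; rewrite -EFinM -EFinD lee_fin -/(U w).
  rewrite -(real_normK (num_real (U w - u)%R)); move: (normr_ge0 (U w - u)%R).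
  move: (`|(U w - u)%R|%R) => x x0; have [xe|ex] := leP x e.
    by rewrite (le_trans xe)// lerDl mulr_ge0 ?invr_ge0 ?sqr_ge0// ltW.
  rewrite (@le_trans _ _ (e^-1 * x ^+ 2)%R)//; last by rewrite lerDr ltW.
  by rewrite mulrC ler_pdivlMr// expr2 ler_wpM2l// ltW.
rewrite ge0_integralD//; last 3 first.
- by move=> w _; rewrite lee_fin ltW.
- by move=> w _; rewrite -EFinM lee_fin mulr_ge0 ?invr_ge0 ?sqr_ge0// ltW.
- by apply: emeasurable_funM => //; exact/measurable_EFinP.
rewrite integral_cst//= probability_setT mule1 EFinD leeD2l//.
rewrite ge0_integralZl//; last 3 first.
- exact/measurable_EFinP.
- by move=> w _; rewrite lee_fin sqr_ge0.
- by rewrite lee_fin invr_ge0 ltW.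
rewrite mulrC EFinM; apply: lee_wpmul2l => //.
by rewrite lee_fin invr_ge0 ltW.
Qed.

End sparse_fraction.

(** * Poisson limit of the mean and convergence of the fraction *)

Lemma near_div_nat_le (R : realType) (a e : R) : 0 < e ->
  \forall n \near \oo, a / n%:R <= e.
Proof.
move=> e0; near=> n.
rewrite ler_pdivrMr; last by rewrite ltr0n; near: n; exact: nbhs_infty_gt.
rewrite -ler_pdivrMl//.
by near: n; exact: nbhs_infty_ger.
Unshelve. all: by end_near. Qed.

Section mean_tail_cvg.
Context {disp} {Omega : measurableType disp} {R : realType}.
Variable P : probability Omega R.
Context {d : nat}.
Hypothesis d_gt0 : (0 < d)%N.
Local Notation Rd := (d.-tuple R).
Local Notation lam := (@lebesgue_Rd R d).
Local Notation v := (@unit_ball_volume R d).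
Variables (Q : probability Rd R) (f : Rd -> R) (M : R) (X : nat -> {RV P >-> Rd}).
Hypotheses (mf : measurable_fun setT f) (f0 : forall y, 0 <= f y).
Hypotheses (fi : (\int[lam]_y (f y)%:E = 1)%E) (fM : forall y, f y <= M).
Hypothesis Qf : forall A, measurable A -> Q A = (\int[lam]_(y in A) (f y)%:E)%E.
Hypothesis iidX : iid Q X.

Let M0 : 0 <= M. Proof. exact: le_trans (f0 (@origin R d)) (fM _). Qed.
Let v0 : 0 < v. Proof. exact: unit_ball_volume_gt0. Qed.

Lemma integrable_density : lam.-integrable setT (EFin \o f).
Proof.
apply/integrableP; split; first exact/measurable_EFinP.
by under eq_integral do rewrite /= ger0_norm//; rewrite fi ltry.
Qed.

Lemma ball_prob_int rho x : ball_prob Q rho x = ball_int rho f x.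
Proof. by rewrite /ball_prob /ball_int /Rintegral Qf//; exact: measurable_eball. Qed.

Lemma prob_eball_le rho x : 0 < rho -> (Q (eball x rho) <= (M * v * rho ^+ d)%:E)%E.
Proof.
move=> rho0; have mB := measurable_eball x rho.
have := integral_density_le mf f0 Qf (measurable_indic mB) (fun=> ler0n _ _) fM.
by rewrite !integral_indic// !setIT/= eball_volume// -EFinM mulrA.
Qed.

Lemma measurable_poisson_tail dd (U : measurableType dd) j (l : U -> R) :
  measurable_fun setT l -> measurable_fun setT (fun u => poisson_tail j (l u)).
Proof.
move=> ml; apply: measurable_sum => i; apply: measurable_funM => //.
apply: measurable_funM; last exact: measurable_funX.
by apply: (measurableT_comp (@measurable_expR R)); exact: measurable_funN.
Qed.

(** A ball of this radius has volume v r^d / n, so the mean number of neighbors stays bounded. *)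
Definition scaled_radius (r : R) (n : nat) : R := r / n%:R `^ d%:R^-1.

Lemma scaled_radius_gt0 r n : 0 < r -> (0 < n)%N -> 0 < scaled_radius r n.
Proof. by move=> r0 n0; rewrite divr_gt0// powR_gt0// ltr0n. Qed.

Lemma scaled_radiusX r n : scaled_radius r n ^+ d = r ^+ d / n%:R.
Proof.
rewrite expr_div_n; congr (_ / _); rewrite -powR_mulrn ?powR_ge0//.
by rewrite -powRrM mulVf ?powRr1// pnatr_eq0 -lt0n.
Qed.

Definition poisson_mean j (r : R) : R :=
  fine (\int[Q]_x (poisson_tail j (v * r ^+ d * f x))%:E)%E.

Lemma bounded_integral_dist (G H : Rd -> R) (e : R) :
  measurable_fun setT G -> measurable_fun setT H ->
  (forall x, 0 <= G x <= 1) -> (forall x, 0 <= H x <= 1) ->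
  (\int[Q]_x (`|G x - H x|)%:E <= e%:E)%E ->
  `|fine (\int[Q]_x (G x)%:E)%E - fine (\int[Q]_x (H x)%:E)%E| <= e.
Proof.
move=> mG mH G01 H01 GHe.
have mE (F : Rd -> R) : measurable_fun setT F -> measurable_fun setT (fun x => (F x)%:E).
  by move=> mF; exact/measurable_EFinP.
have F0 (F : Rd -> R) : (forall x, 0 <= F x <= 1) -> forall x, (0 <= (F x)%:E)%E.
  by move=> F01 x; rewrite lee_fin; have /andP[] := F01 x.
have fin (F : Rd -> R) : measurable_fun setT F -> (forall x, 0 <= F x <= 1) ->
    (\int[Q]_x (F x)%:E)%E \is a fin_num.
  move=> mF F01; rewrite ge0_fin_numE; last by apply: integral_ge0 => x _; exact: F0.
  apply: (@le_lt_trans _ _ (\int[Q]_x (cst 1%:E x)))%E; last first.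
    by rewrite integral_cst//= probability_setT mule1 ltry.
  apply: ge0_le_integral => //.
  - by move=> x _; exact: F0.
  - exact: mE.
  - by move=> x _; rewrite lee_fin; have /andP[] := F01 x.
have half (F K : Rd -> R) : measurable_fun setT F -> measurable_fun setT K ->
    (forall x, 0 <= F x <= 1) -> (forall x, 0 <= K x <= 1) ->
    (\int[Q]_x (`|F x - K x|)%:E <= e%:E)%E ->
    fine (\int[Q]_x (F x)%:E)%E - fine (\int[Q]_x (K x)%:E)%E <= e.
  move=> mF mK F01 K01 FKe.
  have mFK : measurable_fun setT (fun x => `|F x - K x|).
    by apply: measurableT_comp => //; exact: measurable_funB.
  rewrite lerBlDl -lee_fin EFinD !fineK ?fin//.
  apply: le_trans (leeD2l _ FKe); rewrite -ge0_integralD//; last 3 first.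
  - by move=> x _; exact: F0.
  - exact: mE.
  - exact: mE.
  apply: ge0_le_integral => //.
  - by move=> x _; exact: F0.
  - exact: mE.
  - by apply: emeasurable_funD; exact: mE.
  - by move=> x _; rewrite -EFinD lee_fin -lerBlDl ler_norm.
rewrite ler_norml lerNl opprB !half//.
by under eq_integral do rewrite distrC.
Qed.

(** Three errors add up, with [c / n] bounding the probability of a ball: the Poisson approximation
    costs [2 * c ^+ 2 / n], passing from [m] to [n] trials costs [2 * c / n], and replacing [n]
    times the ball probability by its limit costs at most [M * n] times [ball_err]. *)
Lemma mean_tail_dist r n m j eta : 0 < r -> (0 < n)%N -> (m <= n)%N -> (n <= m.+2)%N ->
  let rho := scaled_radius r n in let c := M * v * r ^+ d in
  (ball_err rho f <= (eta * rho ^+ d)%:E)%E ->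
  `|mean_tail Q rho m j - poisson_mean j r| <= (2 * c ^+ 2 + 2 * c) / n%:R + M * r ^+ d * eta.
Proof.
move=> r0 n0 mn nm rho c err.
have n0R : 0 < n%:R :> R by rewrite ltr0n.
have rho0 : 0 < rho by exact: scaled_radius_gt0.
have v00 := ltW v0; have r00 := ltW r0.
have c0 : 0 <= c by rewrite mulr_ge0 ?exprn_ge0// mulr_ge0.
have vr0 : 0 <= v * r ^+ d by rewrite mulr_ge0 ?exprn_ge0.
have rhod : rho ^+ d = r ^+ d / n%:R by exact: scaled_radiusX.
pose p := ball_prob Q rho; pose l x := v * r ^+ d * f x.
have l0 x : 0 <= l x by rewrite mulr_ge0.
have p01 x : 0 <= p x <= 1 by exact: ball_prob01.
have pc x : p x <= c / n%:R.
  rewrite -lee_fin fineK; last by rewrite fin_num_measure//; exact: measurable_eball.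
  by apply: le_trans (prob_eball_le _ rho0) _; rewrite lee_fin rhod mulrA.
have mG : measurable_fun setT (fun x => binom_tail (p x) m j).
  exact: measurable_binom_ball_prob.
have mp : measurable_fun setT p by exact: measurable_ball_prob.
have ml : measurable_fun setT l by exact: measurable_funM.
have mH : measurable_fun setT (fun x => poisson_tail j (l x)) by exact: measurable_poisson_tail.
apply: bounded_integral_dist => //.
- by move=> x; rewrite binom_tail_ge0// binom_tail_le1.
- move=> x; apply/andP; split; first exact: poisson_tail_ge0 (l0 x).
  exact: poisson_tail_le1 (l0 x).
have mnpl : measurable_fun setT (fun x => `|n%:R * p x - l x|).
  apply: measurableT_comp => //; apply: measurable_funB => //.
  exact: measurable_funM.
apply: (@le_trans _ _ (\int[Q]_x (cst ((2 * c ^+ 2 + 2 * c) / n%:R)%:E x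
    + (`|n%:R * p x - l x|)%:E))%E).
  apply: ge0_le_integral => //.
  - by apply/measurable_EFinP; apply: measurableT_comp => //; exact: measurable_funB.
  - by apply: emeasurable_funD => //; exact/measurable_EFinP.
  move=> x _; rewrite -EFinD lee_fin.
  have /andP[p0 p1] := p01 x.
  have h1 := binom_poisson_tail m j (p01 x).
  have mp0 : 0 <= m%:R * p x by rewrite mulr_ge0.
  have h2 := poisson_tail_lip j mp0 (l0 x).
  have h3 : `|m%:R * p x - l x| <= 2 * p x + `|n%:R * p x - l x|.
    rewrite (_ : m%:R * p x - l x = - ((n - m)%:R * p x) + (n%:R * p x - l x)).
      rewrite (le_trans (ler_normD _ _))// lerD2r normrN ger0_norm ?mulr_ge0//.
      by rewrite ler_wpM2r// ler_nat leq_subLR addn2.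
    by rewrite natrB//; ring.
  have h4 : 2 * m%:R * p x ^+ 2 <= 2 * c ^+ 2 / n%:R.
    move: (pc x) c0 p0; clearbody c; move: (p x) => y yc c0' y0.
    rewrite -(mulrA 2) -(mulrA 2 _ n%:R^-1) ler_wpM2l//.
    rewrite (@le_trans _ _ (n%:R * (c / n%:R) ^+ 2))//.
      rewrite ler_pM ?sqr_ge0 ?ler_nat//.
      by rewrite lerXn2r ?nnegrE// divr_ge0// ltW.
    rewrite le_eqVlt; apply/orP; left; apply/eqP; field.
    by rewrite gt_eqF.
  have h5 : 2 * p x <= 2 * c / n%:R by rewrite -(mulrA 2) ler_wpM2l.
  rewrite (le_trans (ler_distD (poisson_tail j (m%:R * p x)) _ _))//.
  rewrite [X in _ <= X + _](_ : _ = 2 * c ^+ 2 / n%:R + 2 * c / n%:R); last first.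
    by rewrite mulrDl.
  by lra.
rewrite ge0_integralD//; last 2 first.
- by move=> x _; rewrite lee_fin divr_ge0// addr_ge0// mulr_ge0// sqr_ge0.
- exact/measurable_EFinP.
rewrite integral_cst//= probability_setT mule1 EFinD leeD2l//.
apply: le_trans (integral_density_le mf f0 Qf mnpl (fun=> normr_ge0 _) fM) _.
rewrite (eq_integral (fun x => n%:R%:E * (`|ball_int rho f x - v * rho ^+ d * f x|)%:E)%E).
  rewrite ge0_integralZl//; last exact: measurable_ball_err.
  apply: (@le_trans _ _ (M%:E * (n%:R%:E * (eta * rho ^+ d)%:E))%E).
    by do 2 (apply: lee_wpmul2l; first by rewrite lee_fin).
  rewrite -!EFinM lee_fin rhod le_eqVlt; apply/orP; left; apply/eqP; field.
  by rewrite gt_eqF.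
move=> x _; rewrite -EFinM; congr EFin.
rewrite -[X in _ = X * _](ger0_norm (ltW n0R)) -normrM; congr `|_|.
rewrite /p ball_prob_int /l rhod mulrBr; congr (_ - _); field.
by rewrite gt_eqF.
Qed.

(** Uniformity in [m] is wanted because the first moment involves [n - 1] trials and the second
    [n - 2]. *)
Lemma mean_tail_cvg r j e : 0 < r -> 0 < e ->
  \forall n \near \oo, forall m, (m <= n)%N -> (n <= m.+2)%N ->
  `|mean_tail Q (scaled_radius r n) m j - poisson_mean j r| <= e.
Proof.
move=> r0 e0; pose c := M * v * r ^+ d; pose K := M * r ^+ d.
have v00 := ltW v0; have r00 := ltW r0.
have c0 : 0 <= c by rewrite mulr_ge0 ?exprn_ge0// mulr_ge0.
have K0 : 0 <= K by rewrite mulr_ge0 ?exprn_ge0.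
(* Chosen so that [K * eta] is at most [e / 2]; the [+ 1] keeps the denominator positive. *)
pose eta := e / (2 * (K + 1)).
have eta0 : 0 < eta by rewrite divr_gt0// mulr_gt0// ltr_wpDl.
have Keta : K * eta <= e / 2.
  rewrite /eta mulrA ler_pdivrMr ?mulr_gt0// ?ltr_wpDl//.
  rewrite (_ : e / 2 * _ = e * (K + 1)); last by field.
  by rewrite mulrC ler_wpM2l ?(ltW e0)// lerDl.
have := ball_regular_integrable integrable_density eta0.
move=> [del /= del0 Hdel].
have n1 : \forall n \near \oo, (2 * c ^+ 2 + 2 * c) / n%:R <= e / 2 :> R.
  by apply: near_div_nat_le; rewrite divr_gt0.
have n2 : \forall n \near \oo, scaled_radius r n < del.
  near=> n; have n0 : (0 < n)%N by near: n; exact: nbhs_infty_gt.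
  have rho0 := scaled_radius_gt0 r0 n0.
  rewrite -(@ltr_pXn2r _ d)// ?nnegrE ?ltW// scaled_radiusX.
  apply: (@le_lt_trans _ _ (del ^+ d / 2)).
    by near: n; apply: near_div_nat_le; rewrite divr_gt0// exprn_gt0.
  by rewrite ltr_pdivrMr// ltr_pMr ?exprn_gt0// ltr1n.
near=> n => m mn nm.
have n0 : (0 < n)%N by near: n; exact: nbhs_infty_gt.
have rho0 : 0 < scaled_radius r n by exact: scaled_radius_gt0.
have err : (ball_err (scaled_radius r n) f <= (eta * scaled_radius r n ^+ d)%:E)%E.
  apply: Hdel => //=; rewrite sub0r normrN gtr0_norm//.
  by near: n.
apply: le_trans (mean_tail_dist j r0 n0 mn nm err) _.
rewrite [leRHS]splitr lerD//.
by near: n.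
Unshelve. all: by end_near. Qed.

Lemma poisson_mean01 j (r : R) : 0 < r -> 0 <= poisson_mean j r <= 1.
Proof.
move=> r0.
have l0 x : 0 <= v * r ^+ d * f x.
  by rewrite mulr_ge0// mulr_ge0 ?exprn_ge0 ?(ltW v0) ?(ltW r0).
have ml : measurable_fun setT (fun x => v * r ^+ d * f x) by exact: measurable_funM.
have mp : measurable_fun setT (fun x => (poisson_tail j (v * r ^+ d * f x))%:E).
  by apply/measurable_EFinP; exact: measurable_poisson_tail.
have le1 : (\int[Q]_x (poisson_tail j (v * r ^+ d * f x))%:E <= 1)%E.
  apply: (@le_trans _ _ (\int[Q]_x (cst 1%:E x)))%E; last first.
    by rewrite integral_cst//= probability_setT mule1.
  apply: ge0_le_integral => //.
  - by move=> x _; rewrite lee_fin poisson_tail_ge0.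
  - by move=> x _; rewrite lee_fin poisson_tail_le1.
have ge0 : (0 <= \int[Q]_x (poisson_tail j (v * r ^+ d * f x))%:E)%E.
  by apply: integral_ge0 => x _; rewrite lee_fin poisson_tail_ge0.
rewrite /poisson_mean fine_ge0//= -lee_fin fineK// ge0_fin_numE//.
by rewrite (le_lt_trans le1)// ltry.
Qed.

Lemma sparse_frac_cvg (r : R) j (e : R) : 0 < r -> 0 < e ->
  \forall n \near \oo,
  (\int[P]_w (`|sparse_frac X (scaled_radius r n) n j w - poisson_mean j r|)%:E <= e%:E)%E.
Proof.
move=> r0 e0; set u := poisson_mean j r.
have /andP[u0 u1] : 0 <= u <= 1 by exact: poisson_mean01.
(* The second moment around [u] has to be at most [e1 ^+ 2]. The terms of order 1/n use half of
   this, and replacing both means by [u] costs at most [5 * del], where [del <= 1] gives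
   [del ^+ 2 <= del]; hence the 16. *)
pose e1 := e / 2; pose del := Num.min 1 (e1 ^+ 2 / 16).
have e10 : 0 < e1 by rewrite divr_gt0.
have del0 : 0 < del by rewrite lt_min ltr01 divr_gt0// exprn_gt0.
pose K := M * v * (2 * r) ^+ d.
have H1 : \forall n \near \oo, (1 + K) / n%:R <= e1 ^+ 2 / 2 :> R.
  by apply: near_div_nat_le; rewrite divr_gt0// exprn_gt0.
have H2 := mean_tail_cvg j r0 del0.
near=> n.
have n2 : (1 < n)%N by near: n; exact: nbhs_infty_gt.
have n0 : (0 < n)%N by exact: ltn_trans n2.
have K0 : 0 <= K.
  rewrite mulr_ge0 ?exprn_ge0//; first by rewrite mulr_ge0// ltW.
  by rewrite mulr_ge0// ltW.
set rho := scaled_radius r n.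
have rho0 : 0 < rho by exact: scaled_radius_gt0.
have C0 : 0 <= K / n%:R by rewrite divr_ge0.
have QC x : (Q (eball x (2 * rho)) <= (K / n%:R)%:E)%E.
  have r20 : 0 < 2 * rho by rewrite mulr_gt0.
  apply: le_trans (prob_eball_le x r20) _.
  rewrite lee_fin exprMn scaled_radiusX /K exprMn le_eqVlt; apply/orP; left.
  by apply/eqP; ring.
have Hn : (1 + K) / n%:R <= e1 ^+ 2 / 2 by near: n.
have Hm : forall m, (m <= n)%N -> (n <= m.+2)%N ->
  `|mean_tail Q rho m j - u| <= del by rewrite /rho /u; near: n.
move: n2 Hn Hm rho0 C0 QC; clear -e10 u0 u1 iidX K0 del0.
rewrite /rho {rho}; case: n => [|[|n]]// _ Hn Hm rho0 C0 QC.
have dev := sparse_frac_deviation iidX n j rho0 C0 QC u0 e10; apply: (le_trans dev).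
have b_near := Hm n (leq_trans (leqnSn _) (leqnSn _)) (leqnn _).
have a_near := Hm n.+1 (leqnSn _) (leqnSn _).
rewrite lee_fin [leRHS]splitr lerD2l ler_pdivrMr//.
have b0 := mean_tail_ge0 Q (scaled_radius r n.+2) n j.
have [d1 d2] : del <= 1 /\ del <= e1 ^+ 2 / 16.
  by have := lexx del; rewrite {2}/del le_min => /andP.
move: b_near a_near b0.
move: (mean_tail _ _ n _) (mean_tail _ _ n.+1 _) => b a.
rewrite !ler_norml => /andP[b1 b2] /andP[a1 a2] b0.
rewrite mulrDl mul1r in Hn.
move: Hn; move: (K / n.+2%:R) => C Hn {dev Hm}.
clearbody u del.
have h1 : b ^+ 2 <= u ^+ 2 + 2 * u * del + del ^+ 2.
  rewrite (_ : u ^+ 2 + _ + _ = (u + del) ^+ 2); last by ring.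
  by rewrite lerXn2r ?nnegrE//; lra.
have h2 : u * (u - a) <= u * del by rewrite ler_wpM2l//; lra.
have h3 : u * del <= del by rewrite ler_piMl// ltW.
have h4 : del ^+ 2 <= del by rewrite expr2 ler_piMl// ltW.
have h5 : e / 2 * e1 = e1 ^+ 2 by rewrite expr2.
rewrite h5 {h5} (_ : _ - _ = n.+2%:R^-1 + C + (b ^+ 2 - (u ^+ 2 + 2 * u * del + del ^+ 2))
  + 2 * (u * (u - a)) + 2 * (u * del) + del ^+ 2); last by ring.
have h6 : b ^+ 2 - (u ^+ 2 + 2 * u * del + del ^+ 2) <= 0 by rewrite subr_le0.
have h7 : 0 <= e1 ^+ 2 by exact: sqr_ge0.
have gen (x1 x2 x3 x4 x5 x6 C' d' : R) : 0 <= x2 -> x1 + C' <= x2 / 2 ->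
    d' <= x2 / 16 -> x4 <= x5 -> x5 <= d' -> x6 <= d' -> x3 <= 0 ->
    x1 + C' + x3 + 2 * x4 + 2 * x5 + x6 <= x2 by lra.
exact: gen h7 Hn d2 h2 h3 h4 h6.
Unshelve. all: by end_near. Qed.

End mean_tail_cvg.

(** * Nearest neighbor distances *)

Section sorted_count.
Context {R : realType}.

Lemma nth_sorted_lt (s : seq R) rho i : sorted <=%R s -> (i < size s)%N ->
  (nth 0 s i < rho) = (i < count (fun x => x < rho)%R s)%N.
Proof.
elim: s i => [|x s ih] i //= xs.
have /allP xle := order_path_min le_trans xs.
have ss := path_sorted xs.
have [xr|rx] := ltP x rho.
  by case: i => [|i] /= si; rewrite ?xr// add1n ltnS; exact: ih.
have -> : count (fun x => x < rho)%R s = 0%N.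
  apply/eqP; rewrite -leqn0 leqNgt -has_count; apply/hasP => -[y ys].
  by rewrite ltNge (le_trans rx (xle _ ys)).
case: i => [|i] /= si; first by rewrite ltNge rx.
by rewrite addn0 ltn0 ltNge (le_trans rx)// xle// mem_nth.
Qed.

Lemma nth_sort_lt (s : seq R) rho i : (i < size s)%N ->
  (nth 0 (sort <=%R s) i < rho) = (i < count (fun x => x < rho)%R s)%N.
Proof.
move=> si; rewrite nth_sorted_lt ?size_sort ?sort_le_sorted//.
by congr (_ < _)%N; apply/permP; rewrite perm_sort.
Qed.

End sorted_count.

Section nearest_neighbor_counts.
Context {R : realType} {d : nat}.
Local Notation Rd := (d.-tuple R).
Implicit Types (x : Rd) (A : {fset Rd}).

Lemma nn_dist_lt j x A rho : (0 < j)%N -> (j < #|` A|)%N -> x \in A ->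
  (nn_dist j x A < rho) =
  (j <= count (fun y => euclidean_dist x y < rho)%R (A `\ x)%fset)%N.
Proof.
move=> j0 jA xA; rewrite /nn_dist jA nth_sort_lt.
  by rewrite prednK// count_map.
rewrite size_map prednK//.
by move: jA; rewrite (cardfsD1 x) xA add1n ltnS.
Qed.

(** The list contains only distances to points other than [x]. Positivity keeps the convention for
    negative powers of 0 out of the later inversion. *)
Lemma nn_dist_gt0 j x A : (0 < j)%N -> (j < #|` A|)%N -> x \in A -> 0 < nn_dist j x A.
Proof.
move=> j0 jA xA; rewrite /nn_dist jA.
set s := [seq _ | y <- _].
have : all (fun r => 0 < r) (sort <=%R s).
  rewrite all_sort; apply/allP => _ /mapP[y + ->].
  rewrite !inE => /andP[yx _].
  by rewrite lt_neqAle euclidean_dist_ge0 andbT eq_sym euclidean_dist_eq0 eq_sym.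
move=> /all_nthP; apply; rewrite size_sort size_map prednK//.
by move: jA; rewrite (cardfsD1 x) xA add1n ltnS.
Qed.

Lemma nn_dist_small j x A : ~~ (j < #|` A|)%N -> nn_dist j x A = 0.
Proof. by rewrite /nn_dist => /negbTE ->. Qed.

End nearest_neighbor_counts.

Section sample_measurability.
Context {disp} {Omega : measurableType disp} {R : realType}.
Context {P : probability Omega R} {d : nat}.
Local Notation Rd := (d.-tuple R).
Variable X : nat -> {RV P >-> Rd}.

Let pts (l : seq nat) w : seq Rd := [seq X k w | k <- l].

Let mX k : measurable_fun setT (X k : Omega -> Rd).
Proof. exact: measurable_funP. Qed.

Lemma measurable_eq_rv i k : measurable_fun setT (fun w => X i w == X k w).
Proof.
under eq_fun do rewrite -euclidean_dist_eq0.
by apply: measurable_fun_eqr => //; exact: measurable_euclidean_dist.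
Qed.

Lemma measurable_mem_pts k l : measurable_fun setT (fun w => X k w \in pts l w).
Proof.
rewrite /pts; elim: l => [|i l ih] /=; first exact: measurable_cst.
under eq_fun do rewrite in_cons.
by apply: measurable_or => //; exact: measurable_eq_rv.
Qed.

(** Ties make the cardinal of the sample random. Removing duplicates along the list of indices
    yields a recursion in which each index contributes a measurable indicator. *)
Lemma measurable_count_undup (p : Omega -> pred Rd) l :
  (forall k, measurable_fun setT (fun w => p w (X k w))) ->
  measurable_fun setT (fun w => count (p w) (undup (pts l w))).
Proof.
move=> mp; rewrite /pts; elim: l => [|k l ih] /=; first exact: measurable_cst.
have -> : (fun w => count (p w) (if X k w \in pts l w then undup (pts l w)
    else X k w :: undup (pts l w))) =
  (fun w => ((~~ (X k w \in pts l w) && p w (X k w) : nat) + count (p w) (undup (pts l w)))%N).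
  by apply/funext => w; case: ifP.
apply: measurable_fun_addn; last exact: ih.
apply: (measurableT_comp (f := nat_of_bool)) => //; apply: measurable_and => //.
by apply: measurable_neg; exact: measurable_mem_pts.
Qed.

Lemma sampleE n w : enum_fset (sample X n w) =i pts (iota 0 n) w.
Proof.
move=> x; apply/imfsetP/mapP => /= -[k kn ->]; by exists k.
Qed.

Lemma card_sample n w : #|` sample X n w| = count predT (undup (pts (iota 0 n) w)).
Proof.
rewrite count_predT; apply: perm_size; apply: uniq_perm; rewrite ?undup_uniq//.
by move=> x; rewrite mem_undup; exact: sampleE.
Qed.

Lemma count_sampleD1 n w (p : pred Rd) x :
  count p (sample X n w `\ x)%fset =
  count (fun y => (y != x) && p y) (undup (pts (iota 0 n) w)).
Proof.
rewrite [RHS](eq_count (a2 := predI p (fun y => y != x))); last first.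
  by move=> y /=; rewrite andbC.
rewrite -count_filter; apply/permP; apply: uniq_perm.
- exact: fset_uniq.
- by rewrite filter_uniq// undup_uniq.
- by move=> y; rewrite mem_filter mem_undup -sampleE !inE.
Qed.

(** Sublevel sets suffice: they are counting events when the sample has more than [j] distinct
    points, and otherwise the distance is 0. *)
Lemma measurable_nn_dist j n i : (0 < j)%N -> (i < n)%N ->
  measurable_fun setT (fun w => nn_dist j (X i w) (sample X n w)).
Proof.
move=> j0 ni.
have Xs w : X i w \in sample X n w.
  by rewrite [_ \in _]sampleE; apply/mapP; exists i; rewrite ?mem_iota.
pose big w := (j < #|` sample X n w|)%N.
have mbig : measurable_fun setT big.
  apply: measurable_fun_ltn => //; under eq_fun do rewrite card_sample.
  by apply: measurable_count_undup => k; exact: measurable_cst.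
have mlt rho : measurable_fun setT (fun w => nn_dist j (X i w) (sample X n w) < rho).
  rewrite (_ : (fun w => _) = (fun w => (big w && (j <= count (fun y => (y != X i w)
      && (euclidean_dist (X i w) y < rho)%R) (undup (pts (iota 0 n) w)))%N)
      || (~~ big w && (0 < rho)))).
    apply: measurable_or; apply: measurable_and => //; last first.
      exact: measurable_neg.
    apply: measurable_fun_leq => //.
    apply: (@measurable_count_undup (fun w y => (y != X i w)
      && (euclidean_dist (X i w) y < rho))) => k.
    apply: measurable_and; first by apply: measurable_neg; exact: measurable_eq_rv.
    by apply: measurable_fun_ltr => //; exact: measurable_euclidean_dist.
  apply/funext => w; rewrite /big; case: (boolP (_ < _)%N) => jA/=.
    by rewrite orbF nn_dist_lt// count_sampleD1.
  by rewrite nn_dist_small.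
apply: (measurability _ (RGenInftyO.measurableE R)) => //.
move=> _ [_ [r ->] <-]; rewrite setTI.
have := mlt r measurableT [set true] I; rewrite setTI.
by congr measurable; apply/seteqP; split=> w /=; rewrite in_itv.
Qed.

End sample_measurability.

Lemma ltr_powR_neg (R : realType) (a t alpha : R) : 0 < a -> 0 < t -> alpha < 0 ->
  (t < a `^ alpha) = (a < t `^ alpha^-1).
Proof.
move=> a0 t0 al0.
rewrite -ltr_ln ?posrE ?powR_gt0// ln_powR -[RHS]ltr_ln ?posrE ?powR_gt0// ln_powR.
by rewrite -[RHS](ltr_nM2l al0) mulrA mulfV ?lt_eqF// mul1r.
Qed.

Section nn_terms.
Context {disp} {Omega : measurableType disp} {R : realType}.
Context {P : probability Omega R} {d : nat}.
Local Notation Rd := (d.-tuple R).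
Variables (X : nat -> {RV P >-> Rd}) (j : nat) (alpha : R).
Hypotheses (j_gt0 : (0 < j)%N) (alpha_lt0 : alpha < 0).

Definition nn_term n i w : R :=
  (n%:R `^ (d%:R^-1) * nn_dist j (X i w) (sample X n w)) `^ alpha.

Lemma measurable_nn_term n i : (i < n)%N -> measurable_fun setT (nn_term n i).
Proof.
move=> ni; apply: (measurableT_comp (f := @powR R ^~ alpha)); first exact: measurable_powR.
by apply: measurable_funM => //; exact: measurable_nn_dist.
Qed.

Lemma nn_term_ge0 n i w : 0 <= nn_term n i w. Proof. exact: powR_ge0. Qed.

Definition distinct n w := uniq [seq X k w | k <- iota 0 n].

Lemma count_sample_neighbors n i w rho : distinct n w -> (i < n)%N ->
  count (fun y => euclidean_dist (X i w) y < rho)%R (sample X n w `\ X i w)%fset =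
  neighbors X rho n i w.
Proof.
move=> un ni; rewrite count_sampleD1 undup_id//.
rewrite count_map /neighbors -sum1_count big_mkcond [RHS]big_mkcond/=.
rewrite big_seq [RHS]big_seq; apply: eq_bigr => k kn.
have -> : (X k w != X i w) = (k != i).
  apply/idP/idP; apply: contra => /eqP; first by move=> ->.
  move: kn; rewrite mem_iota/= add0n => kn e; apply/eqP.
  have /(_ i k) := @uniqP _ (X i w) _ un; rewrite !inE size_map size_iota.
  by rewrite !(nth_map 0%N) ?size_iota// !nth_iota// !add0n; symmetry; auto.
by case: (k != i) => //=; case: (_ < _).
Qed.

(** Distinctness gives the finite set more than [j] points, so the distance is positive and the
    decreasing power can be inverted. *)
Lemma below_nn_term n i w t : distinct n w -> (i < n)%N -> (j < n)%N -> 0 < t ->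
  below t (nn_term n i w) = 1 - sparse X (@scaled_radius R d (t `^ alpha^-1) n) n j i w.
Proof.
move=> un ni jn t0; rewrite /below t0/= /nn_term /sparse.
have n0 : (0 < n)%N by exact: leq_trans jn.
have cn : (j < #|` sample X n w|)%N.
  by rewrite card_sample undup_id// count_predT size_map size_iota.
have Xs : X i w \in sample X n w.
  by rewrite [_ \in _]sampleE; apply/mapP; exists i; rewrite ?mem_iota.
have n1d : 0 < n%:R `^ d%:R^-1 :> R by rewrite powR_gt0// ltr0n.
rewrite ltr_powR_neg//; last by rewrite mulr_gt0// nn_dist_gt0.
rewrite mulrC -ltr_pdivlMr// -/(@scaled_radius R d _ n) nn_dist_lt//.
rewrite count_sample_neighbors//.
by case: leqP => _; rewrite ?subr0 ?subrr.
Qed.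

End nn_terms.

(** * Convergence of the exceedance fractions *)

Section exceedance.
Context {disp} {Omega : measurableType disp} {R : realType}.
Variable P : probability Omega R.
Context {d : nat}.
Hypothesis d_gt0 : (0 < d)%N.
Local Notation Rd := (d.-tuple R).
Local Notation lam := (@lebesgue_Rd R d).
Local Notation v := (@unit_ball_volume R d).
Variables (Q : probability Rd R) (f : Rd -> R) (M : R) (X : nat -> {RV P >-> Rd}).
Hypotheses (mf : measurable_fun setT f) (f0 : forall y, 0 <= f y).
Hypotheses (fi : (\int[lam]_y (f y)%:E = 1)%E) (fM : forall y, f y <= M).
Hypothesis Qf : forall A, measurable A -> Q A = (\int[lam]_(y in A) (f y)%:E)%E.
Hypothesis iidX : iid Q X.
Variables (j : nat) (alpha : R).
Hypotheses (j_gt0 : (0 < j)%N) (alpha_lt0 : alpha < 0).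

Let M0 : 0 <= M. Proof. exact: le_trans (f0 (@origin R d)) (fM _). Qed.
Let v0 : 0 < v. Proof. exact: unit_ball_volume_gt0. Qed.

Lemma measurable_eq_event i k : measurable [set w | X i w == X k w].
Proof.
have mT : measurable [set true] by [].
have := measurable_eq_rv X i k measurableT mT; rewrite setTI.
by congr measurable; apply/seteqP; split=> w /=.
Qed.

(** Equal points are closer than every positive [rho], and a pair that close has probability at most
    [M * v * rho ^+ d]. *)
Lemma ae_neq i k : i != k -> P [set w | X i w == X k w] = 0%E.
Proof.
move=> ik; have [s [t [stK tsK s0 s1 _]]] := swap_pair ik.
have iidS : iid Q (X \o s) by exact: iid_reindex iidX.
have mE := measurable_eq_event i k.
apply/eqP; rewrite eq_le measure_ge0 andbT; apply/lee_addgt0Pr => e e0; rewrite add0e.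
have c0 : 0 < M * v + 1 by rewrite ltr_wpDl// mulr_ge0// ltW.
(* As [rho <= 1] and [d > 0], the power [rho ^+ d] is at most [rho], which brings the bound below
   [e]. *)
pose rho := Num.min 1 (e / (M * v + 1)).
have rho0 : 0 < rho by rewrite lt_min ltr01 divr_gt0.
have QC x : (Q (eball x rho) <= e%:E)%E.
  have := prob_eball_le mf f0 fM Qf x rho0.
  move=> /le_trans; apply; rewrite lee_fin.
  have [rho1 rho2] : rho <= 1 /\ rho <= e / (M * v + 1).
    by have := lexx rho; rewrite {2}/rho le_min => /andP.
  have h1 : rho ^+ d <= rho by rewrite ler_iXnr// ltW.
  have h2 : M * v * rho ^+ d <= (M * v + 1) * rho.
    have vM0 : 0 <= M * v by rewrite mulr_ge0// ltW.
    by apply: ler_pM => //; [rewrite exprn_ge0// ltW|rewrite lerDl].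
  by apply: le_trans h2 _; rewrite mulrC -ler_pdivlMr.
have := close_pair_prob iidS QC; rewrite /= s0 s1.
apply: le_trans.
rewrite -[X in P X]setIT -(integral_indic P measurableT mE).
apply: ge0_le_integral => //.
- by apply/measurable_EFinP; exact: measurable_indic.
- apply/measurable_EFinP; apply: measurable_natr_bool; apply: measurable_fun_ltr => //.
  exact: measurable_euclidean_dist.
- move=> w _; rewrite lee_fin indicE; case: (boolP (_ \in _)) => // /set_mem/= /eqP ->.
  by rewrite (eqP (_ : euclidean_dist _ _ == 0)) ?rho0// euclidean_dist_eq0.
Qed.

Lemma ae_distinct n : {ae P, forall w, distinct X n w}.
Proof.
pose N := \big[setU/set0]_(p : 'I_n * 'I_n | p.1 != p.2) [set w | X p.1 w == X p.2 w].
have mE := measurable_eq_event.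
have [mN N0] : measurable N /\ P N = 0%E.
  rewrite /N; elim/big_rec: _ => [|p A p12 [mA A0]]; first by split; rewrite ?measure0.
  split; first exact: measurableU.
  exact: etrans (measureU0 (mE _ _) mA A0) (ae_neq p12).
exists N; split=> // w /=; apply: contra_notP => nN.
rewrite /distinct map_inj_in_uniq ?iota_uniq// => i k.
rewrite !mem_iota/= !add0n => ni nk /eqP Xik; apply/eqP; apply: contrapT => /negP ik.
apply: nN; rewrite /N (bigD1 (Ordinal ni, Ordinal nk))//=; left; exact: Xik.
Qed.

(** For [t > 0], the empirical survival function of the terms; its integral over the levels is the
    normalized statistic. *)
Definition exceed n t w : R := n%:R^-1 * \sum_(i < n) below t (nn_term X j alpha n i w).

Definition tail_radius (t : R) : R := t `^ alpha^-1.

Lemma exceed_sparse n t : (j < n)%N -> 0 < t ->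
  {ae P, forall w, exceed n t w = 1 - sparse_frac X (@scaled_radius R d (tail_radius t) n) n j w}.
Proof.
move=> jn t0; apply: filterS (ae_distinct n) => w un.
rewrite /exceed /sparse_frac.
under eq_bigr => i _ do rewrite below_nn_term//.
rewrite sumrB mulrBr sumr_const card_ord -(mulr_natl 1) mulr1 mulVf//.
by rewrite pnatr_eq0 -lt0n (leq_trans _ jn).
Qed.

Lemma exceed01 n t w : 0 <= exceed n t w <= 1.
Proof.
rewrite /exceed mulr_ge0 ?invr_ge0//=; last by rewrite sumr_ge0// => i _; exact: below_ge0.
case: n => [|n]; first by rewrite big_ord0 mulr0.
rewrite ler_pdivrMl// mulr1 (le_trans (ler_sum _ (fun i _ => below_le1 _ _)))//.
by rewrite sumr_const card_ord.
Qed.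

Lemma measurable_exceed n : measurable_fun setT (fun p : R * Omega => exceed n p.1 p.2).
Proof.
apply: measurable_funM => //; apply: measurable_sum => i; apply: measurable_below.
  exact: measurable_fst.
apply: (measurableT_comp (f := nn_term X j alpha n i)); last exact: measurable_snd.
exact: measurable_nn_term.
Qed.

Lemma tail_radius_gt0 t : 0 < t -> 0 < tail_radius t.
Proof. exact: powR_gt0. Qed.

Lemma tail_radiusX t : tail_radius t ^+ d = t `^ (d%:R / alpha).
Proof. by rewrite -powR_mulrn ?powR_ge0// -powRrM mulrC. Qed.

(** A point has at least [j >= 1] close neighbors with probability at most their expected number,
    and the scaling of the radius cancels [n]. *)
Lemma mean_exceed_le n t : (j < n)%N -> 0 < t ->
  (\int[P]_w (exceed n t w)%:E <= (M * v * t `^ (d%:R / alpha))%:E)%E.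
Proof.
move=> jn t0; case: n jn => // n jn.
set rho := @scaled_radius R d (tail_radius t) n.+1.
have r0 := tail_radius_gt0 t0.
have rho0 : 0 < rho by exact: scaled_radius_gt0.
have msp := measurable_sparse_frac X rho n.+1 j.
have mex : measurable_fun setT (exceed n.+1 t).
  exact: (measurableT_comp (measurable_exceed n.+1) (measurable_pair1 t)).
have ex_ge0 w : 0 <= exceed n.+1 t w by have /andP[] := exceed01 n.+1 t w.
have sumE : (\int[P]_w (exceed n.+1 t w)%:E + (mean_tail Q rho n j)%:E = 1)%E.
  rewrite -(integral_sparse_frac iidX) -ge0_integralD//; last 4 first.
  - by move=> w _; rewrite lee_fin.
  - exact/measurable_EFinP.
  - by move=> w _; rewrite lee_fin sparse_frac_ge0.
  - exact/measurable_EFinP.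
  rewrite (ae_eq_integral (cst 1%E))//.
  - by rewrite integral_cst//= probability_setT mule1.
  - by apply: emeasurable_funD; exact/measurable_EFinP.
  - apply: filterS (exceed_sparse jn t0) => w -> _.
    by rewrite -EFinD subrK.
apply: (@le_trans _ _ (1 - mean_tail Q rho n j)%:E).
  by rewrite EFinB -sumE addeK.
rewrite lee_fin lerBlDl -lerBlDr.
rewrite -lee_fin -mean_tailE EFinB.
case: (j) j_gt0 => // k _.
rewrite leeBlDr// -(mul1e 1%E) -(probability_setT Q) -integral_cst//.
have c0 : 0 <= M * v * t `^ (d%:R / alpha).
  by rewrite mulr_ge0 ?powR_ge0// mulr_ge0// ltW.
rewrite [X in (_ + X)%E](_ : _ = (\int[Q]_x (cst (M * v * t `^ (d%:R / alpha))%:E x))%E); last first.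
  by rewrite integral_cst//= probability_setT mule1.
have mG : measurable_fun setT (fun x => (binom_tail (ball_prob Q rho x) n k.+1)%:E).
  by apply/measurable_EFinP; exact: measurable_binom_ball_prob.
rewrite -ge0_integralD//; last first.
  by move=> x _; rewrite lee_fin binom_tail_ge0// ball_prob01.
apply: ge0_le_integral => //.
- by apply: emeasurable_funD.
- move=> x _; rewrite /cst probability_setT -EFinD lee_fin -lerBlDl.
  apply: le_trans (binom_tail_ge n k (ball_prob01 Q rho x)) _.
  have pb : ball_prob Q rho x <= M * v * rho ^+ d.
    rewrite -lee_fin fineK; first exact: (prob_eball_le mf f0 fM Qf).
    by rewrite fin_num_measure//; exact: measurable_eball.
  apply: (@le_trans _ _ (n.+1%:R * (M * v * rho ^+ d))).
    by apply: ler_pM => //; [have /andP[] := ball_prob01 Q rho x|rewrite ler_nat].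
  rewrite /rho scaled_radiusX// tail_radiusX le_eqVlt; apply/orP; left; apply/eqP.
  have : n.+1%:R != 0 :> R by rewrite pnatr_eq0.
  by move: (n.+1%:R) => N N0; field.
Qed.

(** For [t > 0], the probability that a Poisson variable with mean v t^(d/alpha) f(x), the limiting
    number of neighbors of [x], is at least [j]. The cutoff in [t] matches that of [below]. *)
Definition tail_kernel (t : R) (x : Rd) : R :=
  (0 < t)%R%:R * (1 - poisson_tail j (v * t `^ (d%:R / alpha) * f x)).

Lemma tail_kernel01 t x : 0 <= tail_kernel t x <= 1.
Proof.
have l0 : 0 <= v * t `^ (d%:R / alpha) * f x.
  by rewrite mulr_ge0// mulr_ge0 ?powR_ge0// ltW.
rewrite /tail_kernel; case: (0 < t); rewrite ?mul0r ?mul1r ?lexx ?ler01//.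
by rewrite subr_ge0 poisson_tail_le1//= gerBl poisson_tail_ge0.
Qed.

(** The counterpart of [mean_exceed_le] for the limit, from the Lipschitz bound against parameter 0,
    where the Poisson tail is 1. *)
Lemma tail_kernel_le t x : tail_kernel t x <= M * v * t `^ (d%:R / alpha).
Proof.
have l0 : 0 <= v * t `^ (d%:R / alpha) * f x.
  by rewrite mulr_ge0// mulr_ge0 ?powR_ge0// ltW.
apply: (@le_trans _ _ (v * t `^ (d%:R / alpha) * f x)); last first.
  rewrite (_ : M * v * _ = v * t `^ (d%:R / alpha) * M); last by ring.
  by rewrite ler_wpM2l// mulr_ge0 ?powR_ge0// ltW.
rewrite /tail_kernel; case: (0 < t); rewrite ?mul0r ?mul1r//.
case: (j) j_gt0 => // k _.
rewrite -[X in X - _](@poisson_tail_at0 R k) (le_trans (ler_norm _))//.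
by rewrite (le_trans (poisson_tail_lip _ _ l0))// sub0r normrN ger0_norm.
Qed.

Lemma measurable_tail_kernel :
  measurable_fun setT (fun p : measurableTypeR R * Rd => tail_kernel p.1 p.2).
Proof.
apply: measurable_funM.
  by apply: measurable_natr_bool; apply: measurable_fun_ltr => //; exact: measurable_fst.
apply: measurable_funB => //; apply: measurable_poisson_tail.
apply: measurable_funM; last exact: (measurableT_comp mf measurable_snd).
apply: measurable_funM => //.
apply: (measurableT_comp (f := @powR R ^~ (d%:R / alpha))); first exact: measurable_powR.
exact: measurable_fst.
Qed.

Definition limit_tail (t : R) : R := fine (\int[Q]_x (tail_kernel t x)%:E)%E.

Lemma limit_tailE t : ((limit_tail t)%:E = \int[Q]_x (tail_kernel t x)%:E)%E.
Proof.
have K01 x := tail_kernel01 t x.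
rewrite fineK// ge0_fin_numE; last first.
  by apply: integral_ge0 => x _; rewrite lee_fin; have /andP[] := K01 x.
apply: (@le_lt_trans _ _ (\int[Q]_x (cst 1%:E x)))%E; last first.
  by rewrite integral_cst//= probability_setT mule1 ltry.
apply: ge0_le_integral => //.
- by move=> x _; rewrite lee_fin; have /andP[] := K01 x.
- apply/measurable_EFinP.
  exact: (measurableT_comp measurable_tail_kernel (measurable_pair1 t)).
- by move=> x _; rewrite lee_fin; have /andP[] := K01 x.
Qed.

Lemma limit_tail_ge0 t : 0 <= limit_tail t.
Proof.
rewrite -lee_fin limit_tailE; apply: integral_ge0 => x _; rewrite lee_fin.
by have /andP[] := tail_kernel01 t x.
Qed.

Lemma limit_tail_ub t c : (forall x, tail_kernel t x <= c) -> limit_tail t <= c.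
Proof.
move=> Kc; rewrite -lee_fin limit_tailE.
have c0 : 0 <= c.
  by apply: le_trans (Kc (@origin R d)); have /andP[] := tail_kernel01 t (@origin R d).
apply: (@le_trans _ _ (\int[Q]_x (cst c%:E x)))%E; last first.
  by rewrite integral_cst//= probability_setT mule1.
apply: ge0_le_integral => //.
- by move=> x _; rewrite lee_fin; have /andP[] := tail_kernel01 t x.
- apply/measurable_EFinP.
  exact: (measurableT_comp measurable_tail_kernel (measurable_pair1 t)).
- by move=> x _; rewrite lee_fin.
Qed.

Lemma measurable_limit_tail :
  measurable_fun setT (limit_tail : measurableTypeR R -> R).
Proof.
apply/measurable_EFinP; rewrite (_ : EFin \o limit_tail =
    fun t : measurableTypeR R => \int[Q]_x (tail_kernel t x)%:E)%E; last first.
  by apply/funext => t; exact: limit_tailE.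
apply: (@measurable_fun_fubini_tonelli_F _ _ _ _ _ Q
  (fun p : measurableTypeR R * Rd => (tail_kernel p.1 p.2)%:E)).
- by apply/measurable_EFinP; exact: measurable_tail_kernel.
- by move=> p; rewrite lee_fin; have /andP[] := tail_kernel01 p.1 p.2.
Qed.

Lemma limit_tail_poisson t : 0 < t -> limit_tail t = 1 - poisson_mean Q f j (tail_radius t).
Proof.
move=> t0; apply: EFin_inj; rewrite limit_tailE EFinB.
rewrite /poisson_mean tail_radiusX.
set l := fun x => v * t `^ (d%:R / alpha) * f x.
have l0 x : 0 <= l x by rewrite mulr_ge0// mulr_ge0 ?powR_ge0// ltW.
have mpt : measurable_fun setT (fun x => (poisson_tail j (l x))%:E).
  by apply/measurable_EFinP; apply: measurable_poisson_tail; exact: measurable_funM.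
have mK : measurable_fun setT (fun x => (tail_kernel t x)%:E).
  apply/measurable_EFinP.
  exact: (measurableT_comp measurable_tail_kernel (measurable_pair1 t)).
have K0 x : (0 <= (tail_kernel t x)%:E)%E.
  by rewrite lee_fin; have /andP[] := tail_kernel01 t x.
have pt0 x : (0 <= (poisson_tail j (l x))%:E)%E by rewrite lee_fin poisson_tail_ge0.
have sumE : (\int[Q]_x (tail_kernel t x)%:E + \int[Q]_x (poisson_tail j (l x))%:E = 1)%E.
  rewrite -ge0_integralD//.
  rewrite (eq_integral (cst 1%E)); first by rewrite integral_cst//= probability_setT mule1.
  by move=> x _; rewrite -EFinD /tail_kernel t0 mul1r subrK.
have fin : (\int[Q]_x (poisson_tail j (l x))%:E)%E \is a fin_num.
  rewrite ge0_fin_numE; last exact: integral_ge0.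
  by rewrite (@le_lt_trans _ _ 1%E) ?ltry// -sumE leeDr// integral_ge0.
by rewrite fineK// -sumE addeK.
Qed.

Definition deviation n t : \bar R := (\int[P]_w (`|exceed n t w - limit_tail t|)%:E)%E.

Lemma exceed_le0 n t w : t <= 0 -> exceed n t w = 0.
Proof.
move=> t0; rewrite /exceed big1 ?mulr0// => i _.
by rewrite /below ltNge t0.
Qed.

Lemma limit_tail_le0 t : t <= 0 -> limit_tail t = 0.
Proof.
move=> t0; apply/eqP; rewrite eq_le limit_tail_ge0 andbT; apply: limit_tail_ub => x.
by rewrite /tail_kernel ltNge t0 mul0r.
Qed.

Lemma measurable_exceed_dev n :
  measurable_fun setT (fun p : measurableTypeR R * Omega => `|exceed n p.1 p.2 - limit_tail p.1|).
Proof.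
apply: measurableT_comp => //; apply: measurable_funB; first exact: measurable_exceed.
exact: (measurableT_comp measurable_limit_tail measurable_fst).
Qed.

(** The bound 1 serves for small [t]. The other is the sum of the equal bounds on the mean
    exceedance and on its limit, whence the factor 2. *)
Lemma deviation_le n t : (j < n)%N -> 0 < t ->
  (deviation n t <= (Num.min 1 (2 * (M * v) * t `^ (d%:R / alpha)))%:E)%E.
Proof.
move=> jn t0.
have mD : measurable_fun setT (fun w => (`|exceed n t w - limit_tail t|)%:E).
  apply/measurable_EFinP.
  exact: (measurableT_comp (measurable_exceed_dev n) (measurable_pair1 t)).
have z0 := limit_tail_ge0 t.
rewrite /Num.min; case: ifPn => _.
  apply: (@le_trans _ _ (\int[P]_x (cst 1%:E x)))%E; last first.
    by rewrite integral_cst//= probability_setT mule1.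
  apply: ge0_le_integral => //.
  move=> w _; rewrite lee_fin ler_norml.
  have /andP[e0 e1] := exceed01 n t w.
  have z1 : limit_tail t <= 1.
    by apply: limit_tail_ub => x; have /andP[] := tail_kernel01 t x.
  by apply/andP; split; lra.
have mex : measurable_fun setT (fun w => (exceed n t w)%:E).
  apply/measurable_EFinP.
  exact: (measurableT_comp (measurable_exceed n) (measurable_pair1 t)).
have ex0 w : 0 <= exceed n t w by have /andP[] := exceed01 n t w.
apply: (@le_trans _ _ (\int[P]_w ((exceed n t w)%:E + cst (limit_tail t)%:E w))%E).
  apply: ge0_le_integral => //.
  - by apply: emeasurable_funD.
  - move=> w _; rewrite -EFinD lee_fin (le_trans (ler_normB _ _))//.
    by rewrite !ger0_norm.
rewrite ge0_integralD//; last by move=> w _; rewrite lee_fin.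
rewrite integral_cst//= probability_setT mule1 -mulrA mulr_natl mulr2n EFinD leeD//.
  exact: mean_exceed_le.
rewrite lee_fin; apply: limit_tail_ub => x; exact: tail_kernel_le.
Qed.

Lemma deviation_cvg t : 0 < t -> deviation n t @[n --> \oo] --> 0%E.
Proof.
move=> t0.
have r0 := tail_radius_gt0 t0.
have dev0 n : (0 <= deviation n t)%E by apply: integral_ge0 => w _; rewrite lee_fin.
apply/fine_cvgP; split.
  exists j.+1 => // n /= jn; rewrite ge0_fin_numE//.
  by rewrite (le_lt_trans (deviation_le jn t0))// ltry.
apply/cvgrPdist_le => e e0.
have := sparse_frac_cvg d_gt0 mf f0 fi fM Qf iidX j r0 e0.
move=> [N _ HN]; exists (maxn N j.+1) => // n /=; rewrite geq_max => /andP[Nn jn].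
rewrite sub0r normrN ger0_norm ?fine_ge0// -lee_fin fineK; last first.
  by rewrite ge0_fin_numE// (le_lt_trans (deviation_le jn t0))// ltry.
apply: le_trans (HN n Nn); rewrite le_eqVlt; apply/orP; left; apply/eqP.
apply: ae_eq_integral => //.
- apply/measurable_EFinP.
  exact: (measurableT_comp (measurable_exceed_dev n) (measurable_pair1 t)).
- apply/measurable_EFinP; apply: measurableT_comp => //; apply: measurable_funB => //.
  exact: measurable_sparse_frac.
apply: filterS (exceed_sparse jn t0) => w -> _.
congr EFin; rewrite limit_tail_poisson// -normrN; congr `|_|; ring.
Qed.

End exceedance.

(** * Domination over the levels and convergence of the moments *)

Lemma powRN_cvg0 (R : realType) (c : R) : 0 < c -> t `^ (- c) @[t --> +oo] --> (0 : R).
Proof.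
move=> c0; apply/cvgrPdist_le => e e0; near=> t.
have t0 : 0 < t by near: t; exact: nbhs_pinfty_gt.
have te : e^-1 `^ c^-1 <= t by near: t; exact: nbhs_pinfty_ge.
rewrite sub0r normrN ger0_norm ?powR_ge0// powRN -[leRHS]invrK lef_pV2 ?posrE ?invr_gt0 ?powR_gt0//.
have -> : e^-1 = (e^-1 `^ c^-1) `^ c by rewrite -powRrM mulVf ?gt_eqF// powRr1// invr_ge0 ltW.
apply: ge0_ler_powR; rewrite ?nnegrE ?powR_ge0 ?(ltW c0) ?(ltW t0) ?te.
Unshelve. all: by end_near. Qed.

Lemma integral_powRN_itv (R : realType) (c : R) : 1 < c ->
  (\int[lebesgue_measure]_(t in `[1%R, +oo[) (t `^ (- c))%:E = (c - 1)^-1%:E)%E.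
Proof.
move=> c1; have c10 : 0 < c - 1 by rewrite subr_gt0.
have nc : c - 1 != 0 by rewrite gt_eqF.
pose F (t : R) := - (c - 1)^-1 * t `^ (- (c - 1)).
have dp (x : R) b : 0 < x -> derivable (fun t : R => t `^ b) x 1.
  by move=> x0; apply: derivable_powR; rewrite in_itv/= andbT.
have cp (x : R) b : 0 < x -> {for x, continuous (fun t : R => t `^ b)}.
  move=> x0; apply: differentiable_continuous; apply/derivable1_diffP; exact: dp.
rewrite (@ge0_continuous_FTC2y _ _ F 1 0).
- by rewrite /F powR1 mulr1 sub0e -EFinN opprK.
- by move=> x _; exact: powR_ge0.
- apply: continuous_in_subspaceT => x; rewrite inE/= in_itv/= andbT => x1.
  by apply: cp; exact: lt_le_trans x1.
- rewrite -(mulr0 (- (c - 1)^-1)); apply: cvgM; first exact: cvg_cst.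
  exact: powRN_cvg0.
- by move=> x x1; apply: derivableM => //; apply: dp; exact: lt_trans x1.
- by apply: cvg_at_right_filter; apply: cvgM; [exact: cvg_cst|exact: cp].
- move=> x; rewrite in_itv/= andbT => x1; have x0 : 0 < x by exact: lt_trans x1.
  rewrite derive1E deriveM//; last exact: dp.
  rewrite derive_cst scaler0 addr0 -derive1E powR_derive1 ?in_itv/= ?andbT//.
  rewrite /GRing.scale/= mulrA mulrNN mulVf// mul1r; congr (_ `^ _); ring.
Qed.

Section second_moment.
Context {R : realType}.
Local Notation leb := (@lebesgue_measure R).

(* Below the level [W / 2] the integral of [g <= 1] is at most [W / 2]. *)
Lemma sqr_le_integral (g : measurableTypeR R -> R) (W : R) : measurable_fun setT g ->
  (forall t, 0 <= g t <= 1) -> (forall t, t <= 0 -> g t = 0) -> 0 <= W ->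
  (W%:E <= \int[leb]_t (g t)%:E)%E ->
  ((W ^+ 2)%:E <= 4%:E * \int[leb]_t (t * g t)%:E)%E.
Proof.
move=> mg g01 g0 W0 Wg.
have h0 : 0 <= W / 2 by rewrite divr_ge0.
have g_ge0 t : 0 <= g t by have /andP[] := g01 t.
have g_le1 t : g t <= 1 by have /andP[] := g01 t.
have tg t : 0 <= t * g t.
  by have [t0|/ltW t0] := leP t 0; [rewrite g0// mulr0|exact: mulr_ge0].
have mtg : measurable_fun setT (fun t : measurableTypeR R => (t * g t)%:E).
  by apply/measurable_EFinP; apply: measurable_funM.
have mb : measurable_fun setT (fun t : measurableTypeR R => (below t (W / 2))%:E).
  by apply/measurable_EFinP; exact: measurable_below.
(* Pointwise, g(t) W/2 is at most t g(t) above the level W/2, and at most W/2 below it since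
   [g <= 1]. Together with the lower bound [W] on the integral of g, this leaves W^2/4 <= int t g(t)
   dt. *)
have key : ((W / 2)%:E * \int[leb]_t (g t)%:E <=
    \int[leb]_t (t * g t)%:E + (W / 2)%:E * (W / 2)%:E)%E.
  rewrite -[X in (_ <= _ + _ * X)%E](integral_below h0).
  have below0 t : (0 <= (below t (W / 2))%:E)%E.
    by rewrite lee_fin below_ge0.
  have ge0 t : (0 <= (g t)%:E)%E by rewrite lee_fin.
  have mgE : measurable_fun setT (fun t => (g t)%:E) by exact/measurable_EFinP.
  rewrite -!ge0_integralZl_EFin//.
  rewrite -ge0_integralD//; last 3 first.
  - by move=> t _; rewrite lee_fin.
  - by move=> t _; rewrite -EFinM lee_fin mulr_ge0 ?below_ge0.
  - by apply: emeasurable_funM.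
  apply: ge0_le_integral => //.
  - by move=> t _; rewrite -EFinM lee_fin mulr_ge0.
  - by apply: emeasurable_funM => //; exact/measurable_EFinP.
  - by apply: emeasurable_funD => //; exact: emeasurable_funM.
  move=> t _; rewrite -!EFinM -EFinD lee_fin.
  have [t0|t0] := leP t 0; first by rewrite g0// !mulr0 add0r mulr_ge0 ?below_ge0.
  rewrite /below t0/=; case: ltP => tW.
    rewrite mulr1 (@le_trans _ _ (W / 2))// ?ler_piMr// lerDr.
    by rewrite mulr_ge0// ltW.
  by rewrite mulr0 addr0 ler_wpM2r.
have Itg0 : (0 <= \int[leb]_t (t * g t)%:E)%E by apply: integral_ge0 => t _; rewrite lee_fin.
have [->|Ifin] := eqVneq (\int[leb]_t (t * g t)%:E)%E +oo%E.
  by rewrite gt0_muley ?leey// lte_fin.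
have : ((W / 2 * W)%:E <= \int[leb]_t (t * g t)%:E + (W / 2)%:E * (W / 2)%:E)%E.
  by apply: le_trans key; rewrite EFinM lee_wpmul2l.
have If : (\int[leb]_t (t * g t)%:E)%E \is a fin_num by rewrite ge0_fin_numE// ltey.
rewrite -(fineK If) -!EFinM -EFinD !lee_fin; lra.
Qed.

End second_moment.

Section power_tail.
Context {R : realType}.
Local Notation leb := (@lebesgue_measure R).
Implicit Types K c : R.

(** A majorant, uniform in the sample size, for the weighted deviations; it also yields the
    finiteness of a Gamma integral in [gint_fin]. *)
Definition power_tail K c (t : R) : R :=
  below t 1 + K * (\1_(`[1%R, +oo[%classic) t * t `^ (- c)).

Lemma measurable_power_tail K c :
  measurable_fun setT (power_tail K c : measurableTypeR R -> R).
Proof.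
apply: measurable_funD; first exact: measurable_below.
apply: measurable_funM => //; apply: measurable_funM; first exact: measurable_indic.
exact: measurable_powR.
Qed.

Lemma integrable_power_tail K c : 0 <= K -> 1 < c -> leb.-integrable setT (EFin \o power_tail K c).
Proof.
move=> K0 c1.
have mp : measurable_fun setT (fun t : measurableTypeR R => (t `^ (- c))%:E).
  by apply/measurable_EFinP; exact: measurable_powR.
have mi : measurable_fun setT (fun t : measurableTypeR R =>
    (\1_(`[1%R, +oo[%classic) t * t `^ (- c))%:E).
  by apply/measurable_EFinP; apply: measurable_funM;
    [exact: measurable_indic|exact: measurable_powR].
have i0 t : 0 <= (\1_(`[1%R, +oo[%classic) t * t `^ (- c)).
  by rewrite mulr_ge0 ?powR_ge0// indicE.
apply/integrableP; split; first by apply/measurable_EFinP; exact: measurable_power_tail.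
rewrite (eq_integral (fun t : measurableTypeR R =>
    (below t 1)%:E + K%:E * (\1_(`[1%R, +oo[%classic) t * t `^ (- c))%:E)%E); last first.
  move=> t _; rewrite /= ger0_norm ?addr_ge0 ?below_ge0//.
  by rewrite mulr_ge0.
rewrite ge0_integralD//; last 4 first.
- by move=> t _; rewrite lee_fin below_ge0.
- by apply/measurable_EFinP; exact: measurable_below.
- by move=> t _; rewrite -EFinM lee_fin mulr_ge0.
- exact: emeasurable_funM.
rewrite integral_below// ge0_integralZl_EFin//; last first.
  by move=> t _; rewrite lee_fin.
rewrite (_ : integral _ _ _ = (c - 1)^-1%:E); first by rewrite -EFinM -EFinD ltry.
rewrite -(integral_powRN_itv c1) [RHS]integral_mkcond.
by apply: eq_integral => t _; rewrite epatch_indic/= -EFinM mulrC.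
Qed.

End power_tail.

Section moment_control.
Context {disp} {Omega : measurableType disp} {R : realType}.
Variable P : probability Omega R.
Context {d : nat}.
Hypothesis d_gt0 : (0 < d)%N.
Local Notation Rd := (d.-tuple R).
Local Notation lam := (@lebesgue_Rd R d).
Local Notation leb := (@lebesgue_measure R).
Local Notation v := (@unit_ball_volume R d).
Variables (Q : probability Rd R) (f : Rd -> R) (M : R) (X : nat -> {RV P >-> Rd}).
Hypotheses (mf : measurable_fun setT f) (f0 : forall y, 0 <= f y).
Hypotheses (fi : (\int[lam]_y (f y)%:E = 1)%E) (fM : forall y, f y <= M).
Hypothesis Qf : forall A, measurable A -> Q A = (\int[lam]_(y in A) (f y)%:E)%E.
Hypothesis iidX : iid Q X.
Variables (j q : nat) (alpha : R).
Hypotheses (j_gt0 : (0 < j)%N) (alpha_lt0 : alpha < 0).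
Hypotheses (q12 : q = 1%N \/ q = 2%N) (alpha_gt : - (d%:R / q%:R) < alpha).

Let M0 : 0 <= M. Proof. exact: le_trans (f0 (@origin R d)) (fM _). Qed.
Let v0 : 0 < v. Proof. exact: unit_ball_volume_gt0. Qed.
Local Notation exceed := (exceed X j alpha).
Local Notation limit_tail := (limit_tail Q f j alpha).
Local Notation deviation := (deviation Q f X j alpha).

Definition mean_stat n w : R := n%:R^-1 * nn_stat j alpha X n w.

Lemma measurable_mean_stat n : measurable_fun setT (mean_stat n).
Proof.
by apply: measurable_funM => //; apply: measurable_sum => i; exact: measurable_nn_term.
Qed.

Lemma measurable_exceed_section n w :
  measurable_fun setT (fun t : measurableTypeR R => exceed n t w).
Proof. exact: (measurableT_comp (measurable_exceed X alpha j_gt0 n) (measurable_pair2 w)). Qed.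

Lemma integral_exceed n w : (\int[leb]_t (exceed n t w)%:E = (mean_stat n w)%:E)%E.
Proof.
have mb i : measurable_fun setT
    (fun t : measurableTypeR R => (below t (nn_term X j alpha n i w))%:E).
  by apply/measurable_EFinP; exact: measurable_below.
have b0 i t : (0 <= (below t (nn_term X j alpha n i w))%:E)%E by rewrite lee_fin below_ge0.
under eq_integral do rewrite EFinM -sumEFin.
rewrite ge0_integralZl_EFin//; last 2 first.
- by move=> t _; exact: sume_ge0.
- exact: emeasurable_sum.
rewrite ge0_integral_sum// EFinM; congr (_ * _)%E.
by rewrite -sumEFin; apply: eq_bigr => i _; rewrite integral_below ?nn_term_ge0.
Qed.

(** The limit is an abstract real in the moment estimates; [integral_limit_tail] supplies its
    value. *)
Variable mu : R.
Hypothesis mu_tail : (\int[leb]_t (limit_tail t)%:E = mu%:E)%E.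

Lemma measurable_dev_section n w :
  measurable_fun setT (fun t : measurableTypeR R => `|exceed n t w - limit_tail t|).
Proof.
exact: (measurableT_comp (measurable_exceed_dev Q X mf f0 alpha j_gt0 n) (measurable_pair2 w)).
Qed.

Lemma mean_stat_dist n w :
  (`|mean_stat n w - mu|%:E <= \int[leb]_t (`|exceed n t w - limit_tail t|)%:E)%E.
Proof.
have mE : measurable_fun setT (fun t : measurableTypeR R => (exceed n t w)%:E).
  by apply/measurable_EFinP; exact: measurable_exceed_section.
have mz : measurable_fun setT (fun t : measurableTypeR R => (limit_tail t)%:E).
  by apply/measurable_EFinP; exact: measurable_limit_tail.
have mD : measurable_fun setT (fun t : measurableTypeR R => (`|exceed n t w - limit_tail t|)%:E).
  by apply/measurable_EFinP; exact: measurable_dev_section.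
have e0 t : (0 <= (exceed n t w)%:E)%E.
  by rewrite lee_fin; have /andP[] := exceed01 X j alpha n t w.
have z0 t : (0 <= (limit_tail t)%:E)%E by rewrite lee_fin; exact: limit_tail_ge0.
have [Doo|Dfin] := eqVneq (\int[leb]_t (`|exceed n t w - limit_tail t|)%:E)%E +oo%E.
  by rewrite Doo leey.
have D0 : (0 <= \int[leb]_t (`|exceed n t w - limit_tail t|)%:E)%E.
  by apply: integral_ge0 => t _; rewrite lee_fin.
have Df : (\int[leb]_t (`|exceed n t w - limit_tail t|)%:E)%E \is a fin_num.
  by rewrite ge0_fin_numE// ltey.
rewrite -(fineK Df) lee_fin ler_norml; set D := fine _.
(* Both bounds are put in additive form so that they follow from monotonicity of integrals of
   nonnegative functions. *)
suff [h1 h2] : mu <= mean_stat n w + D /\ mean_stat n w <= mu + D.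
  by apply/andP; split; lra.
rewrite -!lee_fin !EFinD !fineK// -mu_tail -integral_exceed.
rewrite -!ge0_integralD//.
split; apply: ge0_le_integral => //.
- exact: emeasurable_funD.
- by move=> t _; rewrite -EFinD lee_fin -lerBlDl -normrN opprB ler_norm.
- exact: emeasurable_funD.
- by move=> t _; rewrite -EFinD lee_fin -lerBlDl ler_norm.
Qed.

(** The weight [t ^+ q.-1] treats both values of [q] at once; the 4 comes from [sqr_le_integral] and
    is harmless for [q = 1]. *)
Lemma mean_stat_distX n w :
  ((`|mean_stat n w - mu| ^+ q)%:E <=
   4%:E * \int[leb]_t (t ^+ q.-1 * `|exceed n t w - limit_tail t|)%:E)%E.
Proof.
have dist := mean_stat_dist n w.
case: q12 => -> /=.
  rewrite expr1; under [in leRHS]eq_integral do rewrite expr0 mul1r.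
  apply: (le_trans dist).
  rewrite -[leLHS]mul1e lee_wpmul2r ?lee_fin ?ler1n//.
  by apply: integral_ge0 => t _; rewrite lee_fin.
under [in leRHS]eq_integral do rewrite expr1.
apply: sqr_le_integral dist => //.
- exact: measurable_dev_section.
- move=> t; rewrite normr_ge0/= ler_norml.
  have /andP[e0 e1] := exceed01 X j alpha n t w.
  have z0 : 0 <= limit_tail t by exact: limit_tail_ge0.
  have z1 : limit_tail t <= 1.
    by apply: limit_tail_ub => // x; have /andP[] : 0 <= tail_kernel f j alpha t x <= 1 by exact: tail_kernel01.
  by apply/andP; split; lra.
- by move=> t t0; rewrite exceed_le0// limit_tail_le0// subr0 normr0.
Qed.

Definition weighted_dev n (t : R) : \bar R := ((t ^+ q.-1)%:E * deviation n t)%E.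

Lemma weighted_dev_le0 n t : t <= 0 -> weighted_dev n t = 0%E.
Proof.
move=> t0; rewrite /weighted_dev /deviation.
by rewrite integral0_eq ?mule0// => w _; rewrite exceed_le0// limit_tail_le0// subr0 normr0.
Qed.

Lemma measurable_weighted_dev n :
  measurable_fun setT (weighted_dev n : measurableTypeR R -> \bar R).
Proof.
apply: emeasurable_funM; first by apply/measurable_EFinP; exact: measurable_funX.
apply: (@measurable_fun_fubini_tonelli_F _ _ _ _ _ P
  (fun p : measurableTypeR R * Omega => (`|exceed n p.1 p.2 - limit_tail p.1|)%:E)).
- by apply/measurable_EFinP; exact: measurable_exceed_dev.
- by move=> p; rewrite lee_fin.
Qed.

Lemma mean_stat_moment n :
  (\int[P]_w (`|mean_stat n w - mu| ^+ q)%:E <= 4%:E * \int[leb]_t weighted_dev n t)%E.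
Proof.
pose lebs : {sigma_finite_measure set (measurableTypeR R) -> \bar R} := leb.
pose h (p : measurableTypeR R * Omega) : \bar R :=
  (p.1 ^+ q.-1 * `|exceed n p.1 p.2 - limit_tail p.1|)%:E.
have mh : measurable_fun setT h.
  apply/measurable_EFinP/measurable_funM; last exact: measurable_exceed_dev.
  exact: (measurable_funX _ measurable_fst).
have h0 p : (0 <= h p)%E.
  rewrite lee_fin; have [p0|p0] := leP p.1 0; last by rewrite mulr_ge0// exprn_ge0// ltW.
  by rewrite exceed_le0// limit_tail_le0// subr0 normr0 mulr0.
have mI : measurable_fun setT (fun w => \int[leb]_t h (t, w))%E.
  exact: (@measurable_fun_fubini_tonelli_G _ _ _ _ _ lebs h).
have -> : (\int[leb]_t weighted_dev n t = \int[P]_w \int[leb]_t h (t, w))%E.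
  rewrite -(fubini_tonelli (m1 := lebs) (m2 := P) h mh h0).
  apply: eq_integral => t _; rewrite /weighted_dev /deviation /h/=.
  have [t0|t0] := leP t 0.
    rewrite !integral0_eq ?mule0// => w _; last first.
      by rewrite exceed_le0// limit_tail_le0// subr0 normr0.
    by rewrite exceed_le0// limit_tail_le0// subr0 normr0 mulr0.
  under [RHS]eq_integral do rewrite EFinM.
  rewrite ge0_integralZl_EFin//.
  - apply/measurable_EFinP.
    exact: (measurableT_comp (measurable_exceed_dev Q X mf f0 alpha j_gt0 n) (measurable_pair1 t)).
  - by rewrite exprn_ge0// ltW.
rewrite -ge0_integralZl_EFin//; last by move=> w _; apply: integral_ge0.
apply: ge0_le_integral => //.
- apply/measurable_EFinP; apply: measurable_funX; apply: measurableT_comp => //.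
  by apply: measurable_funB => //; exact: measurable_mean_stat.
- by apply: emeasurable_funM.
- by move=> w _; exact: mean_stat_distX.
Qed.

(** The weighted deviation is bounded by a multiple of t^(q-1+d/alpha), whose exponent is [- kappa].
    The condition [kappa > 1] restates alpha > -d/q. *)
Let kappa := - (d%:R / alpha) - q.-1%:R.

Let kappa_gt1 : 1 < kappa.
Proof.
have q0 : (0 < q)%N by case: q12 => ->.
rewrite /kappa ltrBrDr -[X in X + _]/(1%:R) -natrD add1n prednK//.
rewrite -mulrN -invrN ltr_pdivlMr ?oppr_gt0//.
by move: alpha_gt; rewrite ltrNl ltr_pdivlMr ?ltr0n// mulrC.
Qed.

Let K := 2 * (M * v).

Let K0 : 0 <= K. Proof. by apply: mulr_ge0 => //; apply: mulr_ge0 => //; exact: ltW. Qed.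

Lemma weighted_dev_dominated n t : (j < n)%N ->
  (`|weighted_dev n t| <= (power_tail K kappa t)%:E)%E.
Proof.
move=> jn.
have D0 : 0 <= power_tail K kappa t.
  by rewrite addr_ge0 ?below_ge0// mulr_ge0// mulr_ge0 ?powR_ge0// indicE.
have [t0|t0] := leP t 0; first by rewrite weighted_dev_le0// abse0 lee_fin.
have tq : 0 <= t ^+ q.-1 by rewrite exprn_ge0// ltW.
have dev := deviation_le d_gt0 mf f0 fM Qf iidX j_gt0 alpha_lt0 jn t0.
rewrite gee0_abs; last first.
  by rewrite mule_ge0 ?lee_fin// integral_ge0// => w _; rewrite lee_fin.
apply: (@le_trans _ _ (t ^+ q.-1 * Num.min 1 (K * t `^ (d%:R / alpha)))%:E).
  by rewrite EFinM lee_wpmul2l.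
rewrite lee_fin /power_tail.
have [t1|t1] := ltP t 1.
  rewrite /below t0 t1/= indicE memNset ?mul0r ?mulr0 ?addr0; last first.
    by rewrite /= in_itv/= andbT => /le_lt_trans/(_ t1); rewrite ltxx.
  apply: (@le_trans _ _ (1 * 1)); last by rewrite mulr1.
  apply: ler_pM => //; first by rewrite le_min ler01/= mulr_ge0 ?powR_ge0.
    by rewrite exprn_ile1// ltW.
  by rewrite ge_min lexx.
rewrite indicE mem_set ?mul1r; last by rewrite /= in_itv/= t1.
have -> : - kappa = q.-1%:R + d%:R / alpha by rewrite /kappa; ring.
have -> : t `^ (q.-1%:R + d%:R / alpha) = t ^+ q.-1 * t `^ (d%:R / alpha).
  by rewrite powRD ?(gt_eqF t0) ?implybT// powR_mulrn// ltW.
rewrite [leRHS]addrC ler_wpDr ?below_ge0//.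
by rewrite mulrCA ler_wpM2l// ge_min lexx orbT.
Qed.

Lemma weighted_dev_cvg : (\int[leb]_t weighted_dev n t)%E @[n --> \oo] --> 0%E.
Proof.
(* The majorant holds for [n > j], whence the shift by [j + 1]. *)
rewrite -(cvg_shiftn j.+1).
rewrite -(integral0 leb setT).
apply: (@dominated_cvg _ (measurableTypeR R) _ leb setT measurableT
  (fun n t => weighted_dev (n + j.+1) t) (cst 0%E) (EFin \o power_tail K kappa)).
- by move=> n; exact: measurable_weighted_dev.
- move=> t _; have [t0|t0] := leP t 0.
    by apply: cvg_near_cst; apply: nearW => n; exact: weighted_dev_le0.
  rewrite (cvg_shiftn j.+1 (fun n => weighted_dev n t)).
  have : ((t ^+ q.-1)%:E * deviation n t)%E @[n --> \oo] --> ((t ^+ q.-1)%:E * 0)%E.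
    by apply: cvgeZl => //; exact: (deviation_cvg d_gt0 mf f0 fi fM Qf iidX j_gt0 alpha_lt0 t0).
  by rewrite mule0.
- by [].
- exact: integrable_power_tail.
- move=> n t _; apply: weighted_dev_dominated.
  by rewrite addnS ltnS leq_addl.
Qed.

Lemma mean_stat_moment_cvg :
  (\int[P]_w (`|mean_stat n w - mu| ^+ q)%:E)%E @[n --> \oo] --> 0%E.
Proof.
apply: (@squeeze_cvge _ _ _ _ (cst 0%E) _ (fun n => 4%:E * \int[leb]_t weighted_dev n t)%E).
- apply: nearW => n; rewrite mean_stat_moment andbT.
  by apply: integral_ge0 => w _; rewrite lee_fin exprn_ge0.
- exact: cvg_cst.
- rewrite -(mule0 4%:E); apply: cvgeZl => //; exact: weighted_dev_cvg.
Qed.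

End moment_control.

(** * The value of the limit *)

Section gamma_integrals.
Context {R : realType}.
Local Notation leb := (@lebesgue_measure R).

(** The Poisson mass at [k] as a function of the mean [s]. For [s > 0] it is also the density of the
    Gamma distribution of shape [k + 1], and minus the derivative of [poisson_tail k.+1]. *)
Definition erlang (k : nat) (s : R) : R := expR (- s) * s ^+ k / k`!%:R.

Lemma erlang_ge0 k s : 0 <= s -> 0 <= erlang k s.
Proof. by move=> s0; rewrite divr_ge0// mulr_ge0 ?expR_ge0 ?exprn_ge0. Qed.

Lemma continuous_erlang k : continuous (erlang k).
Proof.
move=> s; apply: cvgMl; apply: cvgM; last exact: exprn_continuous.
by apply: continuous_comp; [exact: opp_continuous|exact: continuous_expR].
Qed.

Lemma measurable_erlang k : measurable_fun setT (erlang k : measurableTypeR R -> R).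
Proof. exact: continuous_measurable_fun (@continuous_erlang k). Qed.

Lemma erlang_le1 k s : 0 <= s -> erlang k s <= 1.
Proof.
move=> s0; have := poisson_tail_le1 k.+1 s0; apply: le_trans.
by rewrite poisson_tailS lerDr poisson_tail_ge0.
Qed.

Lemma erlang_cvg0 k : erlang k s @[s --> +oo] --> (0 : R).
Proof.
apply/cvgrPdist_le => e e0; near=> s.
have s0 : 0 < s by near: s; exact: nbhs_pinfty_gt.
have se : k.+1%:R / e <= s by near: s; apply: nbhs_pinfty_ge; exact: num_real.
rewrite sub0r normrN ger0_norm ?erlang_ge0 ?(ltW s0)//.
(* One power of [s] is absorbed into the next mass, which is at most 1; the factor left over decays
   like 1/s. *)
have -> : erlang k s = erlang k.+1 s * (k.+1%:R / s).
  rewrite /erlang factS natrM exprSr; field.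
  by rewrite (gt_eqF s0) nat1r !pnatr_eq0 -!lt0n fact_gt0.
apply: (@le_trans _ _ (k.+1%:R / s)).
  by rewrite ler_piMl ?erlang_le1 ?divr_ge0 ?(ltW s0).
by rewrite ler_pdivrMr// mulrC -ler_pdivrMr.
Unshelve. all: by end_near. Qed.

Lemma poisson_tail_cvg0 k : poisson_tail k s @[s --> +oo] --> (0 : R).
Proof.
elim: k => [|k ih].
  by apply: cvg_near_cst; apply: nearW => s; exact: poisson_tail0.
rewrite -(addr0 (0 : R)); under eq_cvg do rewrite poisson_tailS.
by apply: cvgD => //; exact: erlang_cvg0.
Qed.

Lemma integral_erlang_itvcy k (l : R) : 0 <= l ->
  (\int[leb]_(s in `[l, +oo[) (erlang k s)%:E = (poisson_tail k.+1 l)%:E)%E.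
Proof.
move=> l0; pose F (s : R) := - poisson_tail k.+1 s.
have dF (s : R) : is_derive s 1 F (erlang k s).
  by rewrite /F -[erlang k s]opprK; apply: is_deriveN; exact: is_derive_poisson_tail.
rewrite (@ge0_continuous_FTC2y _ (erlang k) F l 0).
- by rewrite sub0e /F -EFinN opprK.
- by move=> s ls; apply: erlang_ge0; exact: le_trans ls.
- by apply: continuous_subspaceT; exact: continuous_erlang.
- by rewrite -oppr0; apply: cvgN; exact: poisson_tail_cvg0.
- by move=> s _; exact: ex_derive.
- apply: cvg_at_right_filter; apply: differentiable_continuous; apply/derivable1_diffP.
  exact: ex_derive.
- by move=> s _; rewrite derive1E derive_val.
Qed.

Lemma integral_erlang k : (\int[leb]_(s in `]0%R, +oo[) (erlang k s)%:E = 1)%E.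
Proof.
rewrite integral_itv_obnd_cbnd; last first.
  by apply/measurable_EFinP; apply: measurable_funTS; exact: measurable_erlang.
by rewrite integral_erlang_itvcy// poisson_tail_at0.
Qed.

(** The duality between Poisson counts and Gamma waiting times, obtained as the total mass minus the
    mass beyond [l]. *)
Lemma integral_erlang_below k (l : R) : 0 <= l ->
  (\int[leb]_s (below s l * erlang k s)%:E = (1 - poisson_tail k.+1 l)%:E)%E.
Proof.
rewrite le_eqVlt => /predU1P[<-|l0].
  rewrite poisson_tail_at0 subrr integral0_eq// => s _; rewrite /below.
  by case: ltP => //= s0; rewrite ?mul0r// ltNge (ltW s0) mul0r.
have me : measurable_fun setT (fun s : measurableTypeR R => (erlang k s)%:E).
  by apply/measurable_EFinP; exact: measurable_erlang.
have mbe : measurable_fun setT (fun s : measurableTypeR R => (below s l * erlang k s)%:E).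
  apply/measurable_EFinP; apply: measurable_funM; last exact: measurable_erlang.
  exact: measurable_below.
have mie : measurable_fun setT
    (fun s : measurableTypeR R => (erlang k s * \1_(`[l, +oo[%classic) s)%:E).
  apply/measurable_EFinP; apply: measurable_funM; first exact: measurable_erlang.
  exact: measurable_indic.
have be0 s : (0 <= (below s l * erlang k s)%:E)%E.
  rewrite lee_fin /below; case: ltP => /= s0; last by rewrite mul0r.
  by rewrite mulr_ge0// erlang_ge0// ltW.
have ie0 s : (0 <= (erlang k s * \1_(`[l, +oo[%classic) s)%:E)%E.
  rewrite lee_fin indicE; case: (boolP (_ \in _)) => [/set_mem/=|_]; last by rewrite mulr0.
  by rewrite in_itv/= andbT mulr1 => ls; rewrite erlang_ge0// (le_trans (ltW l0)).
have sumE : (\int[leb]_s (below s l * erlang k s)%:E + (poisson_tail k.+1 l)%:E = 1)%E.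
  rewrite -(integral_erlang k) -(integral_erlang_itvcy k (ltW l0)).
  rewrite [X in (_ + X)%E]integral_mkcond [RHS]integral_mkcond.
  under [X in (_ + X)%E]eq_integral do rewrite epatch_indic/= -EFinM.
  rewrite -ge0_integralD//; apply: eq_integral => s _.
  rewrite epatch_indic/= -EFinM -EFinD; congr EFin.
  rewrite !indicE !mem_setE !in_itv/= !andbT /below.
  have [s0|s0] := ltP 0 s; last by rewrite leNgt (le_lt_trans s0 l0) mul0r !mulr0 addr0.
  by case: ltP => _; rewrite ?mul1r ?mul0r ?mulr1 ?mulr0 ?addr0 ?add0r.
by rewrite EFinB -sumE addeK.
Qed.

(* The layers [{t | s < c t^b}] of the Erlang density [s] have length [(s / c)^(1/b)]. *)
Lemma integral_erlang_layers k (b c : R) : b < 0 -> 0 <= c ->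
  (\int[leb]_t ((0 < t)%R%:R * (1 - poisson_tail k.+1 (c * t `^ b)))%:E =
   (c `^ (- b^-1) / k`!%:R)%:E *
     \int[leb]_(s in `]0%R, +oo[) (s `^ (k.+1%:R + b^-1 - 1) * expR (- s))%:E)%E.
Proof.
move=> b0; rewrite le_eqVlt => /predU1P[<-|c0].
  (* For [c = 0] both sides are 0, because 0 is raised to the nonzero exponent [- b^-1]. *)
  rewrite powR0; last by rewrite oppr_eq0 invr_eq0 lt_eqF.
  rewrite mul0r mul0e integral0_eq// => t _.
  by rewrite mul0r poisson_tail_at0 subrr mulr0.
pose lam : {sigma_finite_measure set (measurableTypeR R) -> \bar R} := leb.
pose h (p : measurableTypeR R * measurableTypeR R) : \bar R :=
  ((0 < p.1)%R%:R * (below p.2 (c * p.1 `^ b) * erlang k p.2))%:E.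
have mh : measurable_fun setT h.
  apply/measurable_EFinP; apply: measurable_funM.
    by apply: measurable_natr_bool; apply: measurable_fun_ltr => //; exact: measurable_fst.
  apply: measurable_funM.
    apply: measurable_below; first exact: measurable_snd.
    apply: measurable_funM => //.
    apply: (measurableT_comp (f := @powR R ^~ b)); first exact: measurable_powR.
    exact: measurable_fst.
  exact: (measurableT_comp (measurable_erlang k) measurable_snd).
have be0 s l : 0 <= below s l * erlang k s.
  rewrite /below; case: ltP => /= s0; last by rewrite mul0r.
  by rewrite mulr_ge0// erlang_ge0// ltW.
have h0 p : (0 <= h p)%E by rewrite lee_fin mulr_ge0.
transitivity (\int[lam]_t \int[lam]_s h (t, s))%E.
  apply: eq_integral => t _; rewrite /h/=.
  under [RHS]eq_integral do rewrite EFinM.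
  rewrite ge0_integralZl_EFin//; last 2 first.
  - by move=> s _; rewrite lee_fin.
  - apply/measurable_EFinP; apply: measurable_funM; last exact: measurable_erlang.
    exact: measurable_below.
  by rewrite integral_erlang_below ?mulr_ge0 ?powR_ge0 ?(ltW c0)// EFinM.
rewrite (fubini_tonelli (m1 := lam) (m2 := lam) h mh h0).
rewrite -ge0_integralZl_EFin//; last 3 first.
- by move=> s; rewrite /= in_itv/= andbT => s0; rewrite lee_fin mulr_ge0 ?powR_ge0 ?expR_ge0.
- apply/measurable_EFinP; apply: measurable_funTS; apply: measurable_funM.
    exact: measurable_powR.
  apply: (measurableT_comp (@measurable_expR R)); exact: measurable_funN.
- by rewrite divr_ge0 ?powR_ge0.
rewrite [RHS]integral_mkcond; apply: eq_integral => s _.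
rewrite epatch_indic/= indicE mem_setE in_itv/= andbT /h/=.
have [s0|s0] := ltP 0 s; last first.
  by rewrite mule0 integral0_eq// => t _; rewrite /below (le_gtF s0) mul0r mulr0.
rewrite mule1 (eq_integral (fun t : measurableTypeR R =>
    (erlang k s)%:E * (below t ((s / c) `^ b^-1))%:E)%E); last first.
  move=> t _; rewrite -EFinM; congr EFin; rewrite /below s0/=.
  have [t0|t0] := ltP 0 t; last by rewrite mul0r mulr0.
  rewrite mul1r mulrC; congr (_ * _%:R).
  by rewrite [t < _]ltr_powR_neg ?invr_lt0 ?divr_gt0// invrK ltr_pdivrMr// mulrC.
rewrite ge0_integralZl_EFin//; last 3 first.
- by move=> t _; rewrite lee_fin below_ge0.
- by apply/measurable_EFinP; exact: measurable_below.
- exact: erlang_ge0 (ltW s0).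
rewrite integral_below ?powR_ge0// -!EFinM; congr EFin.
rewrite /erlang powRM ?(ltW s0) ?invr_ge0 ?(ltW c0)//.
rewrite -(powR_inv1 (ltW c0)) -powRrM mulN1r.
rewrite (_ : k.+1%:R + b^-1 - 1 = k%:R + b^-1); last by rewrite -natr1; ring.
rewrite powRD ?(gt_eqF s0) ?implybT// powR_mulrn ?(ltW s0)//.
by field; rewrite pnatr_eq0 -lt0n fact_gt0.
Qed.

End gamma_integrals.

Section limit_value.
Context {R : realType} {d : nat}.
Hypothesis d_gt0 : (0 < d)%N.
Local Notation Rd := (d.-tuple R).
Local Notation lam := (@lebesgue_Rd R d).
Local Notation leb := (@lebesgue_measure R).
Local Notation v := (@unit_ball_volume R d).
Variables (Q : probability Rd R) (f : Rd -> R) (M : R).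
Hypotheses (mf : measurable_fun setT f) (f0 : forall y, 0 <= f y).
Hypotheses (fi : (\int[lam]_y (f y)%:E = 1)%E) (fM : forall y, f y <= M).
Hypothesis Qf : forall A, measurable A -> Q A = (\int[lam]_(y in A) (f y)%:E)%E.
Variables (j : nat) (alpha : R).
Hypotheses (j_gt0 : (0 < j)%N) (alpha_lt0 : alpha < 0) (alpha_gt : - d%:R < alpha).

Let v0 : 0 < v. Proof. exact: unit_ball_volume_gt0. Qed.
Let b := d%:R / alpha.
Let b0 : b < 0. Proof. by rewrite pmulr_rlt0 ?ltr0n// invr_lt0. Qed.
Let b1 : 1 < - b.
Proof. by rewrite /b -mulrN -invrN ltr_pdivlMr ?oppr_gt0// mul1r ltrNl. Qed.
Let binv : b^-1 = alpha / d%:R. Proof. by rewrite invf_div. Qed.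

(** A restatement of the fact that the Erlang density has total mass 1. *)
Lemma Gamma_fun_natE k : Gamma_fun k.+1%:R = k`!%:R :> R.
Proof.
rewrite /Gamma_fun /Rintegral.
rewrite (eq_integral (fun s : measurableTypeR R => k`!%:R%:E * (erlang k s)%:E)%E); last first.
  move=> s; rewrite inE/= in_itv/= andbT => s0; rewrite -EFinM; congr EFin.
  rewrite -natr1 addrK powR_mulrn ?(ltW s0)// /erlang; field.
  by rewrite pnatr_eq0 -lt0n fact_gt0.
rewrite ge0_integralZl_EFin//; last 2 first.
- by move=> s; rewrite /= in_itv/= andbT => s0; rewrite lee_fin erlang_ge0// ltW.
- by apply/measurable_EFinP; apply: measurable_funTS; exact: measurable_erlang.
by rewrite integral_erlang mule1.
Qed.

(** Kept as an extended real until [gint_fin], since [Gamma_fun] records only the finite part. *)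
Let gint := (\int[leb]_(s in `]0%R, +oo[) (s `^ (j%:R + alpha / d%:R - 1) * expR (- s))%:E)%E.

Let gint_ge0 : (0 <= gint)%E.
Proof. by apply: integral_ge0 => s _; rewrite lee_fin mulr_ge0 ?powR_ge0 ?expR_ge0. Qed.

Lemma integral_layers (c : R) : 0 <= c ->
  (\int[leb]_t ((0 < t)%R%:R * (1 - poisson_tail j (c * t `^ b)))%:E =
   (c `^ (- alpha / d%:R) / Gamma_fun j%:R)%:E * gint)%E.
Proof.
rewrite /gint; case: (j) j_gt0 => // k _ c0.
by rewrite integral_erlang_layers// Gamma_fun_natE binv mulNr.
Qed.

(** Finiteness comes from the layer identity at [c = 1]: its left side is dominated by [power_tail]
    with exponent [- b], which exceeds 1 because alpha > -d. *)
Lemma gint_fin : gint = (Gamma_fun (j%:R + alpha / d%:R))%:E.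
Proof.
rewrite /Gamma_fun /Rintegral -/gint fineK// ge0_fin_numE//.
have : ((Gamma_fun j%:R)^-1%:E * gint < +oo)%E.
  have := integral_layers ler01; rewrite powR1 mul1r => <-.
  have /integrableP[_] := integrable_power_tail ler01 b1.
  apply: le_lt_trans; apply: ge0_le_integral => //.
  - move=> t _; rewrite lee_fin mulr_ge0// subr_ge0 poisson_tail_le1//.
    by rewrite mul1r powR_ge0.
  - apply/measurable_EFinP; apply: measurable_funM.
      by apply: measurable_natr_bool; exact: measurable_fun_ltr.
    apply: measurable_funB => //; apply: measurable_poisson_tail.
    apply: measurable_funM => //; exact: measurable_powR.
  - by apply: measurableT_comp => //; apply/measurable_EFinP; exact: measurable_power_tail.
  move=> t _; rewrite /= lee_fin (le_trans _ (ler_norm _))// /power_tail mul1r opprK.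
  rewrite /below; have [t0|t0] := ltP 0 t; last first.
    rewrite mul0r add0r mul1r mulr_ge0 ?powR_ge0// indicE.
  rewrite mul1r mul1r /=.
  case: (j) j_gt0 => // k _.
  have [t1|t1] := ltP t 1.
    rewrite ler_wpDr ?mulr_ge0 ?powR_ge0 ?indicE//.
    by rewrite gerBl poisson_tail_ge0// powR_ge0.
  rewrite add0r indicE mem_set ?mul1r; last by rewrite /= in_itv/= t1.
  rewrite -[X in X - _](@poisson_tail_at0 R k) (le_trans (ler_norm _))//.
  by rewrite (le_trans (poisson_tail_lip _ _ (powR_ge0 _ _)))// sub0r normrN ger0_norm ?powR_ge0.
have G0 : 0 < (Gamma_fun j%:R)^-1 :> R.
  by case: (j) j_gt0 => // k _; rewrite Gamma_fun_natE invr_gt0 ltr0n fact_gt0.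
case: gint gint_ge0 => [r _ _| _|//]; first by rewrite ltry.
by rewrite gt0_muley.
Qed.

Lemma integral_powR_density :
  (\int[Q]_x ((v * f x) `^ (- alpha / d%:R))%:E =
   (v `^ (- alpha / d%:R) * I_rho (1 - alpha / d%:R) f)%:E)%E.
Proof.
set g := - alpha / d%:R.
have g0 : 0 < g by rewrite divr_gt0 ?ltr0n// oppr_gt0.
have mp (h : Rd -> R) p : measurable_fun setT h -> measurable_fun setT (fun x => h x `^ p).
  move=> mh; apply: (measurableT_comp (f := @powR R ^~ p)) => //; exact: measurable_powR.
rewrite (integral_density mf f0 Qf); last 2 first.
- by apply: mp; exact: measurable_funM.
- by move=> x; exact: powR_ge0.
have E y : f y * (v * f y) `^ g = v `^ g * f y `^ (1 - alpha / d%:R).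
  rewrite powRM ?(ltW v0)// mulrCA; congr (_ * _).
  have -> : 1 - alpha / d%:R = 1 + g by rewrite /g mulNr.
  (* Where the density vanishes both sides are 0, the exponents being positive. *)
  have [->|fn0] := eqVneq (f y) 0.
    by rewrite mul0r powR0// gt_eqF// addr_gt0.
  by rewrite powRD ?fn0 ?implybT// powRr1.
under eq_integral do rewrite E EFinM.
rewrite ge0_integralZl_EFin//; last 3 first.
- by move=> y _; rewrite lee_fin powR_ge0.
- by apply/measurable_EFinP; exact: mp.
- exact: powR_ge0.
(* [I_rho] takes a finite part, so finiteness has to be checked: [f <= M] bounds the integrand by a
   multiple of [f]. *)
rewrite EFinM; congr (_ * _)%E; rewrite /I_rho /Rintegral fineK// ge0_fin_numE; last first.
  by apply: integral_ge0 => y _; rewrite lee_fin powR_ge0.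
have -> : 1 - alpha / d%:R = 1 + g by rewrite /g mulNr.
apply: (@le_lt_trans _ _ (\int[lam]_y ((M `^ g)%:E * (f y)%:E))%E).
  apply: ge0_le_integral => //.
  - by move=> y _; rewrite lee_fin powR_ge0.
  - by apply/measurable_EFinP; exact: mp.
  - by apply: emeasurable_funM => //; exact/measurable_EFinP.
  move=> y _; rewrite -EFinM lee_fin.
  have [->|fn0] := eqVneq (f y) 0.
    by rewrite mulr0 powR0// gt_eqF// addr_gt0.
  rewrite powRD ?fn0 ?implybT// powRr1// mulrC ler_wpM2r//.
  by apply: ge0_ler_powR => //; rewrite ?nnegrE ?(ltW g0)// (le_trans (f0 y)).
rewrite ge0_integralZl_EFin ?powR_ge0//; last exact/measurable_EFinP.
  by rewrite fi mule1 ltry.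
by move=> y _; rewrite lee_fin.
Qed.

(** For fixed [x] the integral over the levels is [integral_layers] at [c = v * f x], which leaves a
    power of the density to be integrated over [x]. *)
Lemma integral_limit_tail :
  (\int[leb]_t (limit_tail Q f j alpha t)%:E =
   (v `^ (- alpha / d%:R) * (Gamma_fun (j%:R + alpha / d%:R) / Gamma_fun j%:R)
    * I_rho (1 - alpha / d%:R) f)%:E)%E.
Proof.
pose lebs : {sigma_finite_measure set (measurableTypeR R) -> \bar R} := leb.
pose h (p : measurableTypeR R * Rd) : \bar R := (tail_kernel f j alpha p.1 p.2)%:E.
have mh : measurable_fun setT h.
  by apply/measurable_EFinP; exact: measurable_tail_kernel.
have h0 p : (0 <= h p)%E.
  by rewrite lee_fin; have /andP[] : 0 <= tail_kernel f j alpha p.1 p.2 <= 1 by exact: tail_kernel01.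
transitivity (\int[leb]_t \int[Q]_x h (t, x))%E.
  by apply: eq_integral => t _; rewrite limit_tailE.
rewrite (fubini_tonelli (m1 := lebs) (m2 := Q) h mh h0).
have vf0 x : 0 <= v * f x by apply: mulr_ge0 => //; exact: ltW.
have k0 : 0 <= Gamma_fun (j%:R + alpha / d%:R) / Gamma_fun j%:R :> R.
  rewrite divr_ge0//; first by rewrite -lee_fin -gint_fin.
  by case: (j) j_gt0 => // k _; rewrite Gamma_fun_natE.
under eq_integral => x _.
  rewrite /h/= (_ : (\int[lebs]_t _)%E =
    ((Gamma_fun (j%:R + alpha / d%:R) / Gamma_fun j%:R)%:E
      * ((v * f x) `^ (- alpha / d%:R))%:E)%E); last first.
    rewrite -EFinM -mulrA mulrC (mulrC _^-1) EFinM -gint_fin -integral_layers//.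
    apply: eq_integral => t _; rewrite /tail_kernel -/b; congr (_ * (1 - poisson_tail j _))%:E.
    by ring.
  over.
rewrite ge0_integralZl_EFin//; last 2 first.
- by move=> x _; rewrite lee_fin powR_ge0.
- apply/measurable_EFinP; apply: (measurableT_comp (f := @powR R ^~ (- alpha / d%:R))).
    exact: measurable_powR.
  exact: measurable_funM.
rewrite integral_powR_density -EFinM; congr EFin; ring.
Qed.

End limit_value.

(** * From vanishing moments to convergence in L^q *)

Section Lp_convergence.
Context {disp} {Omega : measurableType disp} {R : realType}.
Variable P : probability Omega R.

(** The q-th power of the norm is the q-th absolute moment; the moments are finite for large [n]
    because they converge to a finite limit. *)
Lemma cvg_in_Lp_moment (q : nat) (Y : (Omega -> R)^nat) (c : R) : (0 < q)%N ->
  (forall n, measurable_fun setT (Y n)) ->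
  (\int[P]_w (`|Y n w - c| ^+ q)%:E)%E @[n --> \oo] --> 0%E ->
  cvg_in_Lp P q%:R Y (cst c).
Proof.
move=> q0 mY /fine_cvgP[Ifin Icvg].
have qn0 : q%:R != 0 :> R by rewrite pnatr_eq0 -lt0n.
have q1 : (1 <= q%:R%:E :> \bar R)%E by rewrite lee_fin ler1n.
have NE n : ('N[P]_q%:R%:E [EFin \o (Y n \- cst c)%R] `^ q%:R =
    \int[P]_w (`|Y n w - c| ^+ q)%:E)%E.
  rewrite poweR_Lnorm//; apply: eq_integral => w _.
  by rewrite -powR_mulrn.
have N0 n : (0 <= 'N[P]_q%:R%:E [EFin \o (Y n \- cst c)%R])%E by exact: Lnorm_ge0.
have Nfin : \forall n \near \oo, ('N[P]_q%:R%:E [EFin \o (Y n \- cst c)%R] < +oo)%E.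
  apply: filterS Ifin => n In; apply: (lty_poweRy qn0).
  by rewrite NE ltey_eq In.
have cL : cst c \in Lfun P q%:R%:E by exact: Lfun_cst.
split => //.
- apply: filterS Nfin => n Nn.
  (* Membership of [Y n] is recovered by adding the constant back to this difference. *)
  have dL : (Y n \- cst c) \in Lfun P q%:R%:E.
    rewrite inE; apply/andP; split; rewrite inE//.
    exact: measurable_funB.
  have -> : Y n = (Y n \- cst c) + cst c by apply/funext => w /=; rewrite subrK.
  by have [_] := Lfun_addr_closed P q1; apply.
- apply/fine_cvgP; split.
    by apply: filterS Nfin => n Nn; rewrite ge0_fin_numE.
  apply/cvgrPdist_le => e e0.
  have eq0 : 0 < e ^+ q by rewrite exprn_gt0.
  have /cvgrPdist_le/(_ _ eq0) Ie := Icvg.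
  near=> n; rewrite sub0r normrN ger0_norm ?fine_ge0//.
  rewrite -(@ler_pXn2r _ q)// ?nnegrE ?fine_ge0// ?(ltW e0)//.
  have : `|0 - fine (\int[P]_w (`|Y n w - c| ^+ q)%:E)%E| <= e ^+ q by near: n.
  by rewrite sub0r normrN -NE fine_poweR powR_mulrn ?fine_ge0// ger0_norm ?exprn_ge0 ?fine_ge0.
Unshelve. all: by end_near. Qed.

End Lp_convergence.

Theorem theorem2 (R : realType) (disp : measure_display)
    (Omega : measurableType disp) (P : probability Omega R)
    (d j q : nat) (alpha : R)
    (f : d.-tuple R -> R) (X : nat -> {RV P >-> d.-tuple R})
    (d_gt0 : (0 < d)%N) (j_gt0 : (0 < j)%N)
    (q12 : q = 1%N \/ q = 2%N)
    (alpha_gt : - (d%:R / q%:R) < alpha) (alpha_lt0 : alpha < 0)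
    (f_pdf : pdf_Rd f) (f_bounded : bounded_fun f)
    (X_indep : mutually_independent X)
    (X_density : forall i, has_density (X i) f) :
  cvg_in_Lp P q%:R
    (fun n w => n%:R^-1 * nn_stat j alpha X n w)
    (cst (unit_ball_volume d `^ (- alpha / d%:R)
          * (Gamma_fun (j%:R + alpha / d%:R) / Gamma_fun j%:R)
          * I_rho (1 - alpha / d%:R) f)).
Proof.
have [mf f0 fi] := f_pdf.
have [M fM] : exists M, forall y, f y <= M.
  (* Boundedness provides a bound by every real above [M], in particular by [M + 1]. *)
  have [M [_ fM]] := f_bounded; exists (M + 1) => y.
  by apply: le_trans (ler_norm _) (fM _ _ _ I); rewrite ltrDl.
pose Q : probability (d.-tuple R) R := distribution P (X 0%N).
have Qf A : measurable A -> Q A = (\int[lebesgue_Rd d]_(y in A) (f y)%:E)%E.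
  exact: X_density.
have iidX : iid Q X by split=> // i A mA; rewrite Qf// X_density.
have q0 : (0 < q)%N by case: q12 => ->.
(* The value of the limit is computed under alpha > -d, which follows from q >= 1. *)
have alpha_gtd : - d%:R < alpha.
  apply: le_lt_trans alpha_gt; rewrite lerN2 ler_pdivrMr ?ltr0n//.
  by rewrite ler_peMr// ler1n.
apply: cvg_in_Lp_moment => //.
  move=> n; exact: (measurable_mean_stat X alpha j_gt0 n).
apply: (mean_stat_moment_cvg d_gt0 mf f0 fi fM Qf iidX j_gt0 alpha_lt0 q12 alpha_gt).
exact: integral_limit_tail.
Qed.
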